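(* Let $X$ be a Köthe function space on $[0,1]$. If $X$ has $M_p$ for some $p$ with $2<p<\infty$, then $X$ is lattice isomorphic to $L_2(0,1)$.
   Context: A Banach space $X$ has $M_p$ if for every subspace $E\subseteq X$ every bounded linear operator $T:E\to\ell_p$ extends to a bounded linear operator $\widetilde T:X\to\ell_p$. A Köthe function space on $[0,1]$ (with Lebesgue measure) is a Banach space $X$ of (equivalence classes of) integrable functions on $[0,1]$ such that if $|f|\le|g|$ a.e. with $f$ measurable and $g\in X$, then $f\in X$ and $\|f\|\le\|g\|$, and such that the characteristic functions of measurable sets belong to $X$; it is a Banach lattice in the pointwise a.e. order. *)

(* Defs.v *)
From HB Require Import structures.
From mathcomp Require Import all_boot all_order all_algebra.
From mathcomp Require Import all_classical all_reals all_analysis.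

Set Implicit Arguments.
Unset Strict Implicit.
Unset Printing Implicit Defensive.

Import Order.TTheory GRing.Theory Num.Theory.
Import numFieldNormedType.Exports.

Local Open Scope classical_set_scope.
Local Open Scope ring_scope.

(* ell_p is Lfun counting p%:E : the sequences of finite L^p-norm for the
   counting measure on nat, for which a.e. equality is equality.
   An operator on the closed subspace E is given by a map T on X whose values
   outside E are irrelevant. *)
Definition has_M (R : realType) (X : completeNormedModType R) (p : R) : Prop :=
  forall (E : {pred X}) (T : X -> nat -> R),
    closed [set` E] -> submod_closed E ->
    (forall x, x \in E -> T x \in Lfun (@counting nat R) p%:E) ->
    (forall (a : R) x y, x \in E -> y \in E -> T (a *: x + y) = a *: T x + T y) ->
    (exists C : R, forall x, x \in E ->
      ('N[@counting nat R]_p%:E[EFin \o T x] <= (C * `|x|)%:E)%E) ->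
  exists T' : {linear X -> (nat -> R)},
    [/\ forall x, T' x \in Lfun (@counting nat R) p%:E,
        exists C : R, forall x,
          ('N[@counting nat R]_p%:E[EFin \o T' x] <= (C * `|x|)%:E)%E
      & forall x, x \in E -> T' x = T x].

(* A measurable function on [0, 1] is encoded by a measurable function on the
   line, only its values on [0, 1] being relevant. *)
Definition leb01 (R : realType) : {measure set (measurableTypeR R) -> \bar R} :=
  mrestr (@lebesgue_measure R) (measurable_itv `[(0 : R), 1]).

(* The elements of X are classes modulo a.e. equality; frepr picks a
   representative in each of them. *)
Record kothe_space (R : realType) (X : completeNormedModType R) := KotheSpace {
  frepr :> X -> measurableTypeR R -> R ;
  frepr_integrable : forall x, frepr x \in Lfun (leb01 R) 1%E ;
  frepr_linear : forall (a : R) x y,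
    frepr (a *: x + y) = (fun t => a * frepr x t + frepr y t) %[ae leb01 R] ;
  frepr_inj : forall x y, frepr x = frepr y %[ae leb01 R] -> x = y ;
  frepr_ideal : forall (f : {mfun measurableTypeR R >-> R}) x,
    (\forall t \ae leb01 R, `|f t| <= `|frepr x t|) ->
    exists2 y, frepr y = f %[ae leb01 R] & `|y| <= `|x| ;
  frepr_indic : forall A : set (measurableTypeR R), measurable A ->
    exists x, frepr x = \1_A %[ae leb01 R]
}.

(* U x is a representative of the image of x in L_2(0, 1). *)
Definition lattice_isomorphic_L2 (R : realType) (X : completeNormedModType R)
    (K : kothe_space X) : Prop :=
  exists U : X -> measurableTypeR R -> R,
    [/\ forall x, U x \in Lfun (leb01 R) 2%:E,
        forall (a : R) x y,
          U (a *: x + y) = (fun t => a * U x t + U y t) %[ae leb01 R],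
        forall g, g \in Lfun (leb01 R) 2%:E -> exists x, U x = g %[ae leb01 R],
        exists c C : R, [/\ 0 < c, 0 < C & forall x,
          ((c * `|x|)%:E <= 'N[leb01 R]_2%:E[EFin \o U x] <= (C * `|x|)%:E)%E]
      & forall x y z,
          (K z = K x \max K y %[ae leb01 R] ->
           U z = U x \max U y %[ae leb01 R]) /\
          (K z = K x \min K y %[ae leb01 R] ->
           U z = U x \min U y %[ae leb01 R])].

(* Main.v *)
(* Write m(A) for the norm of the indicator of A. If X carried arbitrarily bad
   failures of the lower, or of the upper, 2-estimate for disjoint multiples of
   indicators, each failure would give a finite-dimensional operator into l_p
   with only large extensions to X: Rademacher functions supplied by Khinchine's
   inequality, resp. a random sign matrix a la Kashin, and a trace argument. A
   gliding hump glues such operators supported on disjoint sets into one operator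
   without bounded extension, contradicting M_p. A localization argument moves
   arbitrarily bad failures to disjoint sets, so both 2-estimates hold with
   uniform constants. Hence m^2 is equivalent to a finite measure, absolutely
   continuous with respect to Lebesgue measure; if w is its density, the norm of
   f is equivalent to the L_2-norm of f sqrt(w) on simple functions, hence
   everywhere, and x |-> x sqrt(w) is the required isomorphism. *)

Require Import Defs.
From HB Require Import structures.
From mathcomp Require Import all_boot all_order all_algebra.
From mathcomp Require Import all_classical all_reals all_analysis.
From mathcomp Require Import measurable_realfun ring lra.

Import Order.TTheory GRing.Theory Num.Theory.
Import numFieldNormedType.Exports.

Set Implicit Arguments.
Unset Strict Implicit.
Unset Printing Implicit Defensive.

Local Open Scope ring_scope.

(** * Averages over finite probability spaces *)

(** A failure takes its values in [L_p] of a finite uniform probability space, where independence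
    and moments are at hand; the gliding hump turns these values into coordinates of [ell_p] by
    rescaling. In both constructions the operator sends the chosen vectors [e_i] to multiples of
    random variables [y_i] (sparse signs, resp. Rademacher functions). For an extension of norm at
    most [M], a weighted sum of the averages of [S e_i * y_i] is known exactly, and moment bounds
    contradict its value. In the lower case [p > 2] enters through the exponent [1/2 - 1/p]: signs
    that are nonzero with small probability [be] require only a Rademacher perturbation of size
    [sqrt be], whose share in the trace is of order [be * be^(1/2 - 1/p)], negligible against [be].
    The Rademacher vectors must be disjoint from the bad family, so lower failures are treated in
    one half of [0, 1] at a time. Localization in turn requires absolute continuity of the norms of
    indicators. It can be proved beforehand, because its negation yields lower failures that already
    live on disjoint sets. *)

Lemma le_of_eq (d : Order.disp_t) (T : porderType d) (x y : T) : x = y -> (x <= y)%O.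
Proof. by move=> ->. Qed.

Section Average.
Context {R : realType}.
Implicit Types W : finType.

Definition avg W (f : W -> R) : R := (\sum_w f w) / #|W|%:R.

Lemma eq_avg W (f g : W -> R) : f =1 g -> avg f = avg g.
Proof. by move=> fg; rewrite /avg; under eq_bigr do rewrite fg. Qed.

Lemma avgD W (f g : W -> R) : avg (fun w => f w + g w) = avg f + avg g.
Proof. by rewrite /avg big_split mulrDl. Qed.

Lemma avgZ W a (f : W -> R) : avg (fun w => a * f w) = a * avg f.
Proof. by rewrite /avg -mulr_sumr mulrA. Qed.

Lemma avg_sum W (I : Type) (r : seq I) (P : pred I) (f : I -> W -> R) :
  avg (fun w => \sum_(i <- r | P i) f i w) = \sum_(i <- r | P i) avg (f i).
Proof. by rewrite /avg exchange_big /= mulr_suml. Qed.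

Lemma exchange_avg W (V : finType) (f : W -> V -> R) :
  avg (fun w => avg (f w)) = avg (fun v => avg (f^~ v)).
Proof.
rewrite /avg -!mulr_suml exchange_big /= -!mulrA; congr (_ * _).
by rewrite mulrC.
Qed.

Lemma ler_avg W (f g : W -> R) : (forall w, f w <= g w) -> avg f <= avg g.
Proof.
by move=> fg; rewrite /avg ler_wpM2r ?invr_ge0 ?ler0n// ler_sum.
Qed.

Lemma avg_ge0 W (f : W -> R) : (forall w, 0 <= f w) -> 0 <= avg f.
Proof.
by move=> f0; rewrite /avg divr_ge0 ?ler0n// sumr_ge0.
Qed.

Lemma avg_cst W a : (0 < #|W|)%N -> avg (fun _ : W => a) = a.
Proof.
by move=> W0; rewrite /avg sumr_const -[a *+ _]mulr_natr mulfK// pnatr_eq0 -lt0n.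
Qed.

Lemma avg_exists_lt W (f : W -> R) a : (0 < #|W|)%N -> avg f < a ->
  exists w, f w < a.
Proof.
move=> W0 fa; apply/not_existsP => H.
have : a <= avg f; last by rewrite leNgt fa.
rewrite -[a in a <= _](@avg_cst W)//; apply: ler_avg => w.
by rewrite leNgt; apply/negP/H.
Qed.

Lemma avg_prod (I W : finType) (f : I -> W -> R) :
  avg (fun w : {ffun I -> W} => \prod_i f i (w i)) = \prod_i avg (f i).
Proof.
rewrite /avg -bigA_distr_bigA big_split /= card_ffun; congr (_ * _).
by rewrite prodr_const natrX exprVn.
Qed.

(** Cauchy-Schwarz, from the nonnegativity of a quadratic form in [s] and [t], evaluated at
    [(b, - c)]. *)
Lemma sum_mul_sq (I : finType) (x y : I -> R) :
  (\sum_i x i * y i) ^+ 2 <= (\sum_i x i ^+ 2) * (\sum_i y i ^+ 2).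
Proof.
set a := \sum_i x i ^+ 2; set b := \sum_i y i ^+ 2; set c := \sum_i _.
have a0 : 0 <= a by apply: sumr_ge0 => i _; exact: sqr_ge0.
have b0 : 0 <= b by apply: sumr_ge0 => i _; exact: sqr_ge0.
have H s t : 0 <= s ^+ 2 * a + 2 * (s * t) * c + t ^+ 2 * b.
  rewrite /a /b /c !mulr_sumr -!big_split /=; apply: sumr_ge0 => i _.
  have -> : s ^+ 2 * x i ^+ 2 + 2 * (s * t) * (x i * y i) + t ^+ 2 * y i ^+ 2
    = (s * x i + t * y i) ^+ 2 by ring.
  exact: sqr_ge0.
have [b_eq|bn] := eqVneq b 0.
  suff -> : c = 0 by rewrite b_eq expr0n mulr0.
  apply/eqP/negPn/negP => c0; have := H 1 (- (a + 1) / c); rewrite b_eq.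
  have -> : 2 * (1 * (- (a + 1) / c)) * c = - 2 * (a + 1) by field.
  by lra.
have bp : 0 < b by rewrite lt_def bn.
have := H b (- c); move=> H1.
have : 0 <= b * (a * b - c ^+ 2).
  by apply: le_trans H1 _; apply: le_of_eq; ring.
by rewrite pmulr_rge0// subr_ge0.
Qed.

Lemma avg_mul_sq W (f g : W -> R) :
  (avg (fun w => f w * g w)) ^+ 2 <=
  avg (fun w => f w ^+ 2) * avg (fun w => g w ^+ 2).
Proof.
rewrite /avg mulrACA -expr2 exprMn; apply: ler_wpM2r; first exact: sqr_ge0.
exact: sum_mul_sq.
Qed.

End Average.

(** * Random sign sums, Khinchine's inequality and random sign matrices *)

Section Signs.
Context {R : realType}.

Definition sgb (b : bool) : R := (-1) ^+ b.

Lemma sgb_sq b : sgb b * sgb b = 1.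
Proof. by rewrite /sgb -signr_addb addbb. Qed.

Lemma normr_sgb b : `|sgb b| = 1.
Proof. by rewrite /sgb normrX normrN1 expr1n. Qed.

Lemma card_signs_gt0 (I : finType) : (0 < #|{ffun I -> bool}|)%N.
Proof. by rewrite card_ffun card_bool expn_gt0. Qed.

Lemma avg_bool (f : bool -> R) : avg f = (f true + f false) / 2.
Proof. by rewrite /avg big_bool card_bool. Qed.

Lemma avg_sgb_mul (I : finType) (i j : I) :
  avg (fun s : {ffun I -> bool} => sgb (s i) * sgb (s j)) = (i == j)%:R.
Proof.
have [<-|ij] := eqVneq i j.
  by under eq_avg do rewrite sgb_sq; rewrite avg_cst// card_signs_gt0.
(* The product of two coordinates is written as a product over all coordinates, so that independence
   ([avg_prod]) applies. *)
pose f k b : R := (if k == i then sgb b else 1) * (if k == j then sgb b else 1).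
transitivity (avg (fun s : {ffun I -> bool} => \prod_k f k (s k))).
  apply: eq_avg => s; rewrite /f big_split /= -!big_mkcond /=.
  by rewrite !big_pred1_eq.
rewrite avg_prod (bigD1 i)//= avg_bool /f eqxx (negbTE ij) !mulr1.
by rewrite /sgb expr1 expr0 addNr !mul0r.
Qed.

Lemma avg_sign_sum_sq (I : finType) (x : I -> R) :
  avg (fun s : {ffun I -> bool} => (\sum_i sgb (s i) * x i) ^+ 2) =
  \sum_i x i ^+ 2.
Proof.
transitivity (\sum_i \sum_j x i * x j *
   avg (fun s : {ffun I -> bool} => sgb (s i) * sgb (s j))).
  under eq_bigr do under eq_bigr do rewrite -avgZ.
  under eq_bigr do rewrite -avg_sum.
  rewrite -avg_sum; apply: eq_avg => s.
  rewrite expr2 mulr_suml; apply: eq_bigr => i _.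
  by rewrite mulr_sumr; apply: eq_bigr => j _; ring.
apply: eq_bigr => i _; rewrite (bigD1 i)//= avg_sgb_mul eqxx mulr1 big1.
  by rewrite addr0.
by move=> j ji; rewrite avg_sgb_mul eq_sym (negbTE ji) mulr0.
Qed.

(** The bounds [expR y * (1 - y) <= 1] at [y = x] and [y = - x] give [cosh x <= 1 / (1 - x ^+ 2)],
    and this is at most [1 + 2 * x ^+ 2] when [x ^+ 2 <= 1 / 2]. *)
Lemma expR_half_cosh (x : R) : `|x| <= 1 / 2 ->
  (expR x + expR (- x)) / 2 <= 1 + 2 * x ^+ 2.
Proof.
move=> x2.
have H (y : R) : `|y| <= 1 / 2 -> expR y * (1 - y) <= 1.
  move=> y2; have := expR_ge1Dx (- y); rewrite expRN => H.
  rewrite -ler_pdivlMl ?expR_gt0// mulr1; exact: H.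
have H1 := H _ x2; have H2 := H (- x) _; rewrite normrN in H2.
have {}H2 := H2 x2; move: x2; rewrite ler_norml => /andP[xl xr].
have e1 : 0 < expR x := expR_gt0 x. have e2 : 0 < expR (- x) := expR_gt0 _.
have xx : x ^+ 2 <= 1 / 4 by nra.
have A : (expR x + expR (- x)) * (1 - x ^+ 2) <= 2 by nra.
nra.
Qed.

(** Raise [s / p <= expR (s / p)] to the power [p]. *)
Lemma powR_le_expR (p s : R) : 0 < p -> 0 <= s -> s `^ p <= p `^ p * expR s.
Proof.
move=> p0 s0; have -> : s = p * (s / p) by field; lra.
have sp : 0 <= s / p by apply: divr_ge0 => //; exact: ltW.
rewrite powRM//; last exact: ltW.
apply: ler_wpM2l; first exact: powR_ge0.
rewrite [p * _]mulrC expRM; apply: ge0_ler_powR; rewrite ?nnegrE ?expR_ge0// 1?ltW//.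
by apply: lt_le_trans (expR_ge1Dx _); rewrite ltrDr.
Qed.

Section ExpMoment.
Variables (W : finType) (y : W -> R) (be : R).
Hypothesis W0 : (0 < #|W|)%N.
Hypothesis be0 : 0 <= be.
Hypothesis hexp : forall x : R, `|x| <= 1 / 2 ->
  avg (fun v => expR (x * y v)) <= 1 + 2 * be * x ^+ 2.

(** [hexp] is a subgaussian bound of variance [be], applied to signs with [be = 1] and to sparse
    signs with [be] small. Independence multiplies the bounds; the absolute value costs the factor
    2. *)
Lemma avg_expR_sum (I : finType) (x : I -> R) : (forall i, `|x i| <= 1 / 2) ->
  avg (fun w : {ffun I -> W} => expR (`| \sum_i x i * y (w i) |)) <=
  2 * expR (2 * be * \sum_i x i ^+ 2).
Proof.
have H (z : I -> R) : (forall i, `|z i| <= 1 / 2) ->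
    avg (fun w : {ffun I -> W} => expR (\sum_i z i * y (w i))) <=
    expR (2 * be * \sum_i z i ^+ 2).
  move=> zi; under eq_avg do rewrite expR_sum.
  rewrite (avg_prod (fun i v => expR (z i * y v))) mulr_sumr expR_sum.
  apply: ler_prod => i _; rewrite avg_ge0/=; last by move=> w; exact: expR_ge0.
  exact: le_trans (hexp (zi i)) (expR_ge1Dx _).
move=> xi; apply: (@le_trans _ _ (avg (fun w : {ffun I -> W} =>
   expR (\sum_i x i * y (w i)) + expR (\sum_i (- x i) * y (w i))))).
  apply: ler_avg => w; under [X in _ + expR X]eq_bigr do rewrite mulNr.
  rewrite sumrN; case: ler0P => _; first by rewrite lerDr expR_ge0.
  by rewrite lerDl expR_ge0.
rewrite avgD mulr_natl mulr2n; apply: lerD; first exact: H.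
have := H (fun i => - x i); under eq_bigr do rewrite sqrrN; apply => i.
by rewrite normrN.
Qed.

(** A moment inequality of Rosenthal type: the [L_p] norm of the sum is controlled by the largest
    coefficient and by [sqrt be] times the [ell_2] norm, both at most [D]. Dividing by [2 * D]
    brings the coefficients into the range of [avg_expR_sum]. *)
Lemma avg_powR_sum (I : finType) (x : I -> R) (p D : R) : 0 < p -> 0 < D ->
  (forall i, `|x i| <= D) -> be * \sum_i x i ^+ 2 <= D ^+ 2 ->
  avg (fun w : {ffun I -> W} => `| \sum_i x i * y (w i) | `^ p) <=
  ((2 * p) `^ p * (2 * expR 1)) * D `^ p.
Proof.
move=> p0 D0 xD xs; pose z i := x i / (2 * D).
have zh i : `|z i| <= 1 / 2.
  rewrite /z normrM normfV [`|2 * D|]ger0_norm; last by nra.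
  by rewrite ler_pdivrMr; [have := xD i; lra|nra].
have zs : 2 * be * \sum_i z i ^+ 2 <= 1.
  under eq_bigr do rewrite /z expr_div_n.
  rewrite -mulr_suml; set S := \sum_i _ in xs *.
  have -> : 2 * be * (S / (2 * D) ^+ 2) = (be * S) * (2 * D ^+ 2)^-1 by field; lra.
  by rewrite ler_pdivrMr; nra.
apply: (@le_trans _ _ ((2 * D) `^ p * (p `^ p *
   avg (fun w : {ffun I -> W} => expR (`| \sum_i z i * y (w i) |))))).
  rewrite -!avgZ; apply: ler_avg => w.
  have -> : \sum_i x i * y (w i) = (2 * D) * \sum_i z i * y (w i).
    by rewrite mulr_sumr; apply: eq_bigr => i _; rewrite /z; field; lra.
  rewrite normrM [`|2 * D|]ger0_norm; last by nra.
  rewrite [X in X <= _]powRM ?normr_ge0//; last by nra.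
  by apply: ler_wpM2l; [exact: powR_ge0|exact: powR_le_expR].
have H := avg_expR_sum zh.
have H2 : avg (fun w : {ffun I -> W} => expR (`| \sum_i z i * y (w i) |)) <= 2 * expR 1.
  by apply: le_trans H _; rewrite ler_wpM2l// ler_expR.
rewrite !powRM//; [|exact: ltW..].
have : 0 <= 2 `^ p * D `^ p * p `^ p by rewrite !mulr_ge0 ?powR_ge0.
move=> a0; have := ler_wpM2l a0 H2; lra.
Qed.

End ExpMoment.

Lemma avg_bool_expR (x : R) : `|x| <= 1 / 2 ->
  avg (fun b => expR (x * sgb b)) <= 1 + 2 * 1 * x ^+ 2.
Proof.
by move=> /expR_half_cosh; rewrite avg_bool /sgb expr1 expr0 mulrN1 !mulr1 addrC.
Qed.

Lemma avg_sign_expR (I : finType) (x : I -> R) : (forall i, `|x i| <= 1 / 2) ->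
  avg (fun s : {ffun I -> bool} => expR (`| \sum_i x i * sgb (s i) |)) <=
  2 * expR (2 * \sum_i x i ^+ 2).
Proof.
move=> xi; have := @avg_expR_sum _ (fun b => sgb b) 1.
rewrite mulr1; apply => // z zh; have := avg_bool_expR zh; rewrite mulr1; exact.
Qed.

Lemma expR_le_pow4 (s : R) : s ^+ 4 <= 384 * expR (`|s| / 2).
Proof.
have s0 : 0 <= `|s| / 2 by rewrite divr_ge0.
have := expR_ge1Dxn 3 s0.
have -> : (4`!)%:R = 24 :> R by [].
have -> : s ^+ 4 = `|s| ^+ 4 by rewrite -normrX ger0_norm// exprn_even_ge0.
by move: (expR _) => e; rewrite exprMn; lra.
Qed.

Lemma expR_half_le2 : expR (1 / 2) <= 2 :> R.
Proof.
have := expR_ge1Dx (- (1 / 2) : R); rewrite expRN => H.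
by move: H; rewrite -[X in _ <= X]mul1r ler_pdivlMr ?expR_gt0//; lra.
Qed.

(** The constant is [384 * 4]: the first factor is [24 * 2 ^ 4] from [expR_le_pow4], and the
    exponential moment of the halved sum is at most [2 * expR (1 / 2) <= 4]. *)
Lemma avg_sign_pow4 (I : finType) (x : I -> R) : \sum_i x i ^+ 2 = 1 ->
  avg (fun s : {ffun I -> bool} => (\sum_i sgb (s i) * x i) ^+ 4) <= 1536.
Proof.
move=> x1; have xi i : `|x i / 2| <= 1 / 2.
  rewrite normrM [`|2^-1|]ger0_norm// ler_pM2r// -(@ler_pXn2r _ 2)// ?nnegrE//.
  rewrite expr1n -normrX ger0_norm ?sqr_ge0// -x1 (bigD1 i)//= lerDl.
  by apply: sumr_ge0 => j _; exact: sqr_ge0.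
have := avg_sign_expR xi.
have -> : \sum_i (x i / 2) ^+ 2 = 1 / 4.
  under eq_bigr do rewrite expr_div_n.
  by rewrite -mulr_suml x1; field.
have -> : 2 * (1 / 4) = 1 / 2 :> R by field.
move=> H; have := expR_half_le2 => H2.
apply: (@le_trans _ _ (384 * avg (fun s : {ffun I -> bool} =>
   expR (`| \sum_i x i / 2 * sgb (s i) |)))); last by lra.
rewrite -avgZ; apply: ler_avg => s; apply: le_trans (expR_le_pow4 _) _.
apply: ler_wpM2l; first exact: ler0n.
rewrite ler_expR; apply: le_of_eq.
rewrite -[X in _ / X](@ger0_norm _ 2)// -normf_div mulr_suml.
by congr (`| _ |); apply: eq_bigr => i _; field.
Qed.

(** With [u = |s / 40|] this is [u * (u - 1) ^+ 2 * (u + 2) >= 0]. The scale 40 weakens the quartic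
    term enough for the fourth moment bound 1536 to leave an average of at least [1 / 40]. *)
Lemma normr_ge_quartic (s : R) : 60 * (s / 40) ^+ 2 - 20 * (s / 40) ^+ 4 <= `|s|.
Proof.
have -> : s = 40 * (s / 40) by field.
have -> : 40 * (s / 40) / 40 = s / 40 by field.
move: (s / 40) => v; rewrite normrM [`|40|]ger0_norm//.
have -> : v ^+ 4 = `|v| ^+ 4 by rewrite -normrX ger0_norm// exprn_even_ge0.
have -> : v ^+ 2 = `|v| ^+ 2 by rewrite -normrX ger0_norm// sqr_ge0.
have : 0 <= `|v| by []; set u : R := `|v| => u0.
have : 0 <= u * (u - 1) ^+ 2 * (u + 2) by apply: mulr_ge0; [apply: mulr_ge0 => //; exact: sqr_ge0|lra].
have -> : u * (u - 1) ^+ 2 * (u + 2) = u ^+ 4 - 3 * u ^+ 2 + 2 * u by ring.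
lra.
Qed.

Lemma khinchine_unit (I : finType) (x : I -> R) : \sum_i x i ^+ 2 = 1 ->
  1 / 40 <= avg (fun s : {ffun I -> bool} => `| \sum_i sgb (s i) * x i |).
Proof.
move=> x1; have H := avg_sign_pow4 x1.
have H2 := avg_sign_sum_sq x; rewrite x1 in H2.
pose xi (s : {ffun I -> bool}) := \sum_i sgb (s i) * x i.
have : avg (fun s => (60 / 40 ^+ 2) * xi s ^+ 2 +
     (- (20 / 40 ^+ 4)) * xi s ^+ 4) <= avg (fun s => `|xi s|).
  apply: ler_avg => s; have := normr_ge_quartic (xi s).
  by rewrite !expr_div_n; move: (40 ^+ 2) (40 ^+ 4) => *; lra.
rewrite avgD !avgZ H2 => H3; apply: le_trans H3.
have : 20 / 40 ^+ 4 * avg (fun s => xi s ^+ 4) <= 20 / 40 ^+ 4 * 1536.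
  by apply: ler_wpM2l => //; rewrite divr_ge0// exprn_ge0.
lra.
Qed.

Lemma khinchine (I : finType) (x : I -> R) :
  Num.sqrt (\sum_i x i ^+ 2) / 40 <=
  avg (fun s : {ffun I -> bool} => `| \sum_i sgb (s i) * x i |).
Proof.
set S := \sum_i _.
have S0 : 0 <= S by apply: sumr_ge0 => i _; exact: sqr_ge0.
have [->|Sn] := eqVneq S 0; first by rewrite sqrtr0 mul0r; apply: avg_ge0.
have s0 : 0 < Num.sqrt S by rewrite sqrtr_gt0 lt_def Sn.
have x1 : \sum_i (x i / Num.sqrt S) ^+ 2 = 1.
  under eq_bigr do rewrite expr_div_n sqr_sqrtr//.
  by rewrite -mulr_suml divff.
have := khinchine_unit x1.
under eq_avg => s do under eq_bigr do rewrite mulrA.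
under eq_avg => s do rewrite -mulr_suml normrM normfV (ger0_norm (ltW s0)) mulrC.
rewrite avgZ => H; have := ler_wpM2l (ltW s0) H.
by rewrite mulVKf ?gt_eqF//; lra.
Qed.

Lemma natr_geom_le (N : nat) : \sum_(k < N) (1 / 2 : R) ^+ k <= 2.
Proof.
suff : \sum_(k < N) (1 / 2 : R) ^+ k = 2 - 2 * (1 / 2) ^+ N.
  by move=> ->; have : 0 <= (1 / 2 : R) ^+ N; [rewrite exprn_ge0//; lra|lra].
elim: N => [|N IH]; first by rewrite big_ord0 expr0; lra.
by rewrite big_ord_recr /= IH exprS; lra.
Qed.

Lemma two_powr_le_expR (n : nat) : 2 ^+ n <= expR n%:R :> R.
Proof.
rewrite -[n%:R]mulr1 expRM_natl lerXn2r ?nnegrE ?expR_ge0//.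
by have := expR_ge1Dx (1 : R).
Qed.

(* The point [n] is weighed by [2 ^- (\sum_j n j)]. *)
Lemma card_small_sum (d N : nat) :
  \sum_(n : {ffun 'I_d -> 'I_N.+1} | (\sum_j n j <= N)%N) 1 <=
  2 ^+ N * 2 ^+ d :> R.
Proof.
apply: (@le_trans _ _ (\sum_(n : {ffun 'I_d -> 'I_N.+1})
    2 ^+ N * \prod_j (1 / 2 : R) ^+ (n j))).
  rewrite [X in _ <= X](bigID (fun n : {ffun 'I_d -> 'I_N.+1} =>
    (\sum_j n j <= N)%N)) /= -[X in X <= _]addr0; apply: lerD.
    apply: ler_sum => n nN; rewrite prodrXr.
    rewrite -[N in 2 ^+ N](subnK nN) exprD -mulrA -exprMn.
    have -> : 2 * (1 / 2) = 1 :> R by field.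
    by rewrite expr1n mulr1 exprn_ege1// ler1n.
  apply: sumr_ge0 => n _; rewrite mulr_ge0 ?exprn_ge0//.
  by apply: prodr_ge0 => j _; rewrite exprn_ge0//; lra.
rewrite -mulr_sumr ler_wpM2l ?exprn_ge0//.
rewrite -(bigA_distr_bigA (fun _ (k : 'I_N.+1) => (1 / 2 : R) ^+ k)).
rewrite -[X in _ <= _ ^+ X](card_ord d) -prodr_const.
apply: ler_prod => j _; rewrite natr_geom_le andbT.
by apply: sumr_ge0 => k _; rewrite exprn_ge0//; lra.
Qed.

(** A convex function on the cube is maximal at a vertex. Once the signs [tau] of the inner sums are
    fixed, the expression is linear in [r], and the vertex is given by the signs of its coefficients
    [c]. *)
Lemma sum_norm_sign (d m : nat) (G : 'I_m -> 'I_d -> bool) (r : 'I_d -> R) a :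
  (forall j, `|r j| <= 1) ->
  (forall s : {ffun 'I_d -> bool},
     \sum_i `|\sum_j sgb (G i j) * sgb (s j)| <= a) ->
  \sum_i `|\sum_j sgb (G i j) * r j| <= a.
Proof.
move=> r1 H.
pose tau i := sgb (\sum_j sgb (G i j) * r j < 0).
have E (u : R) : `|u| = sgb (u < 0) * u.
  by rewrite /sgb; case: ltrP => h /=; rewrite ?expr1 ?expr0 ?mulN1r ?mul1r;
     [rewrite ltr0_norm|rewrite ger0_norm].
pose c j := \sum_i tau i * sgb (G i j).
have -> : \sum_i `|\sum_j sgb (G i j) * r j| = \sum_j c j * r j.
  under eq_bigr => i _ do rewrite E -/(tau i) mulr_sumr.
  rewrite exchange_big /=; apply: eq_bigr => j _; rewrite /c mulr_suml.
  by apply: eq_bigr => i _; rewrite mulrA.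
apply: le_trans (H [ffun j => c j < 0]).
apply: (@le_trans _ _ (\sum_j c j * sgb (c j < 0))).
  apply: ler_sum => j _; rewrite [X in _ <= X]mulrC -E.
  by apply: le_trans (ler_norm _) _; rewrite normrM ler_piMr.
under eq_bigr do rewrite mulr_suml.
rewrite exchange_big /=; apply: ler_sum => i _.
under eq_bigr => j _ do rewrite -mulrA.
rewrite -mulr_sumr; apply: le_trans (ler_norm _) _.
rewrite normrM normr_sgb mul1r; apply: le_of_eq.
by congr (`|_|); apply: eq_bigr => j _; rewrite ffunE.
Qed.

(** A lower deviation bound: [expR (- u) <= 1 - u + u ^+ 2] is averaged, with first moment at least
    [1 / 40] by Khinchine and second moment 1. The value of [t] makes [t / 40 = 2 * t ^+ 2], which
    leaves [1 - t ^+ 2]. *)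
Lemma avg_expRN_norm (I : finType) (z : I -> R) (t : R) : t = 1 / 80 ->
  0 < \sum_i z i ^+ 2 ->
  avg (fun s : {ffun I -> bool} =>
    expR (- (t * (`|\sum_i sgb (s i) * z i| / Num.sqrt (\sum_i z i ^+ 2))))) <=
  expR (- t ^+ 2).
Proof.
move=> tE S0; set S := \sum_i _ in S0 *; have s0 : 0 < Num.sqrt S by rewrite sqrtr_gt0.
set xi := fun s : {ffun I -> bool} => `|\sum_i sgb (s i) * z i| / Num.sqrt S.
have xi0 s : 0 <= xi s by rewrite divr_ge0// ltW.
have H2 : avg (fun s => xi s ^+ 2) = 1.
  under eq_avg do rewrite /xi expr_div_n sqr_sqrtr ?ltW// -normrX ger0_norm ?sqr_ge0// mulrC.
  by rewrite avgZ avg_sign_sum_sq mulVf ?gt_eqF.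
have H1 : 1 / 40 <= avg xi.
  under eq_avg do rewrite /xi mulrC.
  rewrite avgZ ler_pdivlMl// mulrC; have := khinchine z; rewrite -/S; lra.
have E s : expR (- (t * xi s)) <= 1 + (- t * xi s + t ^+ 2 * xi s ^+ 2).
  have u0 : 0 <= t * xi s by rewrite mulr_ge0// tE.
  have := expR_ge1Dx (t * xi s); rewrite expRN => H.
  have -> : - t * xi s = - (t * xi s) by ring.
  rewrite -exprMn; move: (t * xi s) u0 H => u u0 H.
  have e0 : 0 < expR u := expR_gt0 _.
  rewrite -[(expR u)^-1]mul1r ler_pdivrMr//.
  have : 1 <= (1 - u + u ^+ 2) * (1 + u).
    by have : 0 <= u ^+ 3; [exact: exprn_ge0|lra].
  have : 0 <= (1 - u + u ^+ 2) * (expR u - (1 + u)).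
    by apply: mulr_ge0; nra.
  lra.
apply: le_trans (ler_avg E) _; rewrite !avgD !avgZ H2 avg_cst ?card_signs_gt0//.
apply: le_trans (expR_ge1Dx _); subst t; lra.
Qed.

(** A union bound over a net. A unit vector is scaled to Euclidean norm [A * sqrt d] and truncated
    to an integer vector. The integer vectors of [ell_1] norm at most [A * d] are only exponentially
    many in [d], and the remainder lies in the unit cube, where the [2 ^ d] sign vectors control
    it. *)
Lemma kashin : exists (lam : nat) (c : R), [/\ (0 < lam)%N, 0 < c &
  forall d : nat, (0 < d)%N -> exists G : 'I_(lam * d) -> 'I_d -> bool,
  forall x : 'I_d -> R,
    c * (lam * d)%:R * Num.sqrt (\sum_j x j ^+ 2) <=
    \sum_i `|\sum_j sgb (G i j) * x j|].
Proof.
pose t : R := 1 / 80; have t0 : 0 < t by rewrite /t; lra.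
(* [A * t >= 28] will give [7 * m * sqrt d] for the integer part, against [6 * m * sqrt d] for the
   remainder. *)
pose A := (Num.truncn (28 / t)).+1.
have At : 28 <= A%:R * t.
  by rewrite -ler_pdivrMr// ltW// truncnS_gt.
have A2 : 2 <= A%:R :> R.
  by apply: le_trans (_ : A%:R * t <= _); [lra|rewrite ler_piMr// /t; lra].
(* Enough rows for the deviation bound [expR (- m * t ^+ 2 / 2)] to beat the number of signed net
   points, at most [2 ^ ((A + 2) * d)]. *)
pose lam := (Num.truncn ((A + 3)%:R / (t ^+ 2 / 2))).+1.
have lt : (A + 3)%:R <= lam%:R * (t ^+ 2 / 2).
  by rewrite -ler_pdivrMr ?ltW ?truncnS_gt// divr_gt0// exprn_gt0.
have lt3 : A%:R + 3 <= lam%:R :> R.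
  rewrite natrD in lt; apply: le_trans lt _; rewrite ler_piMr// /t; lra.
exists lam, A%:R^-1; split => //; first by rewrite invr_gt0; lra.
move=> d d0; set m := (lam * d)%N.
have d1 : 1 <= d%:R :> R by rewrite ler1n.
have mE : m%:R = lam%:R * d%:R :> R by rewrite natrM.
pose sd : R := Num.sqrt d%:R.
have sd0 : 0 < sd by rewrite sqrtr_gt0; lra.
have sd2 : sd ^+ 2 = d%:R by rewrite sqr_sqrtr//; lra.
pose N := (A * d)%N.
pose GT := {ffun 'I_m -> {ffun 'I_d -> bool}}.
pose Z (n : {ffun 'I_d -> 'I_N.+1}) (b : {ffun 'I_d -> bool}) j : R :=
  sgb (b j) * (n j)%:R.
pose nz n b : R := \sum_j Z n b j ^+ 2.
pose g1 (G : GT) (z : 'I_d -> R) := \sum_i `|\sum_j sgb (G i j) * z j|.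
pose P (n : {ffun 'I_d -> 'I_N.+1}) := (\sum_j n j <= N)%N && (0 < \sum_j n j)%N.
(* Exponential Markov weights. [F1 < 1] bounds [g1] on the net point [(n, b)] below by [m * t / 2]
   times its norm, and [F2 < 1] bounds [g1] on the sign vector [s] above by [6 * m * sqrt d]. As all
   terms are nonnegative, [F G < 1] gives all these bounds at once. *)
pose F1 (G : GT) n b := expR (m%:R * (t ^+ 2 / 2)) *
   expR (- (t * (g1 G (Z n b) / Num.sqrt (nz n b)))).
pose F2 (G : GT) (s : {ffun 'I_d -> bool}) := expR (- (3 * m%:R)) *
   expR (g1 G (fun j => sgb (s j)) / (2 * sd)).
pose F (G : GT) := \sum_(n | P n) \sum_b F1 G n b + \sum_s F2 G s.
have GT0 : (0 < #|GT|)%N.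
  by rewrite card_ffun expn_gt0 card_signs_gt0.
have avgrow (f : {ffun 'I_d -> bool} -> R) :
    avg (fun G : GT => expR (\sum_i f (G i))) = avg (fun s => expR (f s)) ^+ m.
  under eq_avg do rewrite expR_sum.
  by rewrite (avg_prod (fun _ s => expR (f s))) prodr_const card_ord.
have nz0 n b : P n -> 0 < nz n b.
  case/andP => _; rewrite lt0n sum_nat_eq0 negb_forall => /existsP[j /= nj].
  rewrite /nz (bigD1 j)//= ltr_wpDr//.
    by apply: sumr_ge0 => i _; rewrite sqr_ge0.
  by rewrite exprn_even_gt0//= mulf_neq0 ?pnatr_eq0// -normr_eq0 normr_sgb oner_eq0.
have HF1 n b : P n -> avg (fun G => F1 G n b) <= expR (- ((A + 3)%:R * d%:R)).
  move=> Pn; rewrite avgZ.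
  have -> : avg (fun G : GT => expR (- (t * (g1 G (Z n b) / Num.sqrt (nz n b))))) =
    avg (fun s : {ffun 'I_d -> bool} =>
      expR (- (t * (`|\sum_j sgb (s j) * Z n b j| / Num.sqrt (nz n b))))) ^+ m.
    rewrite -avgrow; apply: eq_avg => G; congr expR.
    by rewrite /g1 mulr_suml mulr_sumr sumrN.
  have H := avg_expRN_norm (erefl : t = _) (nz0 n b Pn).
  apply: (@le_trans _ _ (expR (m%:R * (t ^+ 2 / 2)) * expR (- t ^+ 2) ^+ m)).
    rewrite ler_wpM2l ?expR_ge0// lerXn2r// nnegrE ?expR_ge0//.
    by apply: avg_ge0 => s; exact: expR_ge0.
  rewrite -expRM_natl -expRD ler_expR mE.
  have -> : lam%:R * d%:R * (t ^+ 2 / 2) + lam%:R * d%:R * - t ^+ 2 =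
    - ((lam%:R * (t ^+ 2 / 2)) * d%:R) by field.
  by rewrite lerN2 ler_wpM2r.
have HF2 s : avg (fun G => F2 G s) <= expR (- m%:R).
  rewrite avgZ.
  have -> : avg (fun G : GT => expR (g1 G (fun j => sgb (s j)) / (2 * sd))) =
    avg (fun u : {ffun 'I_d -> bool} =>
      expR (`|\sum_j sgb (u j) * sgb (s j)| / (2 * sd))) ^+ m.
    by rewrite -avgrow; apply: eq_avg => G; congr expR; rewrite /g1 mulr_suml.
  have xh j : `|sgb (s j) / (2 * sd)| <= 1 / 2.
    have sd1 : 1 <= sd by rewrite -(@ler_pXn2r _ 2) ?nnegrE ?ler01 ?(ltW sd0)// expr1n sd2.
    rewrite normrM normr_sgb mul1r ger0_norm ?invr_ge0; last by nra.
    by rewrite ler_pdivrMr; nra.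
  have := avg_sign_expR xh.
  have -> : \sum_j (sgb (s j) / (2 * sd)) ^+ 2 = 1 / 4.
    under eq_bigr do rewrite expr_div_n expr2 sgb_sq exprMn sd2.
    by rewrite sumr_const card_ord -mulr_natr; field; lra.
  have -> : 2 * (1 / 4) = 1 / 2 :> R by field.
  under eq_avg => u.
    have -> : `|\sum_j sgb (s j) / (2 * sd) * sgb (u j)| =
       `|\sum_j sgb (u j) * sgb (s j)| / (2 * sd).
      rewrite -[X in _ / X](@ger0_norm _ (2 * sd)); last by nra.
      rewrite -normf_div mulr_suml; congr (`|_|).
      by apply: eq_bigr => j _; ring.
    over.
  move=> H; have H2 := @expR_half_le2.
  have H4 : avg (fun u : {ffun 'I_d -> bool} =>
      expR (`|\sum_j sgb (u j) * sgb (s j)| / (2 * sd))) <= expR 2.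
    apply: le_trans H _; have := expR_ge1Dx (1 : R) => e1.
    have -> : 2 = 1 + 1 :> R by []. rewrite expRD; nra.
  apply: (@le_trans _ _ (expR (- (3 * m%:R)) * expR 2 ^+ m)).
    rewrite ler_wpM2l ?expR_ge0// lerXn2r// nnegrE ?expR_ge0//.
    by apply: avg_ge0 => u; exact: expR_ge0.
  by rewrite -expRM_natl -expRD ler_expR; lra.
have HF : avg F < 1.
  rewrite /F avgD 2!avg_sum.
  under eq_bigr do rewrite avg_sum.
  apply: (@le_lt_trans _ _ (expR (- 1) + expR (- 1))).
    apply: lerD.
      apply: (@le_trans _ _ (\sum_(n | P n) 2 ^+ d * expR (- ((A + 3)%:R * d%:R)))).
        apply: ler_sum => n Pn.
        apply: le_trans (_ : \sum_(b : {ffun 'I_d -> bool}) expR (- ((A + 3)%:R * d%:R)) <= _).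
          by apply: ler_sum => b _; exact: HF1.
        by rewrite sumr_const card_ffun card_bool card_ord -[X in X <= _]mulr_natl natrX.
      under eq_bigr do rewrite -[_ * _]mul1r.
      rewrite -mulr_suml.
      have H : \sum_(n | P n) 1 <= 2 ^+ N * 2 ^+ d :> R.
        apply: le_trans (card_small_sum d N).
        rewrite [X in _ <= X](bigID (fun n : {ffun 'I_d -> 'I_N.+1} =>
          (0 < \sum_j n j)%N)) /= lerDl; exact: sumr_ge0.
      apply: le_trans (ler_wpM2r _ H) _.
        by rewrite mulr_ge0 ?exprn_ge0 ?expR_ge0.
      apply: (@le_trans _ _ (expR (N + d + d)%:R * expR (- ((A + 3)%:R * d%:R)))).
        rewrite mulrA ler_wpM2r ?expR_ge0// -!exprD; exact: two_powr_le_expR.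
      rewrite -expRD ler_expR.
      have -> : (N + d + d)%:R = A%:R * d%:R + d%:R + d%:R :> R.
        by rewrite natrD natrD /N natrM.
      by have -> : (A + 3)%:R = A%:R + 3 :> R; [rewrite natrD|lra].
    apply: (@le_trans _ _ (\sum_(s : {ffun 'I_d -> bool}) expR (- m%:R))).
      by apply: ler_sum => s _; exact: HF2.
    rewrite sumr_const card_ffun card_bool card_ord -[X in X <= _]mulr_natl natrX.
    apply: (@le_trans _ _ (expR d%:R * expR (- m%:R))).
      by rewrite ler_wpM2r ?expR_ge0// two_powr_le_expR.
    by rewrite -expRD ler_expR mE; nra.
  have : 1 + 1 < expR 1 :> R by apply: expR_gt1Dx; rewrite oner_eq0.
  have : expR 1 * expR (-1) = 1 :> R by rewrite -expRD subrr expR0.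
  have : 0 < expR (- 1) :> R by exact: expR_gt0.
  nra.
have [G HG] := avg_exists_lt GT0 HF.
exists (fun i j => G i j) => x.
have F10 n b : 0 <= F1 G n b by rewrite mulr_ge0// expR_ge0.
have F20 s : 0 <= F2 G s by rewrite mulr_ge0// expR_ge0.
have S1 n b : P n -> m%:R * (t / 2) * Num.sqrt (nz n b) <= g1 G (Z n b).
  move=> Pn; have q0 : 0 < Num.sqrt (nz n b) by rewrite sqrtr_gt0 nz0.
  have : F1 G n b < 1.
    apply: le_lt_trans HG; rewrite /F (bigD1 n)//= (bigD1 b)//= -!addrA lerDl.
    by rewrite !addr_ge0//; do ?[apply: sumr_ge0 => ? _] => //; apply: sumr_ge0.
  rewrite /F1 -expRD expR_lt1 => H.
  rewrite -ler_pdivlMr//; move: (g1 _ _ / _) H => u H.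
  by rewrite -(ler_pM2l t0); lra.
have S2 (s : {ffun 'I_d -> bool}) : g1 G (fun j => sgb (s j)) <= 6 * m%:R * sd.
  have : F2 G s < 1.
    apply: le_lt_trans HG; rewrite /F [X in _ + X](bigD1 s)//= addrCA lerDl.
    by rewrite addr_ge0//; apply: sumr_ge0 => ? _ //; apply: sumr_ge0.
  rewrite /F2 -expRD expR_lt1 => H.
  have : g1 G (fun j => sgb (s j)) / (2 * sd) <= 3 * m%:R by lra.
  by rewrite ler_pdivrMr; nra.
suff Hu (u : 'I_d -> R) : \sum_j u j ^+ 2 = 1 -> m%:R <= A%:R * g1 G u.
  set S := \sum_j _; have S0 : 0 <= S by apply: sumr_ge0 => j _; exact: sqr_ge0.
  have [S_eq|Sn] := eqVneq S 0.
    by rewrite S_eq sqrtr0 mulr0; apply: sumr_ge0.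
  have s0 : 0 < Num.sqrt S by rewrite sqrtr_gt0 lt_def Sn.
  have x1 : \sum_j (x j / Num.sqrt S) ^+ 2 = 1.
    under eq_bigr do rewrite expr_div_n sqr_sqrtr//.
    by rewrite -mulr_suml divff.
  have := Hu _ x1.
  have -> : g1 G (fun j => x j / Num.sqrt S) = g1 G x / Num.sqrt S.
    rewrite /g1 mulr_suml; apply: eq_bigr => i _.
    rewrite -[X in _ / X](@ger0_norm _ (Num.sqrt S)) ?ltW// -normf_div mulr_suml.
    by congr (`|_|); apply: eq_bigr => j _; rewrite mulrA.
  rewrite -/(g1 G x) mulrA ler_pdivlMr// => H.
  by rewrite -mulrA ler_pdivrMl//; lra.
move=> u1; pose y j := A%:R * sd * u j.
have Asd0 : 0 < A%:R * sd by nra.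
have y2 : \sum_j `|y j| ^+ 2 = A%:R ^+ 2 * d%:R.
  under eq_bigr do rewrite -normrX ger0_norm ?sqr_ge0// exprMn.
  by rewrite -mulr_sumr u1 mulr1 exprMn sd2.
have y1 : \sum_j `|y j| <= N%:R.
  rewrite -(@ler_pXn2r _ 2) ?nnegrE ?ler0n ?sumr_ge0//.
  have := sum_mul_sq (fun j => `|y j|) (fun=> 1).
  under eq_bigr do rewrite mulr1.
  rewrite y2 expr1n.
  by rewrite sumr_const card_ord /N natrM; lra.
pose k j := Num.truncn `|y j|.
have kle j : (k j)%:R <= `|y j| by rewrite truncn_le.
have klt j : `|y j| < (k j).+1%:R by exact: truncnS_gt.
have ksum : (\sum_j k j <= N)%N.
  by rewrite -(ler_nat R) natr_sum; apply: le_trans y1; exact: ler_sum.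
have kN j : (k j < N.+1)%N.
  by rewrite ltnS; apply: leq_trans ksum; rewrite (bigD1 j)//= leq_addr.
pose n := [ffun j => Ordinal (kN j)].
pose b := [ffun j => y j < 0].
have yE j : y j = sgb (y j < 0) * `|y j|.
  rewrite /sgb; case: (ltrP (y j) 0) => h /=; rewrite ?expr1 ?expr0 ?mulN1r ?mul1r;
     [by rewrite ltr0_norm ?opprK|by rewrite ger0_norm].
have ZE j : Z n b j = sgb (y j < 0) * (k j)%:R by rewrite /Z !ffunE.
pose r j := y j - Z n b j.
have r1 j : `|r j| <= 1.
  rewrite /r ZE {1}yE -mulrBr normrM normr_sgb mul1r ger0_norm ?subr_ge0//.
  by have := klt j; rewrite -natr1; lra.
(* From [y ^+ 2 <= 2 * Z ^+ 2 + 2] in each coordinate; the total loss [2 * d] is at most half of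
   [A ^+ 2 * d] because [A >= 2]. *)
have nzb : A%:R ^+ 2 / 4 * d%:R <= nz n b.
  have : \sum_j `|y j| ^+ 2 <= \sum_j (2 * Z n b j ^+ 2 + 2).
    apply: ler_sum => j _; rewrite -normrX ger0_norm ?sqr_ge0//.
    have -> : y j = Z n b j + r j by rewrite /r; ring.
    have := r1 j; rewrite ler_norml => /andP[]; move: (Z n b j) (r j) => z v v1 v2.
    by have := sqr_ge0 (z - v); nra.
  rewrite y2 big_split /= -mulr_sumr -/(nz n b) sumr_const card_ord -(mulr_natr 2 d).
  have : 4 * d%:R <= A%:R ^+ 2 * d%:R :> R by rewrite ler_wpM2r ?ler0n//; nra.
  lra.
have Pn : P n.
  rewrite /P; under eq_bigr do rewrite ffunE /=.
  rewrite ksum /= lt0n; apply/negP => /eqP k0.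
  have : nz n b = 0.
    rewrite /nz big1// => j _; rewrite ZE.
    have -> : k j = 0%N.
      by apply/eqP; rewrite -leqn0 -k0 (bigD1 j)//= leq_addr.
    by rewrite mulr0 expr0n.
  nra.
have sq : A%:R / 2 * sd <= Num.sqrt (nz n b).
  rewrite -(@ler_pXn2r _ 2) ?nnegrE ?sqrtr_ge0//; last by nra.
  rewrite sqr_sqrtr; last by nra.
  by rewrite exprMn sd2; nra.
have Gr : g1 G r <= 6 * m%:R * sd by apply: sum_norm_sign => // s; exact: S2.
have Gz := S1 n b Pn.
have Gy : g1 G (Z n b) <= A%:R * sd * g1 G u + g1 G r.
  rewrite /g1 mulr_sumr -big_split /=; apply: ler_sum => i _.
  rewrite -[A%:R * sd]ger0_norm ?(ltW Asd0)// -normrM mulr_sumr.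
  rewrite -[X in _ + X]normrN; apply: le_trans (ler_normD _ _).
  apply: le_of_eq; congr (`|_|).
  by rewrite -sumrN -big_split /=; apply: eq_bigr => j _; rewrite /r /y; ring.
have m0 : 0 <= m%:R :> R by rewrite ler0n.
have H7 : 7 * (m%:R * sd) <= m%:R * (t / 2) * Num.sqrt (nz n b).
  apply: (@le_trans _ _ (m%:R * (t / 2) * (A%:R / 2 * sd))).
    have : 0 <= m%:R * sd * (A%:R * t - 28) by apply: mulr_ge0; [apply: mulr_ge0; lra|lra].
    lra.
  by rewrite ler_wpM2l// mulr_ge0//; lra.
have : m%:R * sd <= A%:R * g1 G u * sd by lra.
by rewrite ler_pM2r.
Qed.

End Signs.

Local Open Scope classical_set_scope.

(** * Representatives of elements of a Koethe space *)

Section KoetheBasics.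
Context {R : realType} {X : completeNormedModType R} (K : kothe_space X).
Local Notation mu := (leb01 R).
Local Notation T := (measurableTypeR R).
Implicit Types (x y z : X) (f g h : T -> R) (A B : set T).

(** Elements of [X] are classes; computations go through this relation with concrete functions,
    which determines [x] from [f]. *)
Definition rep f x := \forall t \ae mu, K x t = f t.

Lemma rep_refl x : rep (K x) x.
Proof. exact: aeW. Qed.

Lemma rep_uniq f x y : rep f x -> rep f y -> x = y.
Proof.
move=> fx fy; apply: (frepr_inj (k := K)).
by near=> t => _; rewrite (near fx t)// (near fy t).
Unshelve. all: by end_near. Qed.

Lemma rep_ae f g x : rep f x -> (\forall t \ae mu, f t = g t) -> rep g x.
Proof.
move=> fx fg; near=> t; rewrite (near fx t)//; exact: (near fg t).
Unshelve. all: by end_near. Qed.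

Lemma rep_ext f g x : rep f x -> f =1 g -> rep g x.
Proof. by move=> fx /funext <-. Qed.

Lemma rep_lin a f g x y : rep f x -> rep g y ->
  rep (fun t => a * f t + g t) (a *: x + y).
Proof.
move=> fx gy; have l := frepr_linear K a x y.
near=> t; rewrite (near l t)// (near fx t)// (near gy t)//.
Unshelve. all: by end_near. Qed.

Lemma rep0 : rep (fun=> 0) 0.
Proof.
have := rep_lin (- 1) (rep_refl 0) (rep_refl 0).
rewrite scaleN1r addNr => /rep_ext; apply => t; ring.
Qed.

Lemma repZ a f x : rep f x -> rep (fun t => a * f t) (a *: x).
Proof.
move=> fx; have := rep_lin a fx rep0; rewrite addr0 => /rep_ext; apply => t.
by rewrite addr0.
Qed.

Lemma repD f g x y : rep f x -> rep g y -> rep (fun t => f t + g t) (x + y).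
Proof.
move=> fx gy; have := rep_lin 1 fx gy; rewrite scale1r => /rep_ext; apply => t.
by rewrite mul1r.
Qed.

Lemma repN f x : rep f x -> rep (fun t => - f t) (- x).
Proof.
by move=> /(repZ (-1)); rewrite scaleN1r => /rep_ext; apply => t; rewrite mulN1r.
Qed.

Lemma repB f g x y : rep f x -> rep g y -> rep (fun t => f t - g t) (x - y).
Proof. by move=> fx /repN; exact: repD. Qed.

Lemma rep_sum (I : Type) (r : seq I) (P : pred I) (f : I -> T -> R) (x : I -> X) :
  (forall i, P i -> rep (f i) (x i)) ->
  rep (fun t => \sum_(i <- r | P i) f i t) (\sum_(i <- r | P i) x i).
Proof.
move=> fx; elim: r => [|i r IH].
  by rewrite big_nil; apply: rep_ext rep0 _ => t; rewrite big_nil.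
rewrite big_cons; case: ifPn => Pi.
  by apply: rep_ext (repD (fx _ Pi) IH) _ => t; rewrite big_cons Pi.
by apply: rep_ext IH _ => t; rewrite big_cons (negbTE Pi).
Qed.

Lemma measurable_frepr x : measurable_fun setT (K x).
Proof. by have /sub_Lfun_mfun := frepr_integrable K x; rewrite inE. Qed.

Lemma rep_dominated f g x : measurable_fun setT f -> rep g x ->
  (\forall t \ae mu, `|f t| <= `|g t|) -> exists2 y, rep f y & `|y| <= `|x|.
Proof.
move=> mf gx fg.
pose F : {mfun T >-> R} := HB.pack f (@isMeasurableFun.Build _ _ T R f mf).
have [|y yF yx] := @frepr_ideal _ _ K F x.
  by near=> t; rewrite (near gx t)//=; exact: (near fg t).
by exists y => //; near=> t; rewrite (near yF t).
Unshelve. all: by end_near. Qed.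

Lemma rep_norm_le f g x y : rep f x -> rep g y ->
  (\forall t \ae mu, `|f t| <= `|g t|) -> `|x| <= `|y|.
Proof.
move=> fx gy fg; have [||z zx zy] := @rep_dominated (K x) g y _ gy.
- exact: measurable_frepr.
- by near=> t; rewrite (near fx t)//; exact: (near fg t).
- by rewrite (rep_uniq (rep_refl x) zx).
Unshelve. all: by end_near. Qed.

Lemma rep_norm_eq f g x y : rep f x -> rep g y ->
  (\forall t \ae mu, `|f t| = `|g t|) -> `|x| = `|y|.
Proof.
move=> fx gy fg; apply/le_anti/andP; split; [apply: (rep_norm_le fx gy)|apply: (rep_norm_le gy fx)].
  by near=> t; rewrite (near fg t).
by near=> t; rewrite (near fg t).
Unshelve. all: by end_near. Qed.

Definition good f := exists x, rep f x.

(** The default 0 is reached only when [f] represents no element of [X], which [good f] excludes. *)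
Definition el f : X := xget 0 [set x | rep f x].

Lemma elP f : good f -> rep f (el f).
Proof. by move=> /xgetPex; exact. Qed.

Lemma elE f x : rep f x -> el f = x.
Proof. by move=> fx; apply: (@rep_uniq f) => //; apply: elP; exists x. Qed.

Lemma good_dominated f g : measurable_fun setT f -> good g ->
  (forall t, `|f t| <= `|g t|) -> good f.
Proof.
move=> mf [x gx] fg; have [|y fy _] := rep_dominated mf gx; last by exists y.
exact: aeW.
Qed.

Lemma goodD f g : good f -> good g -> good (fun t => f t + g t).
Proof. by move=> [x fx] [y gy]; exists (x + y); exact: repD. Qed.

Lemma goodZ a f : good f -> good (fun t => a * f t).
Proof. by move=> [x fx]; exists (a *: x); exact: repZ. Qed.

Lemma good_sum (I : Type) (r : seq I) (P : pred I) (f : I -> T -> R) :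
  (forall i, P i -> good (f i)) -> good (fun t => \sum_(i <- r | P i) f i t).
Proof.
move=> gf; exists (\sum_(i <- r | P i) el (f i)); apply: rep_sum => i Pi.
exact/elP/gf.
Qed.

Lemma good_indic A : measurable A -> good \1_A.
Proof.
move=> mA; have [x xA] := frepr_indic K mA; exists x.
by near=> t; rewrite (near xA t).
Unshelve. all: by end_near. Qed.

Lemma good_frepr x : good (K x).
Proof. by exists x; exact: rep_refl. Qed.

Lemma elD f g : good f -> good g -> el (fun t => f t + g t) = el f + el g.
Proof. by move=> gf gg; apply/elE/repD; exact: elP. Qed.

Lemma elB f g : good f -> good g -> el (fun t => f t - g t) = el f - el g.
Proof. by move=> gf gg; apply/elE/repB; exact: elP. Qed.

Lemma elZ a f : good f -> el (fun t => a * f t) = a *: el f.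
Proof. by move=> gf; apply/elE/repZ; exact: elP. Qed.

Lemma el_sum (I : Type) (r : seq I) (P : pred I) (f : I -> T -> R) :
  (forall i, P i -> good (f i)) ->
  el (fun t => \sum_(i <- r | P i) f i t) = \sum_(i <- r | P i) el (f i).
Proof. by move=> gf; apply/elE/rep_sum => i Pi; exact/elP/gf. Qed.

Definition nrm f := `|el f|.

Lemma nrm_le f g : good f -> good g -> (\forall t \ae mu, `|f t| <= `|g t|) ->
  nrm f <= nrm g.
Proof. by move=> gf gg; apply: rep_norm_le; exact: elP. Qed.

Lemma nrm_leW f g : good f -> good g -> (forall t, `|f t| <= `|g t|) ->
  nrm f <= nrm g.
Proof. by move=> gf gg fg; apply: nrm_le => //; exact: aeW. Qed.

Lemma nrm_ge0 f : 0 <= nrm f.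
Proof. exact: normr_ge0. Qed.

Lemma nrmZ a f : good f -> nrm (fun t => a * f t) = `|a| * nrm f.
Proof. by move=> gf; rewrite /nrm elZ// normrZ. Qed.

Lemma nrmD_le f g : good f -> good g -> nrm (fun t => f t + g t) <= nrm f + nrm g.
Proof. by move=> gf gg; rewrite /nrm elD// ler_normD. Qed.

Lemma nrmE f x : rep f x -> nrm f = `|x|.
Proof. by move=> /elE fx; rewrite /nrm fx. Qed.

(** The band projection onto the functions supported in [B], a contraction because the norm is a
    lattice norm. *)
Definition band B x : X := el (fun t => \1_B t * K x t).

Lemma good_band B f : measurable B -> good f -> good (fun t => \1_B t * f t).
Proof.
move=> mB [x fx].
have [||y yf _] := @rep_dominated (fun t => \1_B t * K x t) (K x) x _ (rep_refl x).
- by apply: measurable_funM => //; exact: measurable_frepr.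
- apply: aeW => t; rewrite normrM ler_piMl// ger0_norm// indicE; by case: (t \in B).
- exists y; apply: rep_ae yf _.
  by near=> t; rewrite (near fx t).
Unshelve. all: by end_near. Qed.

Lemma rep_band B f x : measurable B -> rep f x -> rep (fun t => \1_B t * f t) (band B x).
Proof.
move=> mB fx; apply: rep_ae (elP (good_band mB (good_frepr x))) _.
by near=> t; rewrite (near fx t).
Unshelve. all: by end_near. Qed.

Lemma bandP a B x y : measurable B -> band B (a *: x + y) = a *: band B x + band B y.
Proof.
move=> mB; have := rep_lin a (rep_band mB (rep_refl x)) (rep_band mB (rep_refl y)).
apply: rep_uniq; apply: rep_ae (rep_band mB (rep_lin a (rep_refl x) (rep_refl y))) _.
by apply: aeW => t; ring.
Qed.

Lemma band_norm_le B x : measurable B -> `|band B x| <= `|x|.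
Proof.
move=> mB; apply: (rep_norm_le (rep_band mB (rep_refl x)) (rep_refl x)).
apply: aeW => t; rewrite normrM ler_piMl// ger0_norm// indicE; by case: (t \in B).
Qed.

Lemma band_el B f : measurable B -> good f -> band B (el f) = el (fun t => \1_B t * f t).
Proof. by move=> mB gf; apply/esym/elE; apply: rep_band => //; exact: elP. Qed.
End KoetheBasics.

(** * Cauchy sequences and limits in epsilon form *)

Section Completeness.
Context {R : realType} {X : completeNormedModType R}.

Definition cauchy_seq (u : nat -> X) := forall e : R, 0 < e ->
  exists N, forall m n, (N <= m)%N -> (N <= n)%N -> `|u m - u n| <= e.

Definition limit_seq (u : nat -> X) (l : X) := forall e : R, 0 < e ->
  exists N, forall n, (N <= n)%N -> `|u n - l| <= e.

Lemma cauchy_seq_limit (u : nat -> X) : cauchy_seq u -> exists l, limit_seq u l.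
Proof.
move=> cu; have : cvg (u @ \oo).
  apply: cauchy_cvg; apply: cauchy_exP => e e0.
  have [N HN] := cu (e / 2) (divr_gt0 e0 (ltr0Sn _ 1)).
  exists (u N); exists N => // n /= Nn.
  rewrite -ball_normE /=; apply: le_lt_trans (HN _ _ (leqnn N) Nn) _.
  by rewrite ltr_pdivrMr//; lra.
move=> /cvg_ex[l] /cvgrPdist_le H; exists l => e e0.
have [N _ HN] := H e e0; exists N => n Nn; rewrite distrC; exact: HN.
Qed.

Lemma limit_seq_norm_le (u : nat -> X) (l : X) (c : R) : limit_seq u l ->
  (forall N, exists2 n, (N <= n)%N & `|u n| <= c) -> `|l| <= c.
Proof.
move=> ul H; apply/ler_addgt0Pr => e e0; have [N HN] := ul e e0.
have [n Nn un] := H N; have := HN n Nn => d.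
have -> : l = u n - (u n - l) by rewrite opprB addrC subrK.
apply: le_trans (ler_normB _ _) _; lra.
Qed.

Lemma limit_seq_uniq (u : nat -> X) (l l' : X) : limit_seq u l -> limit_seq u l' -> l = l'.
Proof.
move=> ul ul'; apply/eqP; rewrite -subr_eq0 -normr_eq0 eq_le normr_ge0 andbT.
apply/ler_addgt0Pr => e e0; rewrite add0r.
have e2 : 0 < e / 2 by rewrite divr_gt0.
have [N HN] := ul _ e2; have [N' HN'] := ul' _ e2.
have h := HN (maxn N N') (leq_maxl _ _); have h' := HN' (maxn N N') (leq_maxr _ _).
have -> : l - l' = (u (maxn N N') - l') - (u (maxn N N') - l).
  by rewrite opprB [RHS]addrC addrA subrK.
apply: le_trans (ler_normB _ _) _; lra.
Qed.
End Completeness.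

(** * The closed positive cone and the continuous inclusion into L_1 *)

Section L1.
Context {R : realType} {X : completeNormedModType R} (K : kothe_space X).
Local Notation mu := (leb01 R).
Local Notation T := (measurableTypeR R).
Implicit Types (x y z : X) (f g h : T -> R) (A B : set T).

Lemma good_abs x : good K (fun t => `|K x t|).
Proof.
apply: (@good_dominated _ _ _ _ (K x)); last by move=> t; rewrite normr_id.
  by apply: measurableT_comp => //; exact: measurable_frepr.
exact: good_frepr.
Qed.

(** The lattice modulus is 1-Lipschitz for the norm and fixes nonnegative elements, hence also their
    limits. *)
Lemma cone_closed z : (forall e : R, 0 < e ->
    exists u, (\forall t \ae mu, 0 <= K u t) /\ `|u - z| <= e) ->
  \forall t \ae mu, 0 <= K z t.
Proof.
move=> H; pose ab x := el K (fun t => `|K x t|).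
have abE x : rep K (fun t => `|K x t|) (ab x) by apply: elP; exact: good_abs.
suff zE : ab z = z.
  by have := abE z; rewrite zE; apply: filterS => t ->.
apply/eqP; rewrite -subr_eq0 -normr_eq0 eq_le normr_ge0 andbT.
apply/ler_addgt0Pr => e e0; rewrite add0r.
have [u [u0 uz]] := H (e / 2) (divr_gt0 e0 (ltr0Sn _ 1)).
have uE : ab u = u.
  apply: rep_uniq (rep_refl K u); apply: rep_ae (abE u) _.
  by near=> t; rewrite ger0_norm//; exact: (near u0 t).
have -> : ab z - z = (ab z - ab u) + (u - z) by rewrite uE addrA subrK.
apply: le_trans (ler_normD _ _) _.
have : `|ab z - ab u| <= `|u - z|.
  rewrite distrC; apply: (rep_norm_le (repB (abE u) (abE z)) (repB (rep_refl K u) (rep_refl K z))).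
  by apply: aeW => t; exact: ler_dist_dist.
lra.
Unshelve. all: by end_near. Qed.

Definition L1norm x : \bar R := (\int[mu]_t (`|K x t|)%:E)%E.

Lemma measurable_abs_frepr x : measurable_fun setT (fun t => (`|K x t|)%:E).
Proof.
apply/measurable_EFinP; apply: measurableT_comp => //; exact: measurable_frepr.
Qed.

Lemma L1norm_fin x : (L1norm x < +oo)%E.
Proof.
have /sub_Lfun_finLfun := frepr_integrable K x; rewrite inE /= /finite_norm Lnorm1.
by [].
Qed.

Lemma L1norm_le x y : (\forall t \ae mu, `|K x t| <= `|K y t|) -> (L1norm x <= L1norm y)%E.
Proof.
move=> xy; apply: ae_ge0_le_integral => //; try exact: measurable_abs_frepr.
by near=> t => _; rewrite lee_fin; exact: (near xy t).
Unshelve. all: by end_near. Qed.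

Lemma L1normZ a x : (L1norm (a *: x) = (`|a|)%:E * L1norm x)%E.
Proof.
rewrite /L1norm -ge0_integralZl_EFin//; last exact: measurable_abs_frepr.
  apply: ae_eq_integral => //; first exact: measurable_abs_frepr.
    apply/measurable_EFinP; apply: measurable_funM => //.
    by apply: measurableT_comp => //; exact: measurable_frepr.
  have := repZ a (rep_refl K x); apply: filterS => t ->  _.
  by rewrite normrM EFinM.
Qed.

(** Otherwise there are elements of norm [2 ^- n] whose [L_1] norm is at least [2 ^ n]. The series
    of their moduli converges in [X], and its sum dominates each of them although it is
    integrable. *)
Lemma L1_bound : exists2 A : R, 0 < A & forall x, (L1norm x <= (A * `|x|)%:E)%E.
Proof.
apply/not_exists2P => H.
have {}H n : exists x, `|x| = (2 ^+ n)^-1 /\ ((2 ^+ n)%:E <= L1norm x)%E.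
  (* The ratio [4 ^ n] is shared between a summable norm [2 ^- n] and an unbounded [L_1] norm
     [2 ^ n]. *)
  have [|] := H (4 ^+ n); first by rewrite exprn_gt0.
  move=> /existsNP[x /negP]; rewrite -ltNge => Jx.
  have n0 : 0 < 2 ^+ n :> R by rewrite exprn_gt0.
  have x0 : 0 < `|x|.
    rewrite normr_gt0; apply/eqP => x_eq; move: Jx; rewrite x_eq normr0 mulr0.
    have := L1normZ 0 0; rewrite scale0r normr0 mul0e => ->; by rewrite ltxx.
  exists ((2 ^+ n * `|x|)^-1 *: x); split.
    rewrite normrZ normfV normrM normr_id (ger0_norm (ltW n0)) invfM.
    by rewrite -mulrA mulVf ?mulr1// gt_eqF.
  rewrite L1normZ ger0_norm ?invr_ge0 ?mulr_ge0 ?(ltW n0)//.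
  rewrite -lee_pdivrMl; last by rewrite invr_gt0 mulr_gt0.
  rewrite invrK -EFinM; apply: le_trans (ltW Jx); rewrite lee_fin.
  by rewrite -[4]/(2 * 2)%:R natrM exprMn mulrAC.
have [y Hy] := choice H.
pose z n := el K (fun t => `|K (y n) t|).
have zE n : rep K (fun t => `|K (y n) t|) (z n) by apply: elP; exact: good_abs.
have nz n : `|z n| = (2 ^+ n)^-1.
  rewrite -(Hy n).1; apply: (rep_norm_eq (zE n) (rep_refl K _)).
  by apply: aeW => t; rewrite normr_id.
pose s n := \sum_(k < n) z k.
have sD m n : (m <= n)%N -> `|s n - s m| <= 2 * (2 ^+ m)^-1.
  move=> mn; suff : `|s n - s m| <= 2 * (2 ^+ m)^-1 - 2 * (2 ^+ n)^-1.
    by have : 0 <= (2 ^+ n)^-1 :> R; [rewrite invr_ge0 exprn_ge0|lra].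
  elim: n mn => [|n IH]; first by rewrite leqn0 => /eqP ->; rewrite !subrr normr0.
  rewrite leq_eqVlt => /predU1P[->|/IH{}IH]; first by rewrite !subrr normr0.
  rewrite {1}/s big_ord_recr /= -/(s n) addrAC.
  apply: le_trans (ler_normD _ _) _; rewrite nz.
  have -> : (2 ^+ n.+1)^-1 = (2 ^+ n)^-1 / 2 :> R by rewrite exprS invfM mulrC.
  lra.
have [|Z sZ] := @cauchy_seq_limit _ _ s.
  have small (e : R) : 0 < e -> exists N, 2 * (2 ^+ N)^-1 <= e.
    move=> e0; exists (Num.truncn (2 / e)).+1; rewrite ler_pdivrMr ?exprn_gt0//.
    rewrite mulrC -ler_pdivrMr//.
    apply: le_trans (ltW (truncnS_gt _)) _; rewrite -natrX ler_nat.
    by apply: ltnW; exact: ltn_expl.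
  move=> e e0; have [N HN] := small e e0.
  have mono m : (N <= m)%N -> 2 * (2 ^+ m)^-1 <= e.
    move=> Nm; apply: le_trans HN; rewrite ler_pM2l//.
    by rewrite lef_pV2 ?posrE ?exprn_gt0// ler_eXn2l// ltr1n.
  exists N => m n Nm Nn; have [mn|/ltnW nm] := leqP m n.
    by rewrite distrC; apply: le_trans (sD _ _ mn) _; exact: mono.
  by apply: le_trans (sD _ _ nm) _; exact: mono.
(* Partial sums beyond index [k] dominate the [k]-th modulus, and the positive cone is closed. *)
have zZ k : \forall t \ae mu, `|K (y k) t| <= K Z t.
  have : \forall t \ae mu, 0 <= K (Z - z k) t.
    apply: cone_closed => e e0; have [N HN] := sZ e e0.
    exists (s (maxn N k.+1) - z k); split; last first.
      by rewrite opprB addrA subrK; apply: HN; rewrite leq_maxl.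
    have sk : rep K (fun t => \sum_(i < maxn N k.+1 | i != k :> nat) `|K (y i) t|)
        (s (maxn N k.+1) - z k).
      have kN : (k < maxn N k.+1)%N by rewrite leq_maxr.
      rewrite /s (bigD1 (Ordinal kN))//= addrC addrK.
      by apply: rep_sum => i _; exact: zE.
    near=> t; rewrite (near sk t)//; exact: sumr_ge0.
  move=> h; have l := repB (rep_refl K Z) (zE k).
  near=> t; rewrite -subr_ge0 -(near l t)//; exact: (near h t).
have JZb k : ((2 ^+ k)%:E <= L1norm Z)%E.
  apply: le_trans (Hy k).2 _; apply: L1norm_le; have := zZ k.
  apply: filterS => t h; exact: le_trans h (ler_norm _).
have := L1norm_fin Z; have : (0 <= L1norm Z)%E by apply: integral_ge0 => t _; rewrite lee_fin.
case: (L1norm Z) JZb => // r JZb _ _.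
have := JZb (Num.truncn r).+1; rewrite lee_fin; apply/negP; rewrite -ltNge.
apply: lt_le_trans (truncnS_gt _) _; rewrite -natrX ler_nat.
by apply: ltnW; exact: ltn_expl.
Unshelve. all: by end_near. Qed.

End L1.

Lemma ler_sum_uniq_sub (R : realDomainType) (I : eqType) (s t : seq I) (F : I -> R) :
  uniq s -> {subset s <= t} -> (forall i, 0 <= F i) ->
  \sum_(i <- s) F i <= \sum_(i <- t) F i.
Proof.
move=> us st F0; elim: s t us st => [|a s IH] t /=.
  by move=> _ _; rewrite big_nil sumr_ge0.
move=> /andP[as_ us] st; have at_ : a \in t by rewrite st ?mem_head.
rewrite (perm_big _ (perm_to_rem at_)) !big_cons lerD2l; apply: IH => // b bs.
have : b \in t by rewrite st// in_cons bs orbT.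
rewrite (perm_mem (perm_to_rem at_)) in_cons => /predU1P[ba|//].
by rewrite -ba bs in as_.
Qed.

Lemma powRV_ge0 (R : realType) (x r : R) : 0 <= x -> (x^-1) `^ r = (x `^ r)^-1.
Proof.
move=> x0; rewrite -(powR_inv1 x0) -(powR_inv1 (powR_ge0 x r)) -!powRrM.
by rewrite mulrN1 mulN1r.
Qed.

(** * The gliding hump *)

Section LpCounting.
Context {R : realType}.
Variable p : R.
Hypothesis p0 : 0 < p.

Let ge (u : nat -> R) k : (0 <= (`|u k| `^ p)%:E)%E.
Proof. by rewrite lee_fin powR_ge0. Qed.

Lemma Lnorm_counting_le (u : nat -> R) (c : R) : 0 <= c ->
  (forall N, \sum_(0 <= n < N) `|u n| `^ p <= c `^ p) ->
  ('N[@counting nat R]_p%:E[EFin \o u] <= c%:E)%E.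
Proof.
move=> c0 H; rewrite Lnorm_counting//=.
have -> : c%:E = ((c `^ p)%:E `^ p^-1)%E.
  by rewrite poweR_EFin -powRrM divff ?gt_eqF// powRr1.
apply: gt0_ler_poweR; rewrite ?invr_ge0 ?(ltW p0)//.
- by rewrite in_itv /= leey andbT; apply: nneseries_ge0 => n _ _; exact: ge.
- by rewrite in_itv /= leey andbT lee_fin powR_ge0.
apply: lime_le; first by apply: is_cvg_nneseries => n _ _; exact: ge.
by apply: nearW => N; rewrite sumEFin lee_fin.
Qed.

Lemma Lnorm_counting_ge (u : nat -> R) (c : R) : 0 <= c ->
  ('N[@counting nat R]_p%:E[EFin \o u] <= c%:E)%E ->
  forall N, \sum_(0 <= n < N) `|u n| `^ p <= c `^ p.
Proof.
move=> c0; rewrite Lnorm_counting//= => H N.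
have S0 : (0 <= \sum_(k <oo) (`|u k| `^ p)%:E)%E.
  by apply: nneseries_ge0 => n _ _; exact: ge.
rewrite -lee_fin -sumEFin.
apply: le_trans (nneseries_lim_ge _ _) _; first by move=> n _ _; exact: ge.
have E (x : \bar R) : (0 <= x)%E -> x = ((x `^ p^-1) `^ p)%E.
  by move=> x0; rewrite -poweRrM mulVf ?gt_eqF// poweRe1.
rewrite (E _ S0) -poweR_EFin; apply: gt0_ler_poweR; rewrite ?(ltW p0)//.
- by rewrite in_itv /= leey andbT poweR_ge0.
- by rewrite in_itv /= leey andbT lee_fin.
Qed.

Lemma Lfun_counting (u : nat -> R) (c : R) :
  ('N[@counting nat R]_p%:E[EFin \o u] <= c%:E)%E -> u \in Lfun (@counting nat R) p%:E.
Proof.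
move=> H; rewrite inE; apply/andP; split; first by rewrite inE.
by rewrite inE /= /finite_norm; exact: le_lt_trans H (ltry _).
Qed.
End LpCounting.

Section Gliding.
Context {R : realType} {X : completeNormedModType R} (K : kothe_space X).
Variable p : R.
Local Notation T := (measurableTypeR R).

(* A finite-dimensional subspace, spanned by [fe], supported in [B], with an
   operator into L_p of a finite uniform probability space, of norm at most 1
   and with no extension to X of norm at most M. *)
Record failure (B : set T) (M : R) := Failure {
  fI : finType ;
  fO : finType ;
  fe : fI -> X ;
  fT : fI -> fO -> R ;
  fgam : R ;
  fO_gt0 : (0 < #|fO|)%N ;
  fgam_gt0 : 0 < fgam ;
  fe_band : forall i, band K B (fe i) = fe i ;
  fe_indep : forall (x : fI -> R) i, fgam * `|x i| <= `|\sum_i x i *: fe i| ;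
  fT_le : forall x : fI -> R,
    avg (fun w => `|\sum_i x i * fT i w| `^ p) <= `|\sum_i x i *: fe i| `^ p ;
  fT_ext : forall S : X -> fO -> R,
    (forall a f g w, S (a *: f + g) w = a * S f w + S g w) ->
    (forall f, avg (fun w => `|S f w| `^ p) <= (M * `|f|) `^ p) ->
    exists i w, S (fe i) w <> fT i w }.

Arguments fe {B M} f i : rename.
Arguments fT {B M} f i w : rename.
Arguments fe_band {B M} f i : rename.
Arguments fe_indep {B M} f x i : rename.
Arguments fT_le {B M} f x : rename.
Arguments fT_ext {B M} f S : rename.

Lemma band_disj A B x : measurable A -> measurable B -> A `&` B = set0 ->
  band K B x = x -> band K A x = 0.
Proof.
move=> mA mB AB <-; rewrite /band; apply: elE.
apply: rep_ae (rep0 K) _.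
have := rep_band mB (rep_refl K x); apply: filterS => t ->.
rewrite mulrA; have -> : \1_A t * \1_B t = (\1_A \* \1_B) t :> R by [].
by rewrite -indicI AB indic0 mul0r.
Qed.

Lemma bandD A x y : measurable A -> band K A (x + y) = band K A x + band K A y.
Proof. by move=> mA; have := bandP K 1 x y mA; rewrite !scale1r. Qed.

Lemma bandB A x y : measurable A -> band K A (x - y) = band K A x - band K A y.
Proof.
move=> mA; have := bandP K (-1) y x mA; rewrite !scaleN1r addrC => ->.
by rewrite addrC.
Qed.

(** [E] collects the [x] whose projection on each [B k] lies in the span of the [k]-th failure, and
    the operator concatenates the images in [ell_p], the [k]-th one damped by [2 ^- k]. An extension
    of norm [C'], undamped on block [k], has norm at most [2 ^ k * C'], which falls below the
    threshold [4 ^ k] for large [k]. *)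
Lemma gliding_hump (B : nat -> set T) : 1 <= p -> has_M X p ->
  (forall k, measurable (B k)) -> (forall k l, k != l -> B k `&` B l = set0) ->
  ~ (forall k, inhabited (failure (B k) (4 ^+ k))).
Proof.
move=> p1 hM mB dB HF; have p0 : 0 < p by exact: lt_le_trans ltr01 p1.
(* Failures are data in [Type] known only to be inhabited, so the simultaneous choice goes through
   [cid]. *)
have [F _] : exists F : forall k, failure (B k) (4 ^+ k), True.
  have : forall k, {_ : failure (B k) (4 ^+ k) | True}.
    by move=> k; apply: cid; have [f] := HF k; exists f.
  by move=> f; exists (fun k => sval (f k)).
pose comb k (c : fI (F k) -> R) := \sum_i c i *: fe (F k) i.
have combB k c c' : comb k c - comb k c' = comb k (fun i => c i - c' i).
  by rewrite /comb -sumrB; apply: eq_bigr => i _; rewrite scalerBl.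
have combP k a c c' : a *: comb k c + comb k c' = comb k (fun i => a * c i + c' i).
  rewrite /comb scaler_sumr -big_split /=; apply: eq_bigr => i _.
  by rewrite scalerA scalerDl.
have comb_inj k c c' : comb k c = comb k c' -> c =1 c'.
  move=> cc i; have := fe_indep (F k) (fun i => c i - c' i) i.
  rewrite -/(comb k _) -combB cc subrr normr0 pmulr_rle0 ?fgam_gt0//.
  by rewrite normr_le0 subr_eq0 => /eqP.
pose E : {pred X} := fun x => `[< forall k, exists c, band K (B k) x = comb k c >].
have EP x : reflect (forall k, exists c, band K (B k) x = comb k c) (x \in E).
  exact: asboolP.
pose coord k x := xget (fun=> 0) [set c | band K (B k) x = comb k c].
have coordE k x : x \in E -> band K (B k) x = comb k (coord k x).
  by move=> /EP/(_ k); rewrite /coord => /xgetPex; exact.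
have Elin a x y : x \in E -> y \in E -> a *: x + y \in E.
  move=> xE yE; apply/EP => k; rewrite bandP// !coordE// combP; by eexists.
have E0 : 0 \in E.
  apply/EP => k; exists (fun=> 0); rewrite /comb big1 => [|i _]; last by rewrite scale0r.
  by have := bandP K (-1) 0 0 (mB k); rewrite !scaleN1r addNr => ->; rewrite addNr.
(* By [fe_indep] the coordinates of an approximating sequence are Cauchy, and their limits are the
   coordinates of the projection of [z]. *)
have Ecl : closed [set` E].
  move=> z zE; apply/EP => k.
  have /choice[u Hu] n : exists u, u \in E /\ `|z - u| <= n.+1%:R^-1.
    have [|u [uE zu]] := zE (ball z (n.+1%:R^-1)).
      by apply: nbhsx_ballx; rewrite invr_gt0 ltr0n.
    exists u; split => //; move: zu; rewrite -ball_normE /=; exact: ltW.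
  have small (e : R) : 0 < e -> exists N, forall n, (N <= n)%N -> n.+1%:R^-1 <= e.
    move=> e0; exists (Num.truncn e^-1) => n Nn.
    rewrite -[e]invrK lef_pV2 ?posrE ?invr_gt0 ?ltr0n//.
    by apply: le_trans (ltW (truncnS_gt _)) _; rewrite ler_nat.
  pose c n := coord k (u n).
  have gcc n m i : fgam (F k) * `|c n i - c m i| <= `|u n - u m|.
    apply: le_trans (fe_indep (F k) (fun i => c n i - c m i) i) _.
    rewrite -/(comb k _) -combB -!coordE; [|exact: (Hu _).1..].
    by rewrite -bandB//; exact: band_norm_le.
  have /choice[l Hl] i : exists l : R^o, limit_seq (fun n => c n i : R^o) l.
    apply: cauchy_seq_limit => e e0.
    have [|N HN] := small (fgam (F k) * e / 2).
      by rewrite divr_gt0// mulr_gt0// fgam_gt0.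
    exists N => m n Nm Nn; rewrite -(ler_pM2l (fgam_gt0 (F k))).
    apply: le_trans (gcc m n i) _.
    have -> : u m - u n = (z - u n) - (z - u m) by rewrite opprB [RHS]addrC addrA subrK.
    apply: le_trans (ler_normB _ _) _.
    apply: le_trans (lerD (le_trans (Hu n).2 (HN _ Nn)) (le_trans (Hu m).2 (HN _ Nm))) _.
    by rewrite -splitr.
  exists l; apply/eqP; rewrite -subr_eq0 -normr_eq0 eq_le normr_ge0 andbT.
  apply/ler_addgt0Pr => e e0; rewrite add0r.
  pose A := \sum_i `|fe (F k) i|; have A0 : 0 <= A by apply: sumr_ge0.
  pose e' := e / (1 + A); have e'0 : 0 < e' by rewrite divr_gt0//; lra.
  have [N1 HN1] := small _ e'0.
  have /choice[N2 HN2] i := Hl i _ e'0.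
  pose N := maxn N1 (\max_i N2 i).
  have -> : band K (B k) z - comb k l = band K (B k) (z - u N) + comb k (fun i => c N i - l i).
    by rewrite bandB// -combB -coordE ?addrA ?subrK//; exact: (Hu N).1.
  apply: le_trans (ler_normD _ _) _.
  have -> : e = e' + e' * A by rewrite /e'; field; lra.
  apply: lerD.
    apply: le_trans (band_norm_le _ _ (mB k)) _; apply: le_trans (Hu N).2 _.
    by apply: HN1; rewrite leq_maxl.
  rewrite /comb /A mulr_sumr; apply: le_trans (ler_norm_sum _ _ _) _.
  apply: ler_sum => i _; rewrite normrZ ler_wpM2r//; apply: HN2.
  by rewrite (leq_trans _ (leq_maxr _ _))//; exact: leq_bigmax.
have Esub : submod_closed E by split.
have coordP k a x y : x \in E -> y \in E ->
    coord k (a *: x + y) =1 (fun i => a * coord k x i + coord k y i).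
  move=> xE yE; apply: comb_inj; rewrite -coordE; last exact: Elin.
  by rewrite bandP// -combP !coordE.
pose Om k := fO (F k).
(* Besides the damping [2 ^- k], the power of [#|Om k|] turns the average over [Om k] into the plain
   sum of [p]-th powers of [ell_p]. *)
pose ck k : R := (2 ^+ k)^-1 * (#|Om k|%:R) `^ (- p^-1).
have Om0 k : 0 < #|Om k|%:R :> R by rewrite ltr0n fO_gt0.
have ck0 k : 0 < ck k by rewrite mulr_gt0 ?invr_gt0 ?exprn_gt0// powR_gt0.
have ckp k : ck k `^ p = ((2 ^+ k) `^ p)^-1 / #|Om k|%:R.
  rewrite powRM ?invr_ge0 ?exprn_ge0 ?powR_ge0//; congr (_ * _).
    by rewrite powRV_ge0 ?exprn_ge0.
  by rewrite -powRrM mulNr mulVf ?gt_eqF// powR_inv1// ltW.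
pose Tk k x w := \sum_i coord k x i * fT (F k) i w.
pose h x (u : {k : nat & Om k}) := ck (tag u) * Tk (tag u) x (tagged u).
(* The coordinates of [ell_p] are the codes of the pairs [(k, w)]; an integer that codes no pair
   receives 0. *)
pose TT x n := if @pickle_inv {k : nat & Om k} n is Some u then h x u else 0.
pose g x (u : {k : nat & Om k}) := `|h x u| `^ p.
have g0 x u : 0 <= g x u by exact: powR_ge0.
have TTp x n : `|TT x n| `^ p = oapp (g x) 0 (pickle_inv n).
  by rewrite /TT; case: pickle_inv => //=; rewrite normr0 powR0// gt_eqF.
have blk k x : x \in E -> \sum_(w : Om k) g x (Tagged Om w) <= (1 / 2) ^+ k * `|x| `^ p.
  move=> xE.
  have -> : \sum_(w : Om k) g x (Tagged Om w) =
     ((2 ^+ k) `^ p)^-1 * avg (fun w => `|Tk k x w| `^ p).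
    rewrite /avg mulrCA mulr_suml; apply: eq_bigr => w _.
    rewrite /g /h /= normrM (ger0_norm (ltW (ck0 k))).
    by rewrite powRM ?normr_ge0 ?(ltW (ck0 k))// ckp /Om; ring.
  apply: ler_pM; rewrite ?invr_ge0 ?powR_ge0//.
  - by apply: avg_ge0 => w; exact: powR_ge0.
  - rewrite div1r exprVn lef_pV2 ?posrE ?powR_gt0 ?exprn_gt0//.
    by rewrite -{1}[2 ^+ k]powRr1 ?exprn_ge0// ler_powR// exprn_ege1// ler1n.
  - apply: le_trans (fT_le (F k) _) _; rewrite -/(comb k _) -coordE//.
    by apply: ge0_ler_powR; rewrite ?nnegrE ?(ltW p0)//; exact: band_norm_le.
pose C := 2 `^ p^-1; have C0 : 0 <= C by exact: powR_ge0.
have TTle x N : x \in E -> \sum_(0 <= n < N) `|TT x n| `^ p <= (C * `|x|) `^ p.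
  move=> xE; under eq_bigr do rewrite TTp.
  rewrite -(@big_pmap _ _ _ _ _ (@pickle_inv {k : nat & Om k}) (index_iota 0 N) (g x)).
  set s := pmap _ _.
  have us : uniq s.
    apply: (@pmap_uniq _ _ _ pickle); last exact: iota_uniq.
    exact: pickle_invK.
  pose K' := (\max_(u <- s) tag u).+1.
  apply: (@le_trans _ _ (\sum_(u <- [seq Tagged Om w | k <- iota 0 K', w <- enum (Om k)]) g x u)).
    apply: ler_sum_uniq_sub => // -[k w] us'; apply/allpairsPdep; exists k, w.
    have kK : (tag (Tagged Om w) <= \max_(u <- s) tag u)%N by exact: leq_bigmax_seq.
    by rewrite mem_enum mem_iota add0n ltnS kK.
  rewrite big_allpairs_dep.
  have -> : iota 0 K' = index_iota 0 K' by rewrite /index_iota subn0.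
  rewrite big_mkord.
  apply: (@le_trans _ _ (\sum_(k < K') (1 / 2) ^+ k * `|x| `^ p)).
    by apply: ler_sum => k _; rewrite big_enum /=; exact: blk.
  rewrite -mulr_suml powRM// -powRrM mulVf ?gt_eqF// powRr1//.
  by rewrite ler_wpM2r ?powR_ge0// natr_geom_le.
have TTn x : x \in E -> ('N[@counting nat R]_p%:E[EFin \o TT x] <= (C * `|x|)%:E)%E.
  by move=> xE; apply: Lnorm_counting_le => // [|N]; [exact: mulr_ge0|exact: TTle].
have [|||T' [_ [C' HC'] T'E]] := hM E TT Ecl Esub.
- by move=> x xE; apply: Lfun_counting (TTn x xE).
- move=> a x y xE yE; apply/funext => n.
  rewrite /TT [RHS]/=; have -> : forall u v : nat -> R, (a *: u + v) n = a * u n + v n by [].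
  case: pickle_inv => [[k w]|]; last by rewrite mulr0 addr0.
  have tkl : Tk k (a *: x + y) w = a * Tk k x w + Tk k y w.
    rewrite /Tk mulr_sumr -big_split /=; apply: eq_bigr => i _.
    by rewrite coordP//; ring.
  by rewrite /h /= tkl; ring.
- by exists C.
(* This gives [|C'| < k <= 2 ^ k], so the undamped extension on block [k] has norm at most
   [4 ^ k]. *)
pose k := (Num.truncn `|C'|).+1.
pose S f (w : Om k) := (ck k)^-1 * T' f (pickle (Tagged Om w)).
have [|f|i [w]] := fT_ext (F k) S.
- move=> a f f' w; rewrite /S linearP.
  have -> : forall u v : nat -> R, forall n, (a *: u + v) n = a * u n + v n by [].
  by ring.
- have HN N : \sum_(0 <= n < N) `|T' f n| `^ p <= (`|C'| * `|f|) `^ p.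
    apply: Lnorm_counting_ge => //.
    by apply: le_trans (HC' f) _; rewrite lee_fin ler_wpM2r// ler_norm.
  have H : \sum_(w : Om k) `|T' f (pickle (Tagged Om w))| `^ p <= (`|C'| * `|f|) `^ p.
    pose s := [seq pickle (Tagged Om w) | w <- enum (Om k)].
    pose N := (\max_(n <- s) n).+1.
    apply: le_trans (HN N).
    rewrite -[X in X <= _]big_enum -(big_map (fun w => pickle (Tagged Om w)) xpredT
      (fun n => `|T' f n| `^ p)) /=.
    apply: ler_sum_uniq_sub => [|n ns|n]; last exact: powR_ge0.
      rewrite map_inj_in_uniq ?enum_uniq// => w w' _ _ /(pcan_inj pickleK) /eqP.
      by rewrite eq_Tagged => /eqP.
    have nN : (n <= \max_(n <- s) n)%N by exact: leq_bigmax_seq.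
    by rewrite /index_iota subn0 mem_iota add0n ltnS nN.
  have -> : avg (fun w => `|S f w| `^ p) =
      (2 ^+ k) `^ p * \sum_(w : Om k) `|T' f (pickle (Tagged Om w))| `^ p.
    rewrite /avg mulr_suml mulr_sumr; apply: eq_bigr => w _.
    rewrite /S normrM normfV (ger0_norm (ltW (ck0 k))) powRM ?invr_ge0 ?(ltW (ck0 k))//.
    rewrite powRV_ge0 ?(ltW (ck0 k))// ckp.
    have a0 : (2 ^+ k) `^ p != 0 :> R by rewrite gt_eqF// powR_gt0 ?exprn_gt0.
    have n0 : #|Om k|%:R != 0 :> R by rewrite gt_eqF.
    by field; rewrite a0 n0.
  have k0 : 0 <= 2 ^+ k :> R by rewrite exprn_ge0.
  apply: (@le_trans _ _ ((2 ^+ k) `^ p * (`|C'| * `|f|) `^ p)).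
    by rewrite ler_wpM2l ?powR_ge0.
  rewrite -powRM ?mulr_ge0//; apply: ge0_ler_powR; rewrite ?nnegrE ?(ltW p0)// ?mulr_ge0// ?exprn_ge0//.
  rewrite mulrA ler_wpM2r//.
  have -> : 4 = 2 * 2 :> R by rewrite -natrM.
  rewrite exprMn ler_wpM2l//; apply: ltW; apply: lt_le_trans (truncnS_gt _) _.
  by rewrite -/k -natrX ler_nat ltnW// ltn_expl.
apply; have eiE : fe (F k) i \in E.
  apply/EP => l; have [<-|kl] := eqVneq k l.
    exists (fun j => (j == i)%:R); rewrite fe_band /comb (bigD1 i)//= eqxx scale1r big1 ?addr0//.
    by move=> j /negbTE ->; rewrite scale0r.
  exists (fun=> 0); rewrite /comb big1 => [|j _]; last by rewrite scale0r.
  by apply: band_disj (fe_band (F k) i) => //; rewrite dB// eq_sym.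
rewrite /S T'E// /TT pickleK_inv /h /= mulKf ?gt_eqF// /Tk.
have ci : coord k (fe (F k) i) =1 (fun j => (j == i)%:R).
  apply: comb_inj; rewrite -coordE// fe_band /comb (bigD1 i)//= eqxx scale1r big1 ?addr0//.
  by move=> j /negbTE ->; rewrite scale0r.
rewrite (bigD1 i)//= ci eqxx mul1r big1 ?addr0// => j /negbTE ji.
by rewrite ci ji mul0r.
Qed.
End Gliding.

(** * Moment comparison on finite probability spaces *)

Section FiniteMoments.
Context {R : realType} (W : finType).
Hypothesis W0 : (0 < #|W|)%N.

Lemma avg_normalized (p b : R) (v : W -> R) : 0 < b ->
  avg (fun w => `|v w| `^ p) <= b `^ p -> avg (fun w => (`|v w| / b) `^ p) <= 1.
Proof.
move=> b0 H; under eq_avg do rewrite powRM ?invr_ge0 ?(ltW b0)// mulrC.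
rewrite avgZ powRV_ge0 ?(ltW b0)// ler_pdivrMl ?powR_gt0//.
by rewrite mulr1.
Qed.

(** Pointwise, [u ^+ 2] is at most 1 for [u <= 1] and at most the [p]-th power of [u] otherwise; the
    sum of both bounds explains the factor 2. *)
Lemma avg_sq_le (p b : R) (v : W -> R) : 2 <= p -> 0 < b ->
  avg (fun w => `|v w| `^ p) <= b `^ p -> avg (fun w => v w ^+ 2) <= 2 * b ^+ 2.
Proof.
move=> p2 b0 /(avg_normalized b0) H.
have E w : v w ^+ 2 <= b ^+ 2 * (1 + (`|v w| / b) `^ p).
  have -> : v w ^+ 2 = `|v w| ^+ 2 by rewrite -normrX ger0_norm// sqr_ge0.
  have u0 : 0 <= `|v w| / b by rewrite divr_ge0// ltW.
  have -> : `|v w| = b * (`|v w| / b) by rewrite mulrCA divff ?mulr1// gt_eqF.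
  have -> : b * (`|v w| / b) / b = `|v w| / b by rewrite mulrAC divff ?mul1r// gt_eqF.
  move: (`|v w| / b) u0 => u u0; rewrite exprMn ler_wpM2l ?sqr_ge0//.
  have [u1|u1] := lerP u 1.
    apply: (@le_trans _ _ 1); first by rewrite expr_le1.
    by rewrite lerDl powR_ge0.
  apply: (@le_trans _ _ (u `^ p)); last by rewrite lerDr.
  by rewrite -powR_mulrn// ler_powR// ltW.
apply: le_trans (ler_avg E) _; rewrite avgZ avgD avg_cst//.
by have := sqr_ge0 b; nra.
Qed.

(** A form of Hoelder's inequality for [y] bounded by 1 and small on average. The normalized [|v|]
    is split at the level [tau]: below it the product is at most [tau * |y|], above it [|y| <= 1]
    and [u <= tau^(1 - p) * u^p]. The level [be^(- 1 / p)] balances the two parts. *)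
Lemma avg_mul_small_le (p b be : R) (v y : W -> R) : 1 < p -> 0 < b -> 0 < be ->
  (forall w, `|y w| <= 1) -> avg (fun w => `|y w|) <= be ->
  avg (fun w => `|v w| `^ p) <= b `^ p ->
  avg (fun w => v w * y w) <= 2 * b * be `^ (1 - p^-1).
Proof.
move=> p1 b0 be0 y1 ybe /(avg_normalized b0) H.
have p0 : 0 < p by lra.
pose tau := be `^ (- p^-1); have tau0 : 0 < tau by exact: powR_gt0.
have t1 : be * tau = be `^ (1 - p^-1).
  by rewrite powRD ?powRr1 ?ltW//; apply/implyP => _; rewrite gt_eqF.
have t2 : tau `^ (1 - p) = be `^ (1 - p^-1).
  rewrite -powRrM; congr (_ `^ _); field; lra.
have E w : v w * y w <= b * (tau * `|y w| + tau `^ (1 - p) * (`|v w| / b) `^ p).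
  apply: le_trans (ler_norm _) _; rewrite normrM.
  have u0 : 0 <= `|v w| / b by rewrite divr_ge0// ltW.
  have -> : `|v w| * `|y w| = b * ((`|v w| / b) * `|y w|).
    by rewrite mulrA mulrCA divff ?mulr1// gt_eqF.
  rewrite ler_pM2l//; move: (`|v w| / b) u0 => u u0.
  have [ut|tu] := lerP u tau.
    rewrite -[X in X <= _]addr0; apply: lerD; first by rewrite ler_wpM2r.
    by rewrite mulr_ge0 ?powR_ge0.
  rewrite -[X in X <= _]add0r; apply: lerD; first by rewrite mulr_ge0// ltW.
  apply: (@le_trans _ _ u); first by rewrite ler_piMr.
  have up : 0 < u by exact: lt_trans tu.
  have uE : u = u `^ (1 - p) * u `^ p.
    by rewrite -powRD ?subrK ?powRr1 ?(ltW up)//; apply/implyP => _; rewrite gt_eqF.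
  rewrite {1}uE ler_wpM2r ?powR_ge0//.
  have -> : 1 - p = - (p - 1) by ring.
  rewrite !powRN lef_pV2 ?posrE ?powR_gt0//.
  by apply: ge0_ler_powR; rewrite ?nnegrE ?(ltW up) ?(ltW tau0) ?(ltW tu)//; lra.
apply: le_trans (ler_avg E) _; rewrite avgZ avgD !avgZ t2.
have := powR_ge0 be (1 - p^-1); rewrite -t1 => z0.
have h1 : tau * avg (fun w => `|y w|) <= be * tau by rewrite mulrC ler_wpM2r// ltW.
have h2 : be * tau * avg (fun w => (`|v w| / b) `^ p) <= be * tau.
  by rewrite ler_piMr.
have := ler_wpM2l (ltW b0) (lerD h1 h2); lra.
Qed.
End FiniteMoments.

(** * Sparse random signs *)

Section SparseSigns.
Context {R : realType} (q : nat).
Local Notation W := ('I_q.+1 * bool)%type.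

(* A symmetric variable with values in {-1, 0, 1}, nonzero with probability
   1 / (q + 1). *)
Definition sparse_sign (v : W) : R := (v.1 == ord0)%:R * sgb v.2.

Lemma card_sparse_gt0 : (0 < #|{: W}|)%N.
Proof. by rewrite card_prod card_ord card_bool. Qed.

Lemma avg_pair (U V : finType) (f : U -> V -> R) :
  avg (fun w : U * V => f w.1 w.2) = avg (fun u => avg (f u)).
Proof.
rewrite /avg -mulr_suml pair_big /= card_prod natrM invfM.
by rewrite [X in _ * X = _]mulrC mulrA.
Qed.

Lemma avg_sparse_sign (f : R -> R) :
  avg (fun v => f (sparse_sign v)) = f 0 + ((f 1 + f (-1)) / 2 - f 0) / q.+1%:R.
Proof.
rewrite (avg_pair (fun u v => f ((u == ord0)%:R * sgb v))).
under eq_avg do rewrite avg_bool /sgb expr1 expr0 mulr1 mulrN1.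
rewrite /avg card_ord big_ord_recl /= mulr1n.
under eq_bigr do rewrite /= mulr0n oppr0.
rewrite sumr_const card_ord -mulr_natr.
have -> : q.+1%:R = 1 + q%:R :> R by rewrite -natr1 addrC.
by field; have : 0 <= q%:R :> R by []; lra.
Qed.

Lemma avg_sparse_expR (x : R) : `|x| <= 1 / 2 ->
  avg (fun v => expR (x * sparse_sign v)) <= 1 + 2 * q.+1%:R^-1 * x ^+ 2.
Proof.
move=> /expR_half_cosh h; rewrite (avg_sparse_sign (fun y => expR (x * y))).
rewrite mulr0 mulr1 mulrN1 expR0 lerD2l mulrAC ler_wpM2r ?invr_ge0//.
by lra.
Qed.

Lemma sparse_sign_sq v : sparse_sign v ^+ 2 = `|sparse_sign v|.
Proof.
rewrite /sparse_sign exprMn expr2 -natrM mulnb andbb [sgb _ ^+ 2]expr2 sgb_sq mulr1.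
by rewrite normrM normr_sgb mulr1 ger0_norm.
Qed.

Lemma normr_sparse_sign v : `|sparse_sign v| <= 1.
Proof.
by rewrite /sparse_sign normrM normr_sgb mulr1 ger0_norm//; case: (_ == _).
Qed.

Lemma avg_ffun_coord (I V : finType) (i : I) (f : V -> R) : (0 < #|V|)%N ->
  avg (fun w : {ffun I -> V} => f (w i)) = avg f.
Proof.
move=> V0; pose g j v : R := if j == i then f v else 1.
transitivity (avg (fun w : {ffun I -> V} => \prod_j g j (w j))).
  by apply: eq_avg => w; rewrite /g -big_mkcond /= big_pred1_eq.
rewrite avg_prod (bigD1 i)//= /g eqxx big1 ?mulr1// => j /negbTE ->.
by rewrite avg_cst.
Qed.

Lemma avg_sparse_sq (I : finType) (i : I) :
  avg (fun w : {ffun I -> W} => sparse_sign (w i) ^+ 2) = q.+1%:R^-1.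
Proof.
rewrite (avg_ffun_coord i (fun v => sparse_sign v ^+ 2) card_sparse_gt0).
by rewrite (avg_sparse_sign (fun y => y ^+ 2)); field.
Qed.
End SparseSigns.

(** * Step functions over disjoint families of sets *)

Section Families.
Context {R : realType} {X : completeNormedModType R} (K : kothe_space X).
Local Notation mu := (leb01 R).
Local Notation T := (measurableTypeR R).
Variable I : finType.
Variable A : I -> set T.

Definition pw_disjoint := forall i j, i != j -> A i `&` A j = set0.

Definition step (c : I -> R) (t : T) : R := \sum_i c i * \1_(A i) t.

Hypothesis mA : forall i, measurable (A i).

Lemma measurable_step c : measurable_fun setT (step c).
Proof.
apply: measurable_sum => i; apply: measurable_funM => //.
Qed.

Lemma good_term c i : good K (fun t => c i * \1_(A i) t).
Proof. exact/goodZ/good_indic. Qed.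

Lemma good_step c : good K (step c).
Proof. by apply: good_sum => i _; exact: good_term. Qed.

Lemma el_step c : el K (step c) = \sum_i c i *: el K \1_(A i).
Proof.
rewrite /step el_sum => [|i _]; last exact: good_term.
by apply: eq_bigr => i _; rewrite elZ//; exact: good_indic.
Qed.

Hypothesis dA : pw_disjoint.

Lemma step_in c i t : A i t -> step c t = c i.
Proof.
move=> Ait; rewrite /step (bigD1 i)//= indicE mem_set// mulr1 big1 ?addr0// => j ji.
rewrite indicE memNset ?mulr0// => Ajt.
by have : (A j `&` A i) t by []; rewrite dA.
Qed.

Lemma step_out c t : (forall i, ~ A i t) -> step c t = 0.
Proof.
by move=> Ait; rewrite /step big1// => j _; rewrite indicE memNset ?mulr0.
Qed.

Lemma step_norm c t : `|step c t| = step (fun i => `|c i|) t.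
Proof.
have [[i Ait]|/forallNP h] := pselect (exists i, A i t); first by rewrite !(step_in _ Ait).
by rewrite !step_out// normr0.
Qed.

Lemma step_le c d t : (forall i, `|c i| <= `|d i|) -> `|step c t| <= `|step d t|.
Proof.
move=> cd; have [[i Ait]|/forallNP h] := pselect (exists i, A i t).
  by rewrite !(step_in _ Ait).
by rewrite !step_out// normr0.
Qed.

Lemma nrm_step_le c d : (forall i, `|c i| <= `|d i|) -> nrm K (step c) <= nrm K (step d).
Proof.
move=> cd; apply: nrm_leW; [exact: good_step..|] => t; exact: step_le.
Qed.

Lemma nrm_step_eq c d : (forall i, `|c i| = `|d i|) -> nrm K (step c) = nrm K (step d).
Proof.
by move=> cd; apply/le_anti; rewrite !nrm_step_le// => i; rewrite cd.
Qed.

Lemma nrm_term_le c i : nrm K (fun t => c i * \1_(A i) t) <= nrm K (step c).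
Proof.
apply: nrm_leW; [exact: good_term|exact: good_step|] => t.
have [Ait|nAit] := pselect (A i t).
  by rewrite (step_in _ Ait) indicE mem_set// mulr1.
by rewrite indicE memNset// mulr0 normr0.
Qed.
End Families.

Lemma rep_in_band (R : realType) (X : completeNormedModType R) (K : kothe_space X)
    (f : measurableTypeR R -> R) (x : X) (B : set (measurableTypeR R)) :
  measurable B -> rep K f x -> (forall t, ~ B t -> f t = 0) -> band K B x = x.
Proof.
move=> mB fx f0; apply: rep_uniq (rep_band mB fx) _; apply: rep_ext fx _ => t.
have [Bt|nBt] := pselect (B t); first by rewrite indicE mem_set// mul1r.
by rewrite f0// mulr0.
Qed.

(** * From a bad lower 2-estimate to an operator without good extension *)

Section LowerFailure.
Context {R : realType} {X : completeNormedModType R} (K : kothe_space X).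
Local Notation T := (measurableTypeR R).
Variable p : R.
Hypothesis p2 : 2 < p.

(** The constants [c] and [rho] are independent of the number of vectors, and no upper [ell_2]
    estimate is asked for: only boundedness and domination of the [ell_2] norm of the
    coefficients. *)
Definition rademacher_on (H : set T) (c rho : R) := forall I : finType,
  exists r : I -> X, [/\ forall i, band K H (r i) = r i, forall i, `|r i| <= rho &
    forall x : I -> R, c * Num.sqrt (\sum_i x i ^+ 2) <= `|\sum_i x i *: r i|].

Lemma small_inv_powR (s e : R) : 0 < s -> 0 < e -> exists q : nat, q.+1%:R^-1 `^ s <= e.
Proof.
move=> s0 e0; exists (Num.truncn ((e `^ s^-1)^-1)).
have z0 : 0 < e `^ s^-1 by exact: powR_gt0.
have eE : e = (e `^ s^-1) `^ s by rewrite -powRrM mulVf ?gt_eqF// powRr1// ltW.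
rewrite [X in _ <= X]eE; apply: ge0_ler_powR; rewrite ?nnegrE ?invr_ge0 ?(ltW s0) ?(ltW z0)//.
by rewrite -[X in _ <= X]invrK lef_pV2 ?posrE ?invr_gt0 ?ltr0n// ltW// truncnS_gt.
Qed.

Lemma sum_mul_le_avg (I W : finType) (f g : I -> W -> R) (l : R) : 0 < l ->
  \sum_i avg (fun w => f i w * g i w) <=
  l / 2 * \sum_i avg (fun w => f i w ^+ 2) + (2 * l)^-1 * \sum_i avg (fun w => g i w ^+ 2).
Proof.
move=> l0; rewrite !mulr_sumr -big_split /=; apply: ler_sum => i _.
rewrite -!avgZ -avgD; apply: ler_avg => w; move: (f i w) (g i w) => x y.
have : 0 <= (l * x - y) ^+ 2 / (2 * l) by rewrite divr_ge0 ?sqr_ge0//; lra.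
have -> : (l * x - y) ^+ 2 / (2 * l) = l / 2 * x ^+ 2 + (2 * l)^-1 * y ^+ 2 - x * y.
  by field; lra.
lra.
Qed.

(** The vectors [e i] are normalized pieces plus [th] times Rademacher-like vectors. The first
    summand controls the largest coefficient and the second one [sqrt be] times the [ell_2] norm, as
    the moment inequality demands for the operator sending [e i] to [ka] times independent sparse
    signs. For an extension [S], the sum of [al i ^+ 2] times the average of [S (e i) * y i] would
    equal [ka * be * S2] and be at most 5/8 of it. *)
Lemma lower_failure (M c rho : R) : 0 < M -> 0 < c -> 0 < rho ->
  exists2 e2 : R, 0 < e2 & forall (H B : set T) (I : finType) (a : I -> R) (A : I -> set T),
    measurable H -> measurable B -> B `&` H = set0 -> rademacher_on H c rho ->
    (forall i, measurable (A i)) -> pw_disjoint A -> (forall i, A i `<=` B) ->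
    nrm K (step A a) ^+ 2 < e2 * \sum_i nrm K (fun t => a i * \1_(A i) t) ^+ 2 ->
    inhabited (failure K p (B `|` H) M).
Proof.
move=> M0 c0 rho0; have p0 : 0 < p by exact: lt_trans p2.
pose Cp : R := (2 * p) `^ p * (2 * expR 1).
have Cp0 : 0 < Cp by rewrite mulr_gt0 ?powR_gt0 ?mulr_gt0 ?expR_gt0.
pose ka := Cp `^ (- p^-1); have ka0 : 0 < ka by exact: powR_gt0.
have kap : ka `^ p * Cp = 1.
  rewrite -powRrM mulNr mulVf ?gt_eqF// powR_inv1 ?(ltW Cp0)//.
  by rewrite mulVf// gt_eqF.
have s0 : 0 < 2^-1 - p^-1 by rewrite subr_gt0 ltf_pV2 ?posrE.
(* The exponent is positive since [p > 2]. This [q] makes the Rademacher part at most a quarter of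
   the trace [ka * be * S2]. *)
have [|q Hq] := @small_inv_powR (2^-1 - p^-1) (ka * c / (8 * M * rho)) s0.
  by rewrite divr_gt0 ?mulr_gt0.
set be := q.+1%:R^-1 in Hq; have be0 : 0 < be by rewrite invr_gt0.
(* With this value, [ka^-1 * (2 * b ^+ 2)] is one eighth of the trace. *)
exists (ka ^+ 2 * be / (16 * M ^+ 2)).
  by rewrite divr_gt0 ?mulr_gt0 ?exprn_gt0.
set e2 := _ / _ => H B I a A mH mB BH radH mA dA AB.
set u := fun i t => a i * \1_(A i) t.
pose al i := nrm K (u i); rewrite -/(al _).
set S2 := \sum_i _ => small; have al0 i : 0 <= al i by exact: nrm_ge0.
have S20 : 0 < S2.
  have S2n : 0 <= S2 by apply: sumr_ge0 => i _; exact: sqr_ge0.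
  rewrite lt_def S2n andbT; apply/eqP => S2e; move: small.
  by rewrite S2e mulr0 ltNge sqr_ge0.
have [r [rH rrho rlow]] := radH I.
(* Pieces of norm 0 cannot be normalized: as the inverse of 0 is 0, their first summand in [e i]
   vanishes, and [de] removes them from the operator. *)
pose de i : R := (0 < al i)%R%:R.
have aldei i : (al i)^-1 * al i = de i.
  rewrite /de; have [->|n0] := eqVneq (al i) 0; first by rewrite mulr0 ltxx.
  by rewrite mulVf// lt_def n0 al0.
pose th := Num.sqrt be / c.
have th0 : 0 < th by rewrite divr_gt0// sqrtr_gt0.
pose e i := (al i)^-1 *: el K (u i) + th *: r i.
have gu i : good K (u i) by exact: good_term.
have uB i : band K B (el K (u i)) = el K (u i).
  apply: rep_in_band (elP (gu i)) _ => // t nBt; rewrite /u indicE memNset ?mulr0//.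
  by move=> /AB.
have mBH : measurable (B `|` H) by exact: measurableU.
have BHdisj x y : band K B x = x -> band K H y = y ->
   [/\ band K B y = 0, band K H x = 0, band K (B `|` H) x = x & band K (B `|` H) y = y].
  move=> xB yH; split.
  - exact: band_disj yH.
  - by apply: band_disj xB => //; rewrite setIC.
  - rewrite -xB; apply: (rep_in_band mBH (rep_band mB (rep_refl K x))) => t /not_orP[nBt _].
    by rewrite indicE memNset// mul0r.
  - rewrite -yH; apply: (rep_in_band mBH (rep_band mH (rep_refl K y))) => t /not_orP[_ nBt].
    by rewrite indicE memNset// mul0r.
have bandZ D (mD : measurable D) z x : band K D (z *: x) = z *: band K D x.
  have h0 : band K D 0 = 0.
    by have := bandP K (-1) 0 0 mD; rewrite !scaleN1r addNr => ->; rewrite addNr.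
  by have := bandP K z x 0 mD; rewrite h0 !addr0.
have band_sum D (mD : measurable D) (x : I -> R) (v : I -> X) :
   band K D (\sum_i x i *: v i) = \sum_i x i *: band K D (v i).
  apply: (big_ind2 (fun y z => band K D y = z)) => //.
  - by have := bandZ _ mD 0 0; rewrite !scale0r.
  - by move=> x1 x2 y1 y2 <- <-; rewrite bandD.
  - by move=> i _; exact: bandZ.
have eBH i : band K (B `|` H) (e i) = e i.
  have [_ _ h1 h2] := BHdisj _ _ (uB i) (rH i).
  by rewrite /e bandP// bandZ// h1 h2.
have eB i : band K B (e i) = (al i)^-1 *: el K (u i).
  have [h1 _ _ _] := BHdisj _ _ (uB i) (rH i).
  by rewrite /e bandP// bandZ// h1 uB scaler0 addr0.
have eH i : band K H (e i) = th *: r i.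
  have [_ h1 _ _] := BHdisj _ _ (uB i) (rH i).
  by rewrite /e bandP// bandZ// h1 rH scaler0 add0r.
have up x i : `|x i * de i| <= `|\sum_j x j *: e j|.
  apply: le_trans (band_norm_le K _ mB); rewrite band_sum//.
  under eq_bigr do rewrite eB.
  have -> : \sum_j x j *: ((al j)^-1 *: el K (u j)) =
      el K (step A (fun j => x j * (al j)^-1 * a j)).
    rewrite el_step//; apply: eq_bigr => j _; rewrite elZ; last exact: good_indic.
    by rewrite !scalerA.
  rewrite -/(nrm K _); apply: le_trans (nrm_term_le K mA dA _ i).
  have -> : (fun t => x i * (al i)^-1 * a i * \1_(A i) t) =
    (fun t => (x i * (al i)^-1) * u i t) by apply/funext => t; rewrite /u !mulrA.
  rewrite nrmZ// -/(al i) !normrM normfV [`|al i|]ger0_norm// -mulrA aldei.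
  by rewrite (ger0_norm (ler0n _ _)).
have lo x : be * \sum_i x i ^+ 2 <= `|\sum_j x j *: e j| ^+ 2.
  have xs : 0 <= \sum_i x i ^+ 2 by apply: sumr_ge0 => i _; exact: sqr_ge0.
  have : th * (c * Num.sqrt (\sum_i x i ^+ 2)) <= `|\sum_j x j *: e j|.
    apply: le_trans (band_norm_le K _ mH); rewrite band_sum//.
    under [X in _ <= `|X|]eq_bigr do rewrite eH scalerA mulrC -scalerA.
    by rewrite -scaler_sumr normrZ (ger0_norm (ltW th0)) ler_pM2l.
  have -> : th * (c * Num.sqrt (\sum_i x i ^+ 2)) = Num.sqrt (be * \sum_i x i ^+ 2).
    by rewrite sqrtrM ?(ltW be0)// /th mulrA divfK// gt_eqF.
  move=> h; rewrite -[X in X <= _]sqr_sqrtr; last by rewrite mulr_ge0// ltW.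
  by rewrite lerXn2r// nnegrE ?sqrtr_ge0.
pose Om : finType := {ffun I -> 'I_q.+1 * bool}.
have Om0 : (0 < #|Om|)%N by rewrite card_ffun expn_gt0 card_sparse_gt0.
pose tT i (w : Om) : R := ka * de i * sparse_sign (w i).
constructor; apply: (@Failure _ _ _ _ _ _ I Om e tT (Num.sqrt be) Om0) => //.
- by rewrite sqrtr_gt0.
- move=> x i; rewrite -(@ler_pXn2r _ 2) ?nnegrE ?mulr_ge0 ?sqrtr_ge0//.
  apply: le_trans (lo x); rewrite exprMn sqr_sqrtr ?(ltW be0)//.
  rewrite ler_wpM2l ?(ltW be0)// (bigD1 i)//= -normrX ger0_norm ?sqr_ge0// lerDl.
  by apply: sumr_ge0 => j _; exact: sqr_ge0.
- move=> x; set D := `|\sum_i x i *: e i|.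
  have -> : avg (fun w : Om => `|\sum_i x i * tT i w| `^ p) = ka `^ p *
     avg (fun w : Om => `|\sum_i (x i * de i) * sparse_sign (w i)| `^ p).
    rewrite -avgZ; apply: eq_avg => w.
    have -> : \sum_i x i * tT i w = ka * \sum_i (x i * de i) * sparse_sign (w i).
      by rewrite mulr_sumr; apply: eq_bigr => i _; rewrite /tT; ring.
    by rewrite normrM (ger0_norm (ltW ka0)) powRM// ltW.
  have [D_eq|D0] := eqVneq D 0.
    have x0 i : x i * de i = 0.
      by apply/eqP; rewrite -normr_eq0 eq_le normr_ge0 andbT -D_eq up.
    rewrite D_eq powR0 ?gt_eqF//.
    under eq_avg => w do under eq_bigr => i _ do rewrite x0 mul0r.
    under eq_avg => w do rewrite big1// normr0 powR0 ?gt_eqF//.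
    by rewrite avg_cst// mulr0.
  have Dp : 0 < D by rewrite lt_def D0 /D normr_ge0.
  apply: (@le_trans _ _ (ka `^ p * (Cp * D `^ p))).
    rewrite ler_wpM2l ?powR_ge0//.
    apply: (avg_powR_sum (be := be)) => //; first exact: avg_sparse_expR.
    apply: le_trans (lo x); rewrite ler_wpM2l ?(ltW be0)//; apply: ler_sum => i _.
    by rewrite exprMn ler_piMr ?sqr_ge0// /de; case: (0 < al i); rewrite ?expr1n ?expr0n.
  by rewrite mulrA kap mul1r.
- move=> S Slin SM; apply: contrapT => nex.
  have SE i w : S (e i) w = tT i w.
    by apply: contrapT => h; apply: nex; exists i, w.
  have S0 w : S 0 w = 0.
    by have := Slin (-1) 0 0 w; rewrite scaleN1r addNr mulN1r addNr.
  have SZ z f w : S (z *: f) w = z * S f w by have := Slin z f 0 w; rewrite S0 !addr0.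
  have SD f g w : S (f + g) w = S f w + S g w.
    by have := Slin 1 f g w; rewrite scale1r mul1r.
  have Ssum (z : I -> R) (f : I -> X) w : S (\sum_i z i *: f i) w = \sum_i z i * S (f i) w.
    apply: (big_ind2 (fun y z => S y w = z)) => // x1 x2 y1 y2 <- <-.
    by rewrite SD.
  pose y i (w : Om) : R := sparse_sign (w i).
  pose b := M * Num.sqrt (e2 * S2).
  have e20 : 0 < e2 by rewrite divr_gt0 ?mulr_gt0 ?exprn_gt0.
  have b0 : 0 < b by rewrite mulr_gt0// sqrtr_gt0 mulr_gt0.
  have b2 : b ^+ 2 = M ^+ 2 * (e2 * S2) by rewrite exprMn sqr_sqrtr// mulr_ge0 ?ltW.
  (* Averaging over signs [sg] turns the square sum into second moments of [S] on signed step
     functions, whose norm is that of [step A a], hence small. *)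
  have Q : \sum_i avg (fun w => S (el K (u i)) w ^+ 2) <= 2 * b ^+ 2.
    rewrite -avg_sum; under eq_avg do rewrite -avg_sign_sum_sq.
    rewrite exchange_avg -[X in _ <= X](@avg_cst _ {ffun I -> bool}) ?card_signs_gt0//.
    apply: ler_avg => sg.
    pose F := \sum_i sgb (sg i) *: el K (u i).
    under eq_avg do rewrite -Ssum.
    apply: (@avg_sq_le _ _ Om0 p) => //; first exact: ltW.
    apply: le_trans (SM _) _; apply: ge0_ler_powR; rewrite ?nnegrE ?(ltW p0) ?(ltW b0)//.
      by rewrite mulr_ge0 ?(ltW M0).
    rewrite ler_pM2l//.
    have -> : \sum_i sgb (sg i) *: el K (u i) = el K (step A (fun i => sgb (sg i) * a i)).
      rewrite el_step//; apply: eq_bigr => i _; rewrite elZ; last exact: good_indic.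
      by rewrite scalerA.
    rewrite -/(nrm K _) (nrm_step_eq K mA dA (d := a)); last first.
      by move=> i; rewrite normrM normr_sgb mul1r.
    rewrite -(@ler_pXn2r _ 2) ?nnegrE ?nrm_ge0 ?sqrtr_ge0//.
    by rewrite sqr_sqrtr; [exact: ltW|apply: mulr_ge0; exact: ltW].
  have H1 : \sum_i avg (fun w => S (el K (u i)) w * (al i * y i w)) <=
      ka^-1 * (2 * b ^+ 2) + ka / 4 * (be * S2).
    have l0 : 0 < 2 / ka by rewrite divr_gt0.
    apply: le_trans (sum_mul_le_avg _ _ l0) _.
    have -> : 2 / ka / 2 = ka^-1 by field; lra.
    have -> : (2 * (2 / ka))^-1 = ka / 4 by field; lra.
    apply: lerD; first by rewrite ler_wpM2l ?invr_ge0 ?(ltW ka0).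
    rewrite ler_wpM2l ?divr_ge0 ?(ltW ka0)// mulr_sumr.
    apply: ler_sum => i _; under eq_avg do rewrite exprMn.
    by rewrite avgZ avg_sparse_sq mulrC.
  have H2 i : avg (fun w => S (r i) w * y i w) <= 2 * (M * rho) * be `^ (1 - p^-1).
    apply: avg_mul_small_le => //.
    - by apply: lt_trans p2; rewrite ltr1n.
    - by rewrite mulr_gt0.
    - by move=> w; exact: normr_sparse_sign.
    - under eq_avg do rewrite /y -sparse_sign_sq.
      by rewrite avg_sparse_sq.
    - apply: le_trans (SM _) _; apply: ge0_ler_powR; rewrite ?nnegrE ?(ltW p0)//.
      + by rewrite mulr_ge0 ?(ltW M0).
      + by rewrite mulr_ge0 ?(ltW M0) ?(ltW rho0).
      + by rewrite ler_pM2l.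
  have tot : \sum_i al i ^+ 2 * avg (fun w => S (e i) w * y i w) = ka * be * S2.
    rewrite /S2 mulr_sumr; apply: eq_bigr => i _.
    under eq_avg do rewrite SE /tT -mulrA -expr2.
    rewrite avgZ avg_sparse_sq -/be /de -[nrm K _]/(al i); have := al0 i; rewrite le_eqVlt.
    move=> /predU1P[<-|->]; first by rewrite expr0n !(mul0r, mulr0).
    by rewrite mulr1n; ring.
  have tot2 i : al i ^+ 2 * avg (fun w => S (e i) w * y i w) =
      avg (fun w => S (el K (u i)) w * (al i * y i w)) +
      al i ^+ 2 * (th * avg (fun w => S (r i) w * y i w)).
    rewrite -!avgZ -avgD; apply: eq_avg => w; rewrite /e SD !SZ.
    have -> : al i ^+ 2 * (((al i)^-1 * S (el K (u i)) w + th * S (r i) w) * y i w) =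
      (al i * ((al i)^-1 * al i)) * S (el K (u i)) w * y i w + al i ^+ 2 * (th * (S (r i) w * y i w)).
      by ring.
    congr (_ + _); rewrite aldei /de; have := al0 i; rewrite le_eqVlt.
    by move=> /predU1P[<-|->]; rewrite ?ltxx /= ?mulr1n ?mulr0n; ring.
  (* The factor [sqrt be] of [th] combines with [be^(1 - 1/p)] into [be * be^(1/2 - 1/p)]; the last
     factor is bounded by the choice of [q]. *)
  have thb : th * (2 * (M * rho) * be `^ (1 - p^-1)) <= be * ka / 4.
    have E : Num.sqrt be * be `^ (1 - p^-1) = be * be `^ (2^-1 - p^-1).
      rewrite -powR12_sqrt ?(ltW be0)// -{3}[be]powRr1 ?(ltW be0)//.
      rewrite -!powRD; try by apply/implyP => _; rewrite gt_eqF.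
      by congr (_ `^ _); lra.
    have -> : th * (2 * (M * rho) * be `^ (1 - p^-1)) =
       2 * (M * rho) / c * be * be `^ (2^-1 - p^-1).
      rewrite -[RHS]mulrA -E /th; ring.
    apply: (@le_trans _ _ (2 * (M * rho) / c * be * (ka * c / (8 * M * rho)))).
      by rewrite ler_wpM2l// mulr_ge0 ?(ltW be0)// divr_ge0 ?(ltW c0)// !mulr_ge0// ltW.
    apply: le_of_eq; field.
    by rewrite !gt_eqF.
  have : ka * be * S2 <= ka^-1 * (2 * b ^+ 2) + ka / 4 * (be * S2) + S2 * (be * ka / 4).
    rewrite -tot; under eq_bigr do rewrite tot2.
    rewrite big_split /=; apply: lerD => //; rewrite /S2 mulr_suml.
    apply: ler_sum => i _; rewrite ler_wpM2l ?sqr_ge0//; apply: le_trans thb.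
    by rewrite ler_pM2l.
  have -> : ka^-1 * (2 * b ^+ 2) = ka * be * S2 / 8.
    by rewrite b2 /e2; field; rewrite !gt_eqF.
  have : 0 < ka * be * S2 by rewrite !mulr_gt0.
  lra.
Qed.
End LowerFailure.

(** * Hahn-Banach for finitely many vectors *)

Section SublinearMinorant.
Context {R : realType} {V : lmodType R}.

Definition sublinear (P : V -> R) :=
  (forall x y, P (x + y) <= P x + P y) /\ (forall a x, 0 <= a -> P (a *: x) = a * P x).

Lemma sublinear0 P : sublinear P -> P 0 = 0.
Proof. by move=> [_ h]; have := h 0 0 (lexx _); rewrite scale0r mul0r. Qed.

Lemma sublinearN P x : sublinear P -> - P (- x) <= P x.
Proof.
move=> sP; have := sP.1 x (- x); rewrite subrr sublinear0//; lra.
Qed.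

(** The infimum over [t >= 0] of [P (x + t *: v) - t * P v] lowers [P] to a sublinear functional
    that is linear along [v]; subadditivity bounds it below by [- P (- x)]. *)
Lemma sublinear_step (P : V -> R) (v : V) : sublinear P ->
  exists P', [/\ sublinear P', forall x, P' x <= P x & P' (- v) = - P v].
Proof.
move=> sP; have [PD PZ] := sP.
pose A x := [set P (x + t *: v) - t * P v | t in [set t : R | 0 <= t]].
have Alb x : has_lbound (A x).
  exists (- P (- x)) => _ [t /= t0 <-].
  rewrite -PZ// lerBrDr; have := PD (x + t *: v) (- x).
  by rewrite addrAC subrr add0r; lra.
have A0 x : A x !=set0 by exists (P (x + 0 *: v) - 0 * P v); exists 0 => /=.
have Ainf x : has_inf (A x) by split.
pose P' x := inf (A x).
have P'le x t : 0 <= t -> P' x <= P (x + t *: v) - t * P v.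
  by move=> t0; apply: ge_inf => //; exists t.
have P'lt x e : 0 < e -> exists2 t, 0 <= t & P (x + t *: v) - t * P v < P' x + e.
  move=> e0; have [_ [t /= t0 <-] h] := inf_adherent e0 (Ainf x); by exists t.
have P'P x : P' x <= P x.
  by have := P'le x 0 (lexx _); rewrite scale0r addr0 mul0r subr0.
exists P'; split => //.
- split=> [x y|a x a0].
    apply/ler_addgt0Pr => e e0; have e2 : 0 < e / 2 by rewrite divr_gt0.
    have [s s0 hs] := P'lt x _ e2; have [t t0 ht] := P'lt y _ e2.
    have := P'le (x + y) (s + t) (addr_ge0 s0 t0).
    have := PD (x + s *: v) (y + t *: v).
    have -> : x + s *: v + (y + t *: v) = x + y + (s + t) *: v.
      by rewrite scalerDl addrACA.
    move: (P (x + y + _)) => *; lra.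
  have [->|an] := eqVneq a 0.
    rewrite scale0r mul0r; apply/le_anti/andP; split.
      by apply: le_trans (P'P 0) _; rewrite sublinear0.
    apply: lb_le_inf => // _ [t /= t0 <-]; rewrite add0r PZ// subrr; exact: lexx.
  have ap : 0 < a by rewrite lt_def an.
  apply/le_anti/andP; split.
    rewrite -ler_pdivrMl//; apply: lb_le_inf => // _ [t /= t0 <-].
    rewrite ler_pdivrMl//; apply: le_trans (P'le _ (a * t) _) _; first by rewrite mulr_ge0.
    by rewrite -scalerA -scalerDr PZ//; lra.
  apply: lb_le_inf => // _ [t /= t0 <-].
  have ti : 0 <= a^-1 * t by rewrite mulr_ge0// invr_ge0.
  apply: le_trans (ler_wpM2l a0 (P'le x _ ti)) _.
  rewrite mulrBr -(PZ a)// scalerDr scalerA !mulrA divff// !mul1r; exact: lexx.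
- apply/le_anti/andP; split.
    by have := P'le (- v) 1 ler01; rewrite scale1r mul1r addNr sublinear0// sub0r.
  apply: lb_le_inf => // _ [t /= t0 <-].
  have := PD (- v + t *: v) v; rewrite addrAC addNr add0r PZ//; lra.
Qed.

(** [sublinear_step] is iterated along [s]. The last clause is what the induction needs: directions
    in which the functional is already linear keep their values in later steps. *)
Lemma sublinear_minorant (P : V -> R) (s : seq V) : sublinear P ->
  exists P', [/\ sublinear P', forall x, P' x <= P x,
    forall v, v \in s -> P' (- v) = - P' v &
    forall v, P (- v) = - P v -> P' v = P v].
Proof.
elim: s P => [|v s IH] P sP.
  by exists P; split.
have [P1 [s1 le1 v1]] := sublinear_step v sP.
have lin (Q Q' : V -> R) u : sublinear Q' -> (forall x, Q' x <= Q x) ->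
    Q (- u) = - Q u -> Q' u = Q u.
  move=> sQ' QQ Qu; apply/le_anti; rewrite QQ /=.
  by have := sublinearN u sQ'; have := QQ (- u); rewrite Qu; lra.
have [P2 [s2 le2 lin2 keep2]] := IH P1 s1.
have v1' : P1 v = P v.
  by apply/le_anti; rewrite le1 /=; have := sublinearN v s1; rewrite v1 opprK.
exists P2; split => //.
- by move=> x; exact: le_trans (le2 x) (le1 x).
- move=> u; rewrite in_cons => /predU1P[->|]; last exact: lin2.
  have e1 : P2 v = P1 v by apply: keep2; rewrite v1 v1'.
  have e2 : P2 (- v) = P1 (- v) by apply: keep2; rewrite opprK v1 v1' opprK.
  by rewrite e1 e2 v1 v1'.
- by move=> u Pu; apply: (lin P) => // x; exact: le_trans (le2 x) (le1 x).
Qed.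

(* Finite-dimensional Hahn-Banach: [b] is the restriction to the [v i] of a
   functional norming their sum. *)
Lemma norming_functional (P : V -> R) (I : finType) (v : I -> V) : sublinear P ->
  exists b : I -> R, \sum_i b i >= P (\sum_i v i) /\
    forall x : I -> R, \sum_i x i * b i <= P (\sum_i x i *: v i).
Proof.
move=> sP; set w := \sum_i v i.
(* Lowering along the sum [w] first pins the value at [w] to [P w]; the later steps along the [v i]
   preserve it. *)
have [P1 [s1 le1 w1]] := sublinear_step w sP.
have w1' : P1 w = P w.
  by apply/le_anti; rewrite le1 /=; have := sublinearN w s1; rewrite w1 opprK.
have [Q [sQ leQ linQ keepQ]] := sublinear_minorant (map v (enum I)) s1.
have lQ i : Q (- v i) = - Q (v i) by apply: linQ; apply: map_f; rewrite mem_enum.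
have Qsum (z : I -> V) : Q (\sum_i z i) <= \sum_i Q (z i).
  apply: (big_ind2 (fun a b => Q a <= b)) => //; first by rewrite sublinear0.
  by move=> x1 x2 y1 y2 h1 h2; apply: le_trans (sQ.1 _ _) _; exact: lerD.
exists (fun i => Q (v i)); split.
  by rewrite -w1' -keepQ ?w1 ?w1'//; exact: Qsum.
move=> x; apply: le_trans (le_trans (leQ _) (le1 _)).
apply: le_trans (sublinearN _ sQ); rewrite lerNr -sumrN.
rewrite -sumrN; apply: le_trans (Qsum _) _; apply: ler_sum => i _.
have [x0|x0] := lerP 0 (x i).
  by rewrite -scalerN sQ.2// lQ mulrN.
by rewrite -scaleNr sQ.2 ?mulNr// oppr_ge0 ltW.
Qed.
End SublinearMinorant.

(** * From a bad upper 2-estimate to an operator without good extension *)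

Section UpperFailure.
Context {R : realType} {X : completeNormedModType R} (K : kothe_space X).
Local Notation T := (measurableTypeR R).
Variable p : R.
Hypothesis p2 : 2 < p.

(* [L] is the set where a functional norming a subfamily of maximal ratio
   nrm / sqrt(cardinal) is large. *)
Lemma norming_subfamily (I : finType) (a : I -> R) (A : I -> set T) (k : R) : 0 < k ->
  (forall i, measurable (A i)) -> pw_disjoint A ->
  (forall i, nrm K (fun t => a i * \1_(A i) t) <= 1) ->
  k * Num.sqrt #|I|%:R < nrm K (step A a) ->
  exists (L : {set I}) (b : R), [/\ 0 < b, b <= 1, k ^+ 2 / 16 <= b ^+ 2 * #|L|%:R &
    forall x : I -> R, b * \sum_(i in L) `|x i| <=
      nrm K (step A (fun i => if i \in L then x i * a i else 0))].
Proof.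
move=> k0 mA dA a1 big.
pose N (J : {set I}) := nrm K (step A (fun i => if i \in J then a i else 0)).
pose ratio (J : {set I}) := N J / Num.sqrt #|J|%:R.
have Nne0 (J : {set I}) : #|J| = 0%N -> N J = 0.
  move=> /eqP; rewrite cards_eq0 => /eqP ->; rewrite /N.
  have -> : step A (fun i => if i \in finset.set0 then a i else 0) = (fun=> 0).
    by apply/funext => t; rewrite /step big1// => i _; rewrite inE mul0r.
  by rewrite (nrmE (rep0 K)) normr0.
have NT : N [set: I]%SET = nrm K (step A a).
  by rewrite /N; congr (nrm K (step A _)); apply/funext => i; rewrite inE.
pose J := [arg max_(J > [set: I]%SET) ratio J]%O.
have Jmax J' : ratio J' <= ratio J.
  by rewrite /J; case: Order.TotalTheory.arg_maxP => //= i _; apply.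
have I0 : (0 < #|I|)%N.
  rewrite lt0n; apply/eqP => I0; move: big; rewrite -NT Nne0 ?cardsT// I0 sqrtr0 mulr0.
  by rewrite ltxx.
have kr : k < ratio J.
  apply: lt_le_trans (Jmax [set: I]%SET); rewrite /ratio NT cardsT ltr_pdivlMr//.
  by rewrite sqrtr_gt0 ltr0n.
set r := ratio J in Jmax kr; have r0 : 0 < r by exact: lt_trans kr.
have J0 : (0 < #|J|)%N.
  rewrite lt0n; apply/eqP => J0; move: r0; rewrite /r /ratio Nne0// mul0r.
  by rewrite ltxx.
pose s : R := Num.sqrt #|J|%:R; have s0 : 0 < s by rewrite sqrtr_gt0 ltr0n.
have NJ : N J = r * s by rewrite /r /ratio divfK// gt_eqF.
have Nle (J' : {set I}) : N J' <= r * Num.sqrt #|J'|%:R.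
  have [J'0|J'0] := posnP #|J'|; first by rewrite Nne0// J'0 sqrtr0 mulr0.
  by rewrite -ler_pdivrMr ?sqrtr_gt0 ?ltr0n//; exact: Jmax.
pose v i : X := if i \in J then el K (fun t => a i * \1_(A i) t) else 0.
have vsum (L : {set I}) (x : I -> R) : L \subset J ->
    `|\sum_i (if i \in L then x i else 0) *: v i| =
    nrm K (step A (fun i => if i \in L then x i * a i else 0)).
  move=> LJ; rewrite /nrm el_step//; congr (`|_|); apply: eq_bigr => i _.
  have [iL|iL] := boolP (i \in L); last by rewrite !scale0r.
  by rewrite /v (fintype.subsetP LJ _ iL) elZ ?scalerA//; exact: good_indic.
have vsum1 (L : {set I}) : L \subset J ->
    `|\sum_i (if i \in L then 1 else 0) *: v i| = N L.
  move=> LJ; rewrite vsum// /N; congr (nrm K (step A _)).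
  by apply/funext => i; rewrite mul1r.
have subl : sublinear (fun x : X => `|x|).
  by split=> [x y|z x z0]; [exact: ler_normD|rewrite normrZ ger0_norm].
have [b [bsum ble]] := norming_functional v subl.
have bv i : b i <= `|v i|.
  have := ble (fun j => (j == i)%:R).
  rewrite (bigD1 i)//= eqxx mul1r big1 => [|j /negbTE ->]; last by rewrite mul0r.
  rewrite (bigD1 i)//= eqxx scale1r big1 => [|j /negbTE ->]; last by rewrite scale0r.
  by rewrite !addr0.
have b1 i : b i <= 1.
  apply: le_trans (bv i) _; rewrite /v; case: ifP => _; last by rewrite normr0.
  exact: a1.
have bJ : r * s <= \sum_(i in J) b i.
  rewrite -NJ; apply: (@le_trans _ _ (\sum_i b i)).
    apply: le_trans bsum; apply: le_of_eq.
    rewrite -vsum1//; congr (`|_|); apply: eq_bigr => i _.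
    by rewrite /v; case: ifP => _; rewrite ?scale1r ?scaler0.
  rewrite [X in X <= _](bigID (mem J)) /= gerDl; apply: sumr_le0 => i iJ.
  by apply: le_trans (bv i) _; rewrite /v (negbTE iJ) normr0.
(* Half of the lower bound [r / s] for the mean of the [b i] over [J]: dropping the smaller ones
   loses at most half of [r * s]. *)
pose th := r / (2 * s); have th0 : 0 < th by apply: divr_gt0 => //; apply: mulr_gt0.
pose L := [set i in J | th <= b i]%SET.
have LJ : L \subset J by apply/fintype.subsetP => i; rewrite inE => /andP[].
have s2 : s ^+ 2 = #|J|%:R by rewrite sqr_sqrtr.
have bL : r * s / 2 <= \sum_(i in L) b i.
  have : \sum_(i in J) b i <= \sum_(i in L) b i + r * s / 2.
    rewrite (big_setID L) /= (finset.setIidPr LJ) lerD2l.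
    apply: (@le_trans _ _ (\sum_(i in J :\: L) th)).
      apply: ler_sum => i; rewrite !inE => /andP[h iJ]; move: h; rewrite iJ /= -ltNge.
      exact: ltW.
    rewrite sumr_const -[th *+ _]mulr_natl.
    apply: (@le_trans _ _ (#|J|%:R * th)).
      by rewrite ler_wpM2r ?(ltW th0)// ler_nat subset_leq_card// finset.subsetDl.
    rewrite -s2 /th; apply: le_of_eq; field.
    by rewrite gt_eqF.
  lra.
(* The maximality of the ratio at [J] also bounds the norm of the subfamily [L]; against [bL] this
   forces [#|L|] to be at least a quarter of [#|J|]. *)
have LbL : \sum_(i in L) b i <= r * Num.sqrt #|L|%:R.
  apply: le_trans (Nle L); have := ble (fun i => if i \in L then 1 else 0).
  rewrite vsum1//; apply: le_trans; rewrite big_mkcond /=; apply: le_of_eq.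
  by apply: eq_bigr => i _; case: ifP => _; rewrite ?mul1r ?mul0r.
have Ls : s / 2 <= Num.sqrt #|L|%:R.
  by rewrite -(ler_pM2l r0); lra.
have Lpos : (0 < #|L|)%N.
  rewrite lt0n; apply/eqP => Le; move: Ls; rewrite Le sqrtr0; lra.
exists L, th; split => //.
- have [i iL] : exists i, i \in L by apply/finset.set0Pn; rewrite -card_gt0.
  by apply: le_trans (b1 i); move: iL; rewrite inE => /andP[].
- have : (s / 2) ^+ 2 <= #|L|%:R.
    rewrite -[X in _ <= X]sqr_sqrtr// lerXn2r// nnegrE ?sqrtr_ge0//.
    by rewrite divr_ge0// ltW.
  move=> h; have th2 : th ^+ 2 * (s / 2) ^+ 2 = r ^+ 2 / 16.
    by rewrite /th; field; rewrite gt_eqF.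
  apply: (@le_trans _ _ (r ^+ 2 / 16)).
    by rewrite ler_pM2r ?invr_gt0// lerXn2r ?nnegrE ?(ltW k0) ?(ltW r0) ?(ltW kr).
  by rewrite -th2 ler_wpM2l ?sqr_ge0.
- move=> x; have := ble (fun i => if i \in L then `|x i| else 0).
  rewrite vsum//.
  have -> : nrm K (step A (fun i => if i \in L then `|x i| * a i else 0)) =
     nrm K (step A (fun i => if i \in L then x i * a i else 0)).
    by apply: nrm_step_eq => // i; case: ifP => // _; rewrite !normrM normr_id.
  apply: le_trans; rewrite mulr_sumr big_mkcond /=; apply: ler_sum => i _.
  have [iL|iL] := boolP (i \in L); last by rewrite mul0r.
  by rewrite mulrC ler_wpM2l//; move: iL; rewrite inE => /andP[].
Qed.

(** On the subfamily [L] the norm dominates [b] times the [ell_1] norm, and the columns of a Kashin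
    matrix [G] select there vectors [e j] whose combinations dominate [b * c * m] times the [ell_2]
    norm of the coefficients. So sending [e j] to a multiple of the [j]-th Rademacher function is a
    contraction. For an extension, the trace [kb * d] is a sum over the [m] rows; each row pairs the
    image of a vector of norm at most 1 with a sign sum of variance [d], so the trace would be at
    most [m * M * sqrt (2 * d)]. *)
Lemma upper_failure : exists2 C0 : R, 0 < C0 & forall (M : R) (B : set T) (I : finType)
    (a : I -> R) (A : I -> set T), 1 <= M -> measurable B ->
    (forall i, measurable (A i)) -> pw_disjoint A -> (forall i, A i `<=` B) ->
    (forall i, nrm K (fun t => a i * \1_(A i) t) <= 1) ->
    C0 * M * Num.sqrt #|I|%:R < nrm K (step A a) ->
    inhabited (failure K p B M).
Proof.
have p0 : 0 < p by exact: lt_trans p2.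
pose Cp : R := (2 * p) `^ p * (2 * expR 1).
have Cp0 : 0 < Cp by rewrite mulr_gt0 ?powR_gt0 ?mulr_gt0 ?expR_gt0.
pose ka := Cp `^ (- p^-1); have ka0 : 0 < ka by exact: powR_gt0.
have kap : ka `^ p * Cp = 1.
  rewrite -powRrM mulNr mulVf ?gt_eqF// powR_inv1 ?(ltW Cp0)//.
  by rewrite mulVf// gt_eqF.
have [lam [c [lam0 c0 kash]]] := @kashin R.
have lam1 : 1 <= lam%:R :> R by rewrite ler1n.
(* The first summand contradicts the trace estimate; the second gives [b ^+ 2 * #|L| >= lam], so
   [d > 0] as [b <= 1]. *)
pose C2 := 128 * lam%:R / (c * ka) ^+ 2 + 16 * lam%:R.
have C20 : 0 < C2.
  by rewrite ltr_wpDl ?mulr_gt0 ?divr_ge0 ?sqr_ge0 ?mulr_ge0// ltr0n.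
pose C0 := Num.sqrt C2; have C00 : 0 < C0 by rewrite sqrtr_gt0.
have C0sq : C0 ^+ 2 = C2 by rewrite sqr_sqrtr// ltW.
exists C0 => // M B I a A M1 mB mA dA AB a1 big.
have M0 : 0 < M by lra.
have [L [b [b0 b1 bL Lle]]] := norming_subfamily (mulr_gt0 C00 M0) mA dA a1 big.
have M2 : 1 <= M ^+ 2 by rewrite expr_ge1// ltW.
have cond2 : 128 * lam%:R / (c * ka) ^+ 2 * M ^+ 2 / 16 + lam%:R <= b ^+ 2 * #|L|%:R.
  apply: le_trans bL; rewrite [(C0 * M) ^+ 2]exprMn C0sq /C2.
  have : lam%:R <= lam%:R * M ^+ 2 by rewrite ler_peMr//; lra.
  lra.
have Lle_lam : (lam <= #|L|)%N.
  rewrite -(ler_nat R); apply: le_trans (_ : b ^+ 2 * #|L|%:R <= _); last first.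
    by rewrite ler_piMl// expr_le1// ltW.
  apply: le_trans cond2; rewrite lerDr; apply: divr_ge0 => //; apply: mulr_ge0.
    by rewrite divr_ge0 ?sqr_ge0// mulr_ge0.
  by lra.
pose d := (#|L| %/ lam)%N.
have d0 : (0 < d)%N by rewrite divn_gt0.
have mL : (lam * d <= #|L|)%N by rewrite mulnC leq_divM.
have Ld : #|L|%:R <= 2 * (lam%:R * d%:R) :> R.
  rewrite -natrM -natrM ler_nat {1}(divn_eq #|L| lam) -/d.
  have h1 : (#|L| %% lam < lam)%N by rewrite ltn_mod.
  by rewrite mulnC mul2n -addnn leq_add2l (leq_trans (ltnW h1))// leq_pmulr.
set m := (lam * d)%N in mL.
have [G HG] := kash d d0; rewrite -/m in G HG.
pose io (i : 'I_m) : I := enum_val (widen_ord mL i).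
have ioL i : io i \in L by exact: enum_valP.
have io_inj : injective io.
  by move=> i j /enum_val_inj /(congr1 val) /= /val_inj.
pose w i : X := el K (fun t => a (io i) * \1_(A (io i)) t).
have w1 i : `|w i| <= 1 by exact: a1.
pose e (j : 'I_d) : X := \sum_i sgb (G i j) *: w i.
pose co (x : 'I_d -> R) i := \sum_j sgb (G i j) * x j.
have esum x : \sum_j x j *: e j = \sum_i co x i *: w i.
  rewrite /e; under eq_bigr do rewrite scaler_sumr.
  rewrite exchange_big /=; apply: eq_bigr => i _; rewrite /co scaler_suml.
  by apply: eq_bigr => j _; rewrite scalerA mulrC.
have wlow (y : 'I_m -> R) : b * \sum_i `|y i| <= `|\sum_i y i *: w i|.
  pose Y (k : I) := \sum_(i | io i == k) y i.
  have Yio i : Y (io i) = y i.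
    by rewrite /Y (big_pred1 i)// => j; rewrite (inj_eq io_inj).
  have YL k : k \notin [set io i | i in 'I_m]%SET -> Y k = 0.
    move=> kL; rewrite /Y big1// => i /eqP ik; move: kL; rewrite -ik.
    by rewrite imset_f.
  have imL : [set io i | i in 'I_m]%SET \subset L.
    by apply/fintype.subsetP => _ /imsetP[i _ ->].
  have := Lle Y.
  have -> : \sum_(i in L) `|Y i| = \sum_i `|y i|.
    rewrite (big_setID [set io i | i in 'I_m]%SET) /= (finset.setIidPr imL) [X in _ + X]big1.
      rewrite addr0 big_imset /=; last by move=> i j _ _; exact: io_inj.
      by apply: eq_bigr => i _; rewrite Yio.
    by move=> k; rewrite inE => /andP[kL _]; rewrite YL// normr0.
  suff -> : nrm K (step A (fun i => if i \in L then Y i * a i else 0)) = `|\sum_i y i *: w i| by [].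
  rewrite /nrm el_step//; congr (`|_|).
  rewrite (bigID (mem [set io i | i in 'I_m]%SET)) /= [X in _ + X]big1.
    rewrite addr0 big_imset /=; last by move=> i j _ _; exact: io_inj.
    apply: eq_bigr => i _; rewrite ioL Yio /w elZ ?scalerA//; exact: good_indic.
  by move=> k kL; rewrite YL// mul0r; case: ifP; rewrite scale0r.
have elow x : b * c * m%:R * Num.sqrt (\sum_j x j ^+ 2) <= `|\sum_j x j *: e j|.
  rewrite esum; apply: le_trans (wlow _).
  by rewrite -!mulrA ler_pM2l// mulrA; exact: HG.
pose kb := b * c * m%:R * ka.
have m0 : 0 < m%:R :> R by rewrite ltr0n muln_gt0 lam0.
have kb0 : 0 < kb by rewrite !mulr_gt0.
pose tT (j : 'I_d) (s : {ffun 'I_d -> bool}) : R := kb * sgb (s j).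
have gam0 : 0 < b * c * m%:R by rewrite !mulr_gt0.
constructor; apply: (@Failure _ _ _ _ _ _ _ _ e tT (b * c * m%:R)) => //.
- exact: card_signs_gt0.
- move=> j; rewrite /e; apply: (big_ind (fun y => band K B y = y)).
  + by have := bandP K (-1) 0 0 mB; rewrite !scaleN1r addNr => ->; rewrite addNr.
  + by move=> x y hx hy; rewrite bandD// hx hy.
  + move=> i _; apply: (@rep_in_band _ _ _ (fun t => sgb (G i j) * (a (io i) * \1_(A (io i)) t))) => //.
      by apply: repZ; apply: elP; exact: good_term.
    by move=> t nBt; rewrite indicE memNset ?mulr0// => /AB.
- move=> x j; apply: le_trans (elow x); rewrite ler_pM2l//.
  rewrite -[X in X <= _]sqrtr_sqr; apply: ler_wsqrtr.
  rewrite (bigD1 j)//= lerDl; apply: sumr_ge0 => k _; exact: sqr_ge0.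
- move=> x; set Q := \sum_j x j ^+ 2.
  have Q0 : 0 <= Q by apply: sumr_ge0 => j _; exact: sqr_ge0.
  have -> : avg (fun s : {ffun 'I_d -> bool} => `|\sum_j x j * tT j s| `^ p) =
      kb `^ p * avg (fun s : {ffun 'I_d -> bool} => `|\sum_j x j * sgb (s j)| `^ p).
    rewrite -avgZ; apply: eq_avg => s.
    have -> : \sum_j x j * tT j s = kb * \sum_j x j * sgb (s j).
      by rewrite mulr_sumr; apply: eq_bigr => j _; rewrite /tT; ring.
    by rewrite normrM (ger0_norm (ltW kb0)) powRM// ltW.
  have [Qe|Qn] := eqVneq Q 0.
    have x0 j : x j = 0.
      apply/eqP; rewrite -sqrf_eq0 eq_le sqr_ge0 andbT -Qe /Q (bigD1 j)//= lerDl.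
      by apply: sumr_ge0 => k _; exact: sqr_ge0.
    have -> : avg (fun s : {ffun 'I_d -> bool} => `|\sum_j x j * sgb (s j)| `^ p) = 0.
      under eq_avg => s.
        rewrite big1 ?normr0 ?powR0 ?gt_eqF//; last by move=> j _; rewrite x0 mul0r.
        over.
      by rewrite avg_cst// card_signs_gt0.
    by rewrite mulr0 powR_ge0.
  have Dp : 0 < Num.sqrt Q by rewrite sqrtr_gt0 lt_def Qn.
  have D2 : Num.sqrt Q ^+ 2 = Q by rewrite sqr_sqrtr.
  apply: (@le_trans _ _ (kb `^ p * (Cp * (Num.sqrt Q) `^ p))).
    rewrite ler_wpM2l ?powR_ge0//.
    apply: (avg_powR_sum (be := 1)) => //.
    + by move=> z zh; have := avg_bool_expR zh.
    + move=> j; rewrite -[X in X <= _]sqrtr_sqr; apply: ler_wsqrtr.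
      rewrite /Q (bigD1 j)//= lerDl; apply: sumr_ge0 => k _; exact: sqr_ge0.
    + by rewrite D2 mul1r.
  have -> : kb `^ p * (Cp * (Num.sqrt Q) `^ p) = (b * c * m%:R * Num.sqrt Q) `^ p.
    rewrite /kb [in LHS]powRM ?(ltW gam0) ?(ltW ka0)//.
    rewrite [in RHS]powRM ?(ltW gam0) ?sqrtr_ge0//.
    have := kap; move: (ka `^ p) => z zC.
    by rewrite -[RHS]mulr1 -zC; ring.
  apply: ge0_ler_powR; rewrite ?nnegrE ?(ltW p0)//.
    by rewrite mulr_ge0 ?(ltW gam0) ?sqrtr_ge0.
  exact: elow.
- move=> S Slin SM; apply: contrapT => nex.
  have SE j s : S (e j) s = tT j s.
    by apply: contrapT => h; apply: nex; exists j, s.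
  have S0 s : S 0 s = 0.
    by have := Slin (-1) 0 0 s; rewrite scaleN1r addNr mulN1r addNr.
  have SZ z f s : S (z *: f) s = z * S f s by have := Slin z f 0 s; rewrite S0 !addr0.
  have SD f g s : S (f + g) s = S f s + S g s.
    by have := Slin 1 f g s; rewrite scale1r mul1r.
  have Ssum (J : finType) (z : J -> R) (f : J -> X) s :
      S (\sum_i z i *: f i) s = \sum_i z i * S (f i) s.
    apply: (big_ind2 (fun y z => S y s = z)) => // x1 x2 y1 y2 <- <-.
    by rewrite SD.
  have cs0 := card_signs_gt0 'I_d.
  have Sw i : avg (fun s => S (w i) s ^+ 2) <= 2 * M ^+ 2.
    apply: (@avg_sq_le _ _ cs0 p) => //; first exact: ltW.
    apply: le_trans (SM _) _; apply: ge0_ler_powR; rewrite ?nnegrE ?(ltW p0) ?(ltW M0)//.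
      by rewrite mulr_ge0 ?(ltW M0).
    by rewrite ler_piMr// ltW.
  pose g i (s : {ffun 'I_d -> bool}) : R := \sum_j sgb (s j) * sgb (G i j).
  have g2 i : avg (fun s => g i s ^+ 2) = d%:R.
    rewrite avg_sign_sum_sq; under eq_bigr do rewrite expr2 sgb_sq.
    by rewrite sumr_const card_ord.
  have sd0 : 0 < Num.sqrt d%:R :> R by rewrite sqrtr_gt0 ltr0n.
  have cs i : avg (fun s => S (w i) s * g i s) <= M * Num.sqrt (2 * d%:R).
    have h : avg (fun s => S (w i) s * g i s) ^+ 2 <= (M * Num.sqrt (2 * d%:R)) ^+ 2.
      apply: le_trans (avg_mul_sq _ _) _; rewrite g2 exprMn sqr_sqrtr ?mulr_ge0//.
      have -> : M ^+ 2 * (2 * d%:R) = 2 * M ^+ 2 * d%:R by ring.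
      by rewrite ler_wpM2r.
    apply: le_trans (ler_norm _) _; rewrite -(@ler_pXn2r _ 2) ?nnegrE//.
      by rewrite -normrX ger0_norm ?sqr_ge0.
    by rewrite mulr_ge0 ?sqrtr_ge0// ltW.
  have tr : kb * d%:R <= m%:R * (M * Num.sqrt (2 * d%:R)).
    have -> : kb * d%:R = \sum_i avg (fun s => S (w i) s * g i s).
      transitivity (\sum_j avg (fun s : {ffun 'I_d -> bool} => S (e j) s * sgb (s j))).
        under eq_bigr => j _.
          under eq_avg => s do rewrite SE /tT -mulrA sgb_sq mulr1.
          rewrite avg_cst//; over.
        by rewrite sumr_const card_ord mulr_natr.
      rewrite -!avg_sum; apply: eq_avg => s.
      under eq_bigr do rewrite /e Ssum mulr_suml.
      rewrite exchange_big /=; apply: eq_bigr => i _; rewrite /g mulr_sumr.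
      by apply: eq_bigr => j _; ring.
    apply: le_trans (ler_sum _ (fun i _ => cs i)) _.
    by rewrite sumr_const card_ord -[X in X <= _]mulr_natl.
  have d1 : 0 < d%:R :> R by rewrite ltr0n.
  have : b * c * ka * d%:R <= M * Num.sqrt (2 * d%:R).
    by rewrite -(ler_pM2l m0); apply: le_trans tr; rewrite /kb; lra.
  have bck : 0 < b * c * ka by rewrite !mulr_gt0.
  move=> h; have h2 : (b * c * ka * d%:R) ^+ 2 <= M ^+ 2 * (2 * d%:R).
    rewrite -[2 * d%:R]sqr_sqrtr ?mulr_ge0// -exprMn lerXn2r// nnegrE.
      by rewrite mulr_ge0 ?(ltW bck) ?(ltW d1).
    by rewrite mulr_ge0 ?sqrtr_ge0 ?(ltW M0).
  have h3 : b ^+ 2 * (c * ka) ^+ 2 * d%:R <= 2 * M ^+ 2.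
    by rewrite -(ler_pM2r d1); move: h2; rewrite !exprMn; lra.
  have ck2 : 0 < (c * ka) ^+ 2 by rewrite exprn_gt0// mulr_gt0.
  have h4 : b ^+ 2 * d%:R <= 2 * M ^+ 2 / (c * ka) ^+ 2 by rewrite ler_pdivlMr//; lra.
  have h5 : b ^+ 2 * #|L|%:R <= 2 * lam%:R * (b ^+ 2 * d%:R).
    have := ler_wpM2l (sqr_ge0 b) Ld; lra.
  have h6 : 2 * lam%:R * (b ^+ 2 * d%:R) <= 2 * lam%:R * (2 * M ^+ 2 / (c * ka) ^+ 2).
    by rewrite ler_wpM2l// mulr_ge0.
  have h7 : 0 <= lam%:R * M ^+ 2 / (c * ka) ^+ 2.
    by rewrite divr_ge0 ?sqr_ge0// mulr_ge0 ?sqr_ge0.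
  lra.
Qed.
End UpperFailure.

(** * Rademacher-like vectors supported in an interval *)

Section Rademacher.
Context {R : realType} {X : completeNormedModType R} (K : kothe_space X).
Local Notation mu := (leb01 R).
Local Notation T := (measurableTypeR R).

Lemma leb01_itv (a b : R) : 0 <= a -> a <= b -> b <= 1 -> mu `[a, b[ = (b - a)%:E.
Proof.
move=> a0 ab b1; rewrite /leb01 /= /mrestr setIidl.
  rewrite lebesgue_measure_itv /= lte_fin; case: ltrP => // ba.
  by have -> : b = a by [apply/le_anti; rewrite ab ba]; rewrite subrr.
move=> t /=; rewrite !in_itv /= => /andP[h1 h2]; lra.
Qed.

Lemma integral_step (I : finType) (A : I -> set T) (c : I -> R) :
  (forall i, measurable (A i)) -> pw_disjoint A ->
  (\int[mu]_t (`|step A c t|)%:E = \sum_i (`|c i|%:E * mu (A i)))%E.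
Proof.
move=> mA dA; transitivity (\int[mu]_t (\sum_i (`|c i| * \1_(A i) t)%:E)%R)%E.
  by apply: eq_integral => t _; rewrite step_norm// /step sumEFin.
rewrite ge0_integral_sum//; last first.
  by move=> i; apply/measurable_EFinP; apply: measurable_funM.
apply: eq_bigr => i _; under eq_integral do rewrite EFinM.
rewrite ge0_integralZl_EFin//; last first.
- by apply/measurable_EFinP; apply: measurable_indic.
by rewrite integral_indic// setIT.
Qed.

(** The interval is cut into equal parts, one for each sign pattern, and [r i] takes the [i]-th sign
    of the pattern. The norm is bounded below through [L_1], where Khinchine's inequality applies.
    The added 1 only makes [rho] positive. *)
Lemma rademacher_itv (a b : R) : 0 <= a -> a < b -> b <= 1 ->
  exists c rho, [/\ 0 < c, 0 < rho & rademacher_on K (`[a, b[ : set T) c rho].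
Proof.
move=> a0 ab b1; set H : set T := `[a, b[.
have mH : measurable H by exact: measurable_itv.
have [C C0 HC] := L1_bound K.
exists ((b - a) / (40 * C)), (nrm K \1_H + 1); split.
- by rewrite divr_gt0 ?subr_gt0 ?mulr_gt0.
- by rewrite ltr_wpDl ?nrm_ge0.
move=> I; pose S : finType := {ffun I -> bool}.
have S0 : (0 < #|S|)%N by exact: card_signs_gt0.
have N0 : 0 < #|S|%:R :> R by rewrite ltr0n.
pose de := (b - a) / #|S|%:R; have de0 : 0 < de by rewrite divr_gt0// subr_gt0.
pose lo (s : S) := a + de * (enum_rank s)%:R.
have loS s : lo s + de <= b.
  have : (enum_rank s).+1%:R <= #|S|%:R :> R by rewrite ler_nat.
  move=> h; have := ler_wpM2l (ltW de0) h.
  by rewrite [de * #|S|%:R]divfK ?gt_eqF// -natr1 /lo; lra.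
have loa s : a <= lo s by rewrite lerDl mulr_ge0// ltW.
pose P (s : S) : set T := `[lo s, lo s + de[.
have mP s : measurable (P s) by exact: measurable_itv.
have PH s : P s `<=` H.
  move=> t; rewrite /P /H /= !in_itv /= => /andP[h1 h2].
  by rewrite (le_trans (loa s) h1) (lt_le_trans h2 (loS s)).
have dP : pw_disjoint P.
  have key s s' t : (enum_rank s < enum_rank s')%N -> P s t -> P s' t -> False.
    rewrite /P /= !in_itv /= => ss' /andP[_ h2] /andP[h3 _].
    have : (enum_rank s).+1%:R <= (enum_rank s')%:R :> R by rewrite ler_nat.
    move=> /(ler_wpM2l (ltW de0)); rewrite -natr1.
    by move: h2 h3; rewrite /lo; lra.
  move=> s s' ss'; apply/seteqP; split => // t [Ps Ps'].
  have [lt|lt|eq] := ltngtP (enum_rank s) (enum_rank s').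
  - exact: key lt Ps Ps'.
  - exact: key lt Ps' Ps.
  - by move/ord_inj/enum_rank_inj: eq ss' => ->; rewrite eqxx.
have muP s : mu (P s) = de%:E.
  rewrite leb01_itv; first by congr EFin; ring.
  - exact: le_trans (loa s).
  - by rewrite lerDl ltW.
  - exact: le_trans (loS s) b1.
pose r i := el K (step P (fun s => sgb (s i))).
have gr i : good K (step P (fun s => sgb (s i))) by exact: good_step.
exists r; split.
- move=> i; apply: rep_in_band (elP (gr i)) _ => // t nHt.
  by apply: step_out => s /PH.
- move=> i; apply: (@le_trans _ _ (nrm K \1_H)); last by rewrite lerDl.
  apply: nrm_leW => // [|t]; first exact: good_indic.
  have [[s Ps]|/forallNP h] := pselect (exists s, P s t); last by rewrite step_out// normr0.
  by rewrite (step_in dP _ Ps) normr_sgb indicE mem_set ?normr1//; exact: PH Ps.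
- move=> x; have rx : rep K (step P (fun s => \sum_i sgb (s i) * x i)) (\sum_i x i *: r i).
    have := rep_sum (index_enum I) (P := xpredT) (fun i _ => repZ (x i) (elP (gr i))).
    move=> /rep_ext; apply => t; rewrite /step.
    under eq_bigr do rewrite mulr_sumr.
    rewrite exchange_big /=; apply: eq_bigr => s _; rewrite mulr_suml.
    by apply: eq_bigr => i _; ring.
  have := HC (\sum_i x i *: r i); rewrite /L1norm.
  have -> : (\int[mu]_t (`|K (\sum_i x i *: r i) t|)%:E =
      \int[mu]_t (`|step P (fun s => \sum_i (sgb (s i) * x i)%R) t|)%:E)%E.
    apply: ae_eq_integral => //.
    + exact: measurable_abs_frepr.
    + apply/measurable_EFinP; apply: measurableT_comp => //; exact: measurable_step.
    + by move: rx; apply: filterS => t -> _.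
  rewrite integral_step//; under eq_bigr do rewrite muP -EFinM.
  rewrite sumEFin lee_fin -mulr_suml => h.
  have := khinchine x; rewrite /avg -/S; set Q := \sum_(w : S) _ in h *.
  rewrite ler_pdivlMr// => k.
  have e : Q * de = (b - a) * (Q / #|S|%:R) by rewrite /de; ring.
  rewrite e in h; set q := Num.sqrt _ in k *.
  have k2 : q / 40 <= Q / #|S|%:R by rewrite ler_pdivlMr.
  have -> : (b - a) / (40 * C) * q = ((b - a) * (q / 40)) / C by field; rewrite gt_eqF.
  rewrite ler_pdivrMr// [X in _ <= X]mulrC; apply: le_trans h.
  by rewrite ler_pM2l ?subr_gt0.
Qed.

End Rademacher.

(** * Absolute continuity of the norms of indicators *)

Section AbsoluteContinuity.
Context {R : realType} {X : completeNormedModType R} (K : kothe_space X).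
Local Notation mu := (leb01 R).
Local Notation T := (measurableTypeR R).
Variable p : R.
Hypothesis p2 : 2 < p.
Hypothesis hM : has_M X p.

Definition lower_bad (M : R) (B : set T) := exists (I : finType) (a : I -> R) (A : I -> set T),
  [/\ forall i, measurable (A i), pw_disjoint A, forall i, A i `<=` B &
    M ^+ 2 * nrm K (step A a) ^+ 2 < \sum_i nrm K (fun t => a i * \1_(A i) t) ^+ 2].

Definition half_line (b : bool) : set T := if b then `[1 / 2, +oo[ else `]-oo, 1 / 2[.

Lemma measurable_half b : measurable (half_line b).
Proof. by case: b; exact: measurable_itv. Qed.

Lemma half_disj : half_line true `&` half_line false = set0.
Proof.
apply/seteqP; split => // t; rewrite /half_line /= !in_itv /= andbT => -[h1 h2].
by move: h2; rewrite ltNge h1.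
Qed.

(* The Rademacher-like vectors needed by [lower_failure] are put in the other
   half line. *)
Lemma no_lower_bad_seq b : exists Mk : nat -> R, (forall k, 0 < Mk k) /\
  forall B : nat -> set T, (forall k, measurable (B k)) ->
    (forall k l, k != l -> B k `&` B l = set0) -> (forall k, B k `<=` half_line b) ->
    ~ forall k, lower_bad (Mk k) (B k).
Proof.
(* The left end of the half of [0, 1] opposite to [half_line b], in which the [H k] are disjoint
   dyadic intervals. *)
pose o : R := if b then 0 else 1 / 2.
pose H k : set T := `[o + (2 ^+ k.+2)^-1, o + (2 ^+ k.+1)^-1[.
have pk k : 0 < (2 ^+ k.+2)^-1 :> R by rewrite invr_gt0 exprn_gt0.
have pk2 k : (2 ^+ k.+1)^-1 = 2 * (2 ^+ k.+2)^-1 :> R.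
  by rewrite [2 ^+ k.+2]exprS invfM mulrA divff ?mul1r.
have pk1 k : (2 ^+ k.+1)^-1 <= 1 / 2 :> R.
  by rewrite div1r lef_pV2 ?posrE ?exprn_gt0// -{1}[2]expr1 ler_eXn2l// ltr1n.
have o0 : 0 <= o by rewrite /o; case: (b); lra.
have o1 : o + 1 / 2 <= 1 by rewrite /o; case: (b); lra.
have mH k : measurable (H k) by exact: measurable_itv.
have Hhalf k : H k `<=` half_line (~~ b).
  move=> t; rewrite /H /half_line /o /= in_itv /= => /andP[h1 h2].
  have := pk k; have := pk1 k; move: h1 h2; case: (b) => /=; rewrite in_itv /= ?andbT; lra.
have dH k l : k != l -> H k `&` H l = set0.
  have key i j t : (i < j)%N -> H i t -> H j t -> False.
    move=> ij; rewrite /H /= !in_itv /= => /andP[h1 _] /andP[_ h2].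
    have : (2 ^+ j.+1)^-1 <= (2 ^+ i.+2)^-1 :> R.
      by rewrite lef_pV2 ?posrE ?exprn_gt0// ler_eXn2l// ltr1n.
    lra.
  move=> kl; apply/seteqP; split => // t [tk tl].
  by have [lt|lt|/eqP] := ltngtP k l; [exact: key lt tk tl|exact: key lt tl tk|rewrite (negbTE kl)].
have hd : half_line b `&` half_line (~~ b) = set0.
  by case: (b); rewrite /= ?half_disj// setIC half_disj.
have /choice[e He] k : exists e : R, 0 < e /\ forall (B : set T) (I : finType)
    (a : I -> R) (A : I -> set T), measurable B -> B `<=` half_line b ->
    (forall i, measurable (A i)) -> pw_disjoint A -> (forall i, A i `<=` B) ->
    nrm K (step A a) ^+ 2 < e * \sum_i nrm K (fun t => a i * \1_(A i) t) ^+ 2 ->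
    inhabited (failure K p (B `|` H k) (4 ^+ k)).
  have [|||c [rho [c0 rho0 rad]]] := @rademacher_itv _ _ K (o + (2 ^+ k.+2)^-1) (o + (2 ^+ k.+1)^-1).
  - by rewrite addr_ge0// ltW.
  - by have := pk k; rewrite ltrD2l (pk2 k); lra.
  - by have := pk1 k; lra.
  have M40 : 0 < 4 ^+ k :> R by rewrite exprn_gt0.
  have [e e0 HE] := lower_failure K p2 M40 c0 rho0.
  exists e; split => // B I a A mB Bh mA dA AB sm.
  apply: HE sm => //; apply/seteqP; split => // t [Bt Ht].
  by rewrite -hd; split; [exact: Bh|exact: (Hhalf _ _ Ht)].
(* [lower_bad] squares its constant, and the square of [1 / e + 1] is at least [1 / e]. *)
exists (fun k => (e k)^-1 + 1); split=> [k|B mB dB Bh bad].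
  by rewrite addr_gt0// invr_gt0; exact: (He k).1.
apply: (gliding_hump _ hM (B := fun k => B k `|` H k)).
- by rewrite ltW// (lt_trans _ p2)// ltr1n.
- by move=> k; exact: measurableU.
- move=> k l kl; have BH i j : B i `&` H j = set0.
    apply/seteqP; split => // t [Bt Ht].
    by rewrite -hd; split; [exact: (Bh _ _ Bt)|exact: (Hhalf _ _ Ht)].
  by rewrite setIUl !setIUr dB// dH// BH [H k `&` B l]setIC BH !setU0.
- move=> k; have [I [a [A [mA dA AB]]]] := bad k.
  set n2 := nrm K _ ^+ 2; set S := \sum_i _ => sm.
  have e0 := (He k).1; apply: ((He k).2 (B k) I a A) => //; rewrite -/n2 -/S.
  have n20 : 0 <= n2 by exact: sqr_ge0.
  have ei : 0 < (e k)^-1 by rewrite invr_gt0.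
  have : (e k)^-1 * n2 < S.
    by apply: le_lt_trans sm; apply: ler_wpM2r => //; nra.
  by rewrite ltr_pdivrMl.
Qed.

Local Notation m A := (nrm K \1_A).

Lemma nrm_indic_le (A B : set T) : measurable A -> measurable B -> A `<=` B -> m A <= m B.
Proof.
move=> mA mB AB; apply: nrm_leW; [exact: good_indic..|] => t; rewrite !indicE.
have [At|nAt] := pselect (A t); first by rewrite !mem_set//; exact: AB.
by rewrite (memNset nAt) normr0.
Qed.

Lemma nrm_indicU_le (A B : set T) : measurable A -> measurable B -> m (A `|` B) <= m A + m B.
Proof.
move=> mA mB; apply: le_trans (nrmD_le (good_indic K mA) (good_indic K mB)).
apply: nrm_leW; [by apply/good_indic/measurableU|by apply/goodD; exact: good_indic|].
move=> t; rewrite !indicE in_setU.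
by case: (t \in A); case: (t \in B); rewrite /= ?addr0 ?add0r// ger0_norm// ger0_norm// lerDl.
Qed.

(** If this fails, tails [C n] of a sequence of sets of summable measure have norms above [e] and
    decrease to a null set. If their indicators are Cauchy, the limit vanishes off every [C n],
    hence is 0, which is absurd. Otherwise there are infinitely many disjoint differences of norm
    above some [d]. Any union of them has norm at most that of the constant 1, so large blocks
    violate the lower 2-estimate on disjoint sets. *)
Lemma abs_cont_half b (e : R) : 0 < e -> exists2 n : nat, True &
  forall A, measurable A -> A `<=` half_line b -> (mu A <= (1 / (2 ^ n.+1)%:R)%:E)%E -> m A <= e.
Proof.
move=> e0; apply: contrapT => H.
have {H}/choice[A HA] n : exists A, [/\ measurable A, A `<=` half_line b,
    (mu A <= (1 / (2 ^ n.+1)%:R)%:E)%E & e < m A].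
  apply: contrapT => nex; apply: H; exists n => // A mA Ah muA.
  by rewrite leNgt; apply/negP => eA; apply: nex; exists A.
have mA n : measurable (A n) by have [] := HA n.
pose C n := \bigcup_k A (k + n)%N.
have mC n : measurable (C n) by exact: bigcupT_measurable.
have Ch n : C n `<=` half_line b by move=> t [k _] At; have [_ + _ _] := HA (k + n)%N; apply.
have Csub n n' : (n <= n')%N -> C n' `<=` C n.
  by move=> nn t [k _ At]; exists (k + (n' - n))%N => //; rewrite -addnA subnK.
have muC n : (mu (C n) <= (1 / 2 ^+ n)%:E)%E.
  apply: (@le_trans _ _ (\sum_(k <oo) mu (A (k + n)%N))%E).
    by apply: generalized_Boole_inequality => //; exact: mC.
  have /cvg_lim <- // := @cvg_geometric_eseries_half R 1 n.
  apply: lee_nneseries => k _ //=.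
  by have [_ _ + _] := HA (k + n)%N; rewrite -addnS.
have eC n : e < m (C n).
  have [_ _ _ h] := HA n; apply: lt_le_trans h _; apply: nrm_indic_le => // t At.
  by exists 0%N.
pose z n := el K \1_(C n).
have zrep n : rep K \1_(C n) (z n) by exact/elP/good_indic.
have nz n : `|z n| = m (C n) by [].
have dif i j : (i <= j)%N -> `|z i - z j| = m (C i `\` C j).
  move=> ij; rewrite -elB; [|exact: good_indic..].
  congr (nrm K _); apply/funext => t; rewrite !indicE in_setD.
  have [Cj|nCj] := pselect (C j t).
    by rewrite (mem_set Cj) (mem_set (Csub _ _ ij _ Cj)) subrr.
  by rewrite (memNset nCj) subr0 andbT.
have [/cauchy_seq_limit[l zl]|ncau] := pselect (cauchy_seq z).
  have bl n : band K (~` C n) l = 0.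
    have mCc : measurable (~` C n) by exact: measurableC.
    apply: (@limit_seq_uniq _ _ (fun k => band K (~` C n) (z k))) => d d0.
      have [N HN] := zl d d0; exists N => k Nk; rewrite -bandB//.
      by apply: le_trans (band_norm_le _ _ mCc) _; exact: HN.
    exists n => k nk; rewrite subr0 /z band_el//; last exact: good_indic.
    have -> : (fun t => \1_(~` C n) t * \1_(C k) t) = (fun=> 0 : R).
      apply/funext => t; rewrite !indicE in_setC.
      have [Ck|nCk] := pselect (C k t).
        by rewrite (mem_set (Csub _ _ nk _ Ck)) mul0r.
      by rewrite (memNset nCk) mulr0.
    by rewrite (elE (rep0 K)) normr0 ltW.
  have l0 : l = 0.
    apply: (rep_uniq (rep_refl K l)); apply: rep_ae (rep0 K) _.
    have h1 : \forall t \ae mu, forall n, ~ C n t -> K l t = 0.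
      apply: ae_foralln => n; have := rep_band (measurableC (mC n)) (rep_refl K l).
      rewrite bl => h; have h' := rep0 K; near=> t => nCt.
      have := near h t; rewrite (near h' t)// => /(_ _) ->//.
      by rewrite indicE mem_set// mul1r.
    have h2 : \forall t \ae mu, exists n, ~ C n t.
      exists (\bigcap_n C n); split.
      - by apply: bigcapT_measurable.
      - apply/eqP; rewrite eq_le measure_ge0 andbT; apply/lee_addgt0Pr => d d0.
        rewrite add0e; have [N HN] : exists N, 1 / 2 ^+ N <= d.
          exists (Num.truncn d^-1).+1; rewrite div1r -[d]invrK lef_pV2 ?posrE ?invr_gt0 ?exprn_gt0//.
          apply: le_trans (ltW (truncnS_gt _)) _; rewrite invrK -natrX ler_nat.
          by apply: ltnW; exact: ltn_expl.
        apply: (@le_trans _ _ (mu (C N))); last by apply: le_trans (muC N) _; rewrite lee_fin.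
        by apply: le_measure; rewrite ?inE//; [exact: bigcapT_measurable|exact: bigcap_inf].
      - by move=> t /= /forallNP h n _; apply: contrapT; exact: h.
    by apply: filterS2 h1 h2 => t h [n nC]; rewrite (h n).
  have [N HN] := zl e e0; have := HN N (leqnn N).
  by rewrite l0 subr0 nz leNgt eC.
have {ncau}[d [d0 ncau]] : exists d, 0 < d /\ forall N, exists i j,
    [/\ (N <= i)%N, (i <= j)%N & d < m (C i `\` C j)].
  apply: contrapT => nex; apply: ncau => d d0.
  apply: contrapT => nN; apply: nex; exists d; split => // N.
  apply: contrapT => nij; apply: nN; exists N => i j Ni Nj.
  rewrite leNgt; apply/negP => dij; apply: nij.
  have [ij|/ltnW ji] := leqP i j; first by exists i, j; split; rewrite // -dif.
  by exists j, i; split; rewrite // -dif// distrC.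
have /choice[f Hf] N : exists ij : nat * nat,
    [/\ (N <= ij.1)%N, (ij.1 <= ij.2)%N & d < m (C ij.1 `\` C ij.2)].
  by have [i [j h]] := ncau N; exists (i, j).
(* Each difference starts where the previous one ended, which makes the [D k] disjoint. *)
pose st := fix st k : nat := if k is k'.+1 then (f (st k')).2 else 0%N.
have st_le i j : (i <= j)%N -> (st i <= st j)%N.
  move=> ij; rewrite -(subnKC ij); elim: (j - i)%N => [|k IH]; first by rewrite addn0.
  rewrite addnS /=; apply: leq_trans IH _; have [h1 h2 _] := Hf (st (i + k)%N).
  exact: leq_trans h1 h2.
pose D k := C (f (st k)).1 `\` C (f (st k)).2.
have mD k : measurable (D k) by exact: measurableD.
have Dh k : D k `<=` half_line b by move=> t [/Ch].
have dD k l : k != l -> D k `&` D l = set0.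
  have key i j t : (i < j)%N -> D i t -> D j t -> False.
    move=> ij [_ nC] [Cj _]; apply: nC; apply: Csub Cj.
    have [h1 _ _] := Hf (st j); apply: leq_trans h1.
    by have := st_le _ _ ij.
  move=> kl; apply/seteqP; split => // t [tk tl].
  by have [lt|lt|/eqP] := ltngtP k l; [exact: key lt tk tl|exact: key lt tl tk|rewrite (negbTE kl)].
have dm k : d < m (D k) by have [] := Hf (st k).
have [Mk [Mk0 noseq]] := no_lower_bad_seq b.
pose n1 := m setT.
(* So many pieces of norm above [d] that their square sum exceeds [Mk k ^+ 2 * n1 ^+ 2]. *)
pose n k := (Num.truncn (Mk k ^+ 2 * n1 ^+ 2 / d ^+ 2)).+1.
(* The pairing distributes a single disjoint sequence over infinitely many blocks. *)
pose E (k i : nat) := D (pickle (k, i)).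
pose B k := \bigcup_(i in [set i | (i < n k)%N]) E k i.
apply: (noseq B).
- by move=> k; apply: bigcup_measurable => i _; exact: mD.
- move=> k l kl; apply/seteqP; split => // t [[i _ ti] [j _ tj]].
  have := dD (pickle (k, i)) (pickle (l, j)); rewrite (inj_eq (pcan_inj pickleK)).
  by rewrite xpair_eqE (negbTE kl) => /(_ isT) <-; split.
- by move=> k t [i _] /Dh.
- move=> k; exists 'I_(n k), (fun _ : 'I_(n k) => 1 : R), (fun i : 'I_(n k) => E k i); split.
  + by move=> i; exact: mD.
  + move=> i j ij; apply: dD; rewrite (inj_eq (pcan_inj pickleK)) xpair_eqE eqxx /=.
    by apply: contra ij => /eqP/val_inj ->.
  + by move=> i t ti; exists i => //=.
  have dE : pw_disjoint (fun i : 'I_(n k) => E k i).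
    move=> i j ij; apply: dD; rewrite (inj_eq (pcan_inj pickleK)) xpair_eqE eqxx /=.
    by apply: contra ij => /eqP/val_inj ->.
  apply: (@le_lt_trans _ _ (Mk k ^+ 2 * n1 ^+ 2)).
    rewrite ler_wpM2l ?sqr_ge0// lerXn2r ?nnegrE ?nrm_ge0//.
    apply: nrm_leW => [||t]; [by apply: good_step => i; exact: mD|exact: good_indic|].
    rewrite indicT normr1.
    have [[i ti]|/forallNP h] := pselect (exists i : 'I_(n k), E k i t).
      by rewrite (step_in dE _ ti) normr1.
    by rewrite step_out// normr0.
  apply: (@lt_le_trans _ _ ((n k)%:R * d ^+ 2)).
    by rewrite -ltr_pdivrMr ?exprn_gt0//; exact: truncnS_gt.
  have -> : (n k)%:R * d ^+ 2 = \sum_(i < n k) d ^+ 2.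
    by rewrite sumr_const card_ord mulr_natl.
  apply: ler_sum => i _.
  have -> : (fun t => 1 * \1_(E k i) t) = \1_(E k i) :> (T -> R).
    by apply/funext => t; rewrite mul1r.
  by rewrite lerXn2r ?nnegrE ?nrm_ge0 ?(ltW d0)//; exact: (ltW (dm _)).
Unshelve. all: by end_near. Qed.

Lemma abs_cont (e : R) : 0 < e -> exists2 d : R, 0 < d &
  forall A, measurable A -> (mu A <= d%:E)%E -> m A <= e.
Proof.
move=> e0; have e2 : 0 < e / 2 by rewrite divr_gt0.
have [n1 _ H1] := abs_cont_half true e2; have [n2 _ H2] := abs_cont_half false e2.
exists (1 / (2 ^ (maxn n1 n2).+1)%:R); first by rewrite divr_gt0// ltr0n expn_gt0.
move=> A mA muA.
have AE : A = (A `&` half_line true) `|` (A `&` half_line false).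
  rewrite -setIUr; have -> : half_line true `|` half_line false = setT; last by rewrite setIT.
  apply/seteqP; split => // t _; rewrite /half_line /= !in_itv /= andbT.
  by case: (lerP (1 / 2) t) => h; [left|right].
have mAh b : measurable (A `&` half_line b) by apply: measurableI => //; exact: measurable_half.
have sm n b : (n <= maxn n1 n2)%N -> (mu (A `&` half_line b) <= (1 / (2 ^ n.+1)%:R)%:E)%E.
  move=> nm; apply: (@le_trans _ _ (mu A)).
    by apply: le_measure; rewrite ?inE//; exact: subIsetl.
  apply: le_trans muA _; rewrite lee_fin !div1r lef_pV2 ?posrE ?ltr0n ?expn_gt0//.
  by rewrite ler_nat leq_exp2l.
rewrite AE; apply: le_trans (nrm_indicU_le _ _) _ => //.
rewrite [e]splitr; apply: lerD.
  by apply: H1 => //; apply: sm; exact: leq_maxl.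
by apply: H2 => //; apply: sm; exact: leq_maxr.
Qed.
End AbsoluteContinuity.

(** * Localization and the two 2-estimates *)

Section Localization.
Context {R : realType}.
Local Notation mu := (leb01 R).
Local Notation T := (measurableTypeR R).

Definition cell (N j : nat) : set T := `[j%:R / N%:R, j.+1%:R / N%:R[.

(** The half-open cells miss the endpoint 1; together with the outside of [0, 1] it forms a null
    set. *)
Definition cell_rest : set T := ~` `[0, 1[.

Lemma measurable_cell N j : measurable (cell N j).
Proof. exact: measurable_itv. Qed.

Lemma measurable_cell_rest : measurable cell_rest.
Proof. by apply: measurableC; exact: measurable_itv. Qed.

Lemma mu_cell N j : (j < N)%N -> mu (cell N j) = (N%:R^-1)%:E.
Proof.
move=> jN; have N0 : 0 < N%:R :> R by rewrite ltr0n (leq_ltn_trans _ jN).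
rewrite leb01_itv.
- by congr EFin; rewrite -mulrBl -natr1 addrAC subrr add0r mul1r.
- by rewrite divr_ge0// ltW.
- by rewrite ler_pM2r ?invr_gt0// ler_nat.
- by rewrite ler_pdivrMr// mul1r ler_nat.
Qed.

Lemma mu_cell_rest : mu cell_rest = 0%E.
Proof.
rewrite /leb01 /= /mrestr; have -> : cell_rest `&` `[(0 : R), 1] = [set 1].
  apply/seteqP; split=> t; rewrite /cell_rest /= !in_itv /=.
    by move=> [h /andP[t0 t1]]; apply/le_anti; rewrite t1 /= leNgt; apply/negP => lt; apply: h; rewrite t0.
  by move=> ->; split; rewrite ?ltxx ?andbF// ler01 lexx.
exact: lebesgue_measure_set1.
Qed.

Lemma cell_cover N t : (0 < N)%N -> ~ cell_rest t -> exists2 j, (j < N)%N & cell N j t.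
Proof.
move=> N0 /contrapT; rewrite /= in_itv /= => /andP[t0 t1].
have Np : 0 < N%:R :> R by rewrite ltr0n.
have tN : 0 <= t * N%:R by rewrite mulr_ge0.
exists (Num.truncn (t * N%:R)).
  by rewrite truncn_lt_nat// gtr_pMl.
by rewrite /cell /= in_itv /= ler_pdivrMr// ltr_pdivlMr// truncn_le tN truncnS_gt.
Qed.

(** Badness with constant [M] on a set, instantiated later by [lower_bad] and [upper_bad]. The
    factor 2 lost in [Qprime] and [Qstable] is harmless because [P] asks for all constants. *)
Variable Q : R -> set T -> Prop.
Hypothesis Qmono : forall M M' B, M <= M' -> 0 < M -> Q M' B -> Q M B.
Hypothesis Qprime : forall M B B', 0 < M -> measurable B -> measurable B' ->
  Q (2 * M) (B `|` B') -> Q M B \/ Q M B'.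
Hypothesis Qstable : forall M B, 0 < M -> measurable B -> Q (2 * M) B ->
  exists2 d : R, 0 < d & forall J, measurable J -> (mu J <= d%:E)%E -> Q M (B `\` J).

Let P B := forall M, 0 < M -> Q M B.

(** If badness stops at [M1] on [B] and at [M2] on [B'], by monotonicity neither set is bad at the
    maximum of the two. *)
Lemma prime_all B B' : measurable B -> measurable B' -> P (B `|` B') -> P B \/ P B'.
Proof.
move=> mB mB' PU; apply: contrapT => /not_orP[/existsNP[M1 /not_implyP[M10 n1]]
  /existsNP[M2 /not_implyP[M20 n2]]].
have M0 : 0 < Num.max M1 M2 by rewrite lt_max M10.
have [|h|h] := Qprime M0 mB mB'; first by apply: PU; rewrite mulr_gt0.
  by apply: n1; apply: Qmono h => //; rewrite le_max lexx.
by apply: n2; apply: Qmono h => //; rewrite le_max lexx orbT.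
Qed.

(** Cells are removed one by one: each time, either the part in the cell is bad for all constants,
    and it is small, or what is left is. After the last cell only a null set is left, which is small
    too. *)
Lemma small_piece B (d : R) : measurable B -> P B -> 0 < d ->
  exists J, [/\ measurable J, J `<=` B, P J & (mu J <= d%:E)%E].
Proof.
move=> mB PB d0; pose N := (Num.truncn d^-1).+1.
have Nd : N%:R^-1 <= d.
  by rewrite -[d]invrK lef_pV2 ?posrE ?invr_gt0 ?ltr0n//; exact/ltW/truncnS_gt.
have le_d A C : measurable A -> measurable C -> (mu C <= d%:E)%E -> (mu (A `&` C) <= d%:E)%E.
  move=> mA mC; apply: le_trans; apply: le_measure; rewrite ?inE//; exact: measurableI.
pose U n := \big[setU/set0]_(j < n) cell N j.
have mU n : measurable (U n).
  by apply: bigsetU_measurable => j _; exact: measurable_cell.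
have H n : (n <= N)%N -> (exists J, [/\ measurable J, J `<=` B, P J & (mu J <= d%:E)%E]) \/
    P (B `\` U n).
  elim: n => [|n IH] nN; first by right; rewrite /U big_ord0 setD0.
  have [h|Pn] := IH (ltnW nN); first by left.
  have mC := measurable_cell N n.
  have E : B `\` U n = (B `\` U n) `&` cell N n `|` B `\` U n.+1.
    apply/seteqP; split => t.
      move=> [Bt nU]; have [ct|nct] := pselect (cell N n t); first by left.
      by right; split => //; rewrite /U big_ord_recr /= => -[|].
    by move=> [[]//|[Bt nU]]; split => // Ut; apply: nU; rewrite /U big_ord_recr /=; left.
  have mD : measurable (B `\` U n) by exact: measurableD.
  rewrite E in Pn.
  have [||h|] := prime_all _ _ Pn; [exact: measurableI|exact: measurableD| |by right].
  left; exists ((B `\` U n) `&` cell N n); split => //.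
  - exact: measurableI.
  - by move=> t [[]].
  - by apply: le_d => //; rewrite mu_cell ?lee_fin.
have [//|PN] := H N (leqnn N).
exists (B `\` U N); split => //; first exact: measurableD.
apply: (@le_trans _ _ (mu cell_rest)); last by rewrite mu_cell_rest lee_fin ltW.
apply: le_measure; rewrite ?inE//; [exact: measurableD|exact: measurable_cell_rest|].
move=> t [_ nU]; apply: contrapT => /(@cell_cover N t isT)[j jN ct]; apply: nU.
by rewrite /U -bigcup_mkord; exists j.
Qed.

(** In a set bad for all constants, a subset with the same property is found so small that its
    removal keeps the set bad with constant [Mk k]. The successive differences of the nested sets
    are disjoint. *)
Lemma localize (D : set T) (Mk : nat -> R) : measurable D -> P D ->
  (forall k, 0 < Mk k) ->
  exists B : nat -> set T, [/\ forall k, measurable (B k),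
    forall k l, k != l -> B k `&` B l = set0, forall k, B k `<=` D &
    forall k, Q (Mk k) (B k)].
Proof.
move=> mD PD M0.
pose st := {J : set T | measurable J /\ P J}.
have step k (J : st) : exists J' : st, sval J' `<=` sval J /\ Q (Mk k) (sval J `\` sval J').
  case: J => J [mJ PJ] /=.
  have [|d d0 Hd] := Qstable (M0 k) mJ; first by apply: PJ; rewrite mulr_gt0.
  have [J' [mJ' J'J PJ' muJ']] := small_piece mJ PJ d0.
  by exists (exist _ J' (conj mJ' PJ')); split => //; exact: Hd.
have {}step (kJ : nat * st) : exists J' : st,
    sval J' `<=` sval kJ.2 /\ Q (Mk kJ.1) (sval kJ.2 `\` sval J') by exact: step.
have /choice[f Hf] := step.
pose s := fix s k : st := if k is k'.+1 then f (k', s k') else exist _ D (conj mD PD).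
have sS k : sval (s k.+1) `<=` sval (s k) by exact: (Hf (k, s k)).1.
have sle i j : (i <= j)%N -> sval (s j) `<=` sval (s i).
  move=> ij; rewrite -(subnKC ij); elim: (j - i)%N => [|n IH]; first by rewrite addn0.
  by rewrite addnS => t /sS /IH.
have ms k : measurable (sval (s k)) by have [] := svalP (s k).
exists (fun k => sval (s k) `\` sval (s k.+1)); split.
- by move=> k; exact: measurableD.
- have key i j t : (i < j)%N -> (sval (s i) `\` sval (s i.+1)) t ->
     (sval (s j) `\` sval (s j.+1)) t -> False.
    by move=> ij [_ nt] [tj _]; apply: nt; exact: sle tj.
  move=> kl1 kl2 kl; apply/seteqP; split => // t [tk tl].
  by have [lt|lt|/eqP] := ltngtP kl1 kl2; [exact: key lt tk tl|exact: key lt tl tk|rewrite (negbTE kl)].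
- by move=> k t [tk _]; exact: (sle 0%N k).
- by move=> k; exact: (Hf (k, s k)).2.
Qed.
End Localization.

(** * The lower 2-estimate and the flat upper 2-estimate *)

Section Estimates.
Context {R : realType} {X : completeNormedModType R} (K : kothe_space X).
Local Notation mu := (leb01 R).
Local Notation T := (measurableTypeR R).
Variable p : R.
Hypothesis p2 : 2 < p.
Hypothesis hM : has_M X p.
Local Notation m A := (nrm K \1_A).

Section Restrict.
Variables (I : finType) (a : I -> R) (A : I -> set T) (B : set T).
Hypothesis mA : forall i, measurable (A i).
Hypothesis mB : measurable B.

Lemma step_setI t : step (fun i => A i `&` B) a t = \1_B t * step A a t.
Proof.
rewrite /step mulr_sumr; apply: eq_bigr => i _; rewrite indicI /=; ring.
Qed.

Lemma pw_disjoint_setI : pw_disjoint A -> pw_disjoint (fun i => A i `&` B).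
Proof. by move=> dA i j ij; rewrite setIACA dA// set0I. Qed.

Lemma nrm_band_le f : good K f -> nrm K (fun t => \1_B t * f t) <= nrm K f.
Proof.
move=> gf; apply: nrm_leW => //; first exact: good_band.
move=> t; rewrite normrM ler_piMl// ger0_norm// indicE; by case: (t \in B).
Qed.

Lemma nrm_step_setI_le : nrm K (step (fun i => A i `&` B) a) <= nrm K (step A a).
Proof.
have -> : step (fun i => A i `&` B) a = (fun t => \1_B t * step A a t).
  by apply/funext => t; rewrite step_setI.
exact/nrm_band_le/good_step.
Qed.

Lemma nrm_term_setI_le i : nrm K (fun t => a i * \1_(A i `&` B) t) <=
  nrm K (fun t => a i * \1_(A i) t).
Proof.
have -> : (fun t => a i * \1_(A i `&` B) t) = (fun t => \1_B t * (a i * \1_(A i) t)).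
  by apply/funext => t; rewrite indicI /=; ring.
exact/nrm_band_le/good_term.
Qed.
End Restrict.

Lemma nrm_term (c : R) (A : set T) : measurable A ->
  nrm K (fun t => c * \1_A t) = `|c| * m A.
Proof. by move=> mA; rewrite nrmZ//; exact: good_indic. Qed.

Lemma indic_split (A B C : set T) (t : T) : A `<=` B `|` C -> B `&` C = set0 ->
  \1_A t = \1_(A `&` B) t + \1_(A `&` C) t :> R.
Proof.
move=> ABC BC; rewrite !indicE !in_setI.
have [At|nAt] := pselect (A t); last by rewrite (memNset nAt) addr0.
rewrite (mem_set At) /=; have [Bt|Ct] := ABC _ At.
  rewrite (mem_set Bt) memNset ?addr0// => Ct.
  by have : (B `&` C) t by []; rewrite BC.
rewrite (mem_set Ct) memNset ?add0r// => Bt.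
by have : (B `&` C) t by []; rewrite BC.
Qed.

Lemma nrm_setD_ge (A J : set T) : measurable A -> measurable J ->
  m A - m J <= m (A `\` J).
Proof.
move=> mA mJ; rewrite lerBlDr; have mD := measurableD mA mJ.
apply: le_trans (nrm_indicU_le K mD mJ).
apply: nrm_indic_le => //; first exact: measurableU.
by move=> t At; have [Jt|nJt] := pselect (J t); [right|left].
Qed.

Lemma lower_bad_mono M M' B : M <= M' -> 0 < M -> lower_bad K M' B -> lower_bad K M B.
Proof.
move=> MM M0 [I [a [A [mA dA AB lt]]]]; exists I, a, A; split => //.
apply: le_lt_trans lt; rewrite ler_wpM2r ?sqr_ge0// lerXn2r// nnegrE ltW//.
exact: lt_le_trans MM.
Qed.

Lemma setU_disj_split (B B' : set T) : measurable B -> measurable B' ->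
  exists2 C, measurable C & [/\ C `<=` B', B `|` B' = B `|` C & B `&` C = set0].
Proof.
move=> mB mB'; exists (B' `\` B); first exact: measurableD.
split; [by move=> t []| |by apply/seteqP; split => // t [Bt []]].
apply/seteqP; split => t [Bt|]; [by left| |by left|by move=> []; right].
by move=> B't; have [Bt|nBt] := pselect (B t); [left|right].
Qed.

(** The factor 2 comes from [(y + z) ^+ 2 <= 2 * y ^+ 2 + 2 * z ^+ 2], for the norms of the two
    parts of each piece. *)
Lemma lower_bad_prime M B B' : 0 < M -> measurable B -> measurable B' ->
  lower_bad K (2 * M) (B `|` B') -> lower_bad K M B \/ lower_bad K M B'.
Proof.
move=> M0 mB mB' [I [a [A [mA dA AB lt]]]].
have [C mC [CB' UE BC]] := setU_disj_split mB mB'; rewrite UE in AB.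
apply: contrapT => /not_orP[n1 n2].
have key D : measurable D -> ~ lower_bad K M D ->
    \sum_i nrm K (fun t => a i * \1_(A i `&` D) t) ^+ 2 <= M ^+ 2 * nrm K (step A a) ^+ 2.
  move=> mD nD; rewrite leNgt; apply/negP => h; apply: nD.
  exists I, a, (fun i => A i `&` D); split => //.
  - by move=> i; exact: measurableI.
  - exact: pw_disjoint_setI.
  - apply: le_lt_trans h; rewrite ler_wpM2l ?sqr_ge0// lerXn2r ?nnegrE ?nrm_ge0//.
    exact: nrm_step_setI_le.
have k1 := key _ mB n1.
have nC : ~ lower_bad K M C.
  move=> [J [b [F [mF dF FC h]]]]; apply: n2; exists J, b, F; split => //.
  by move=> j; exact: subset_trans (FC j) CB'.
have k2 := key _ mC nC.
move: lt; apply/negP; rewrite -leNgt.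
apply: (@le_trans _ _ (\sum_i (2 * nrm K (fun t => a i * \1_(A i `&` B) t) ^+ 2 +
    2 * nrm K (fun t => a i * \1_(A i `&` C) t) ^+ 2))).
  apply: ler_sum => i _.
  have h : nrm K (fun t => a i * \1_(A i) t) <= nrm K (fun t => a i * \1_(A i `&` B) t) +
      nrm K (fun t => a i * \1_(A i `&` C) t).
    have gB : good K (fun t => a i * \1_(A i `&` B) t).
      by apply/goodZ/good_indic; exact: measurableI.
    have gC : good K (fun t => a i * \1_(A i `&` C) t).
      by apply/goodZ/good_indic; exact: measurableI.
    apply: le_trans (nrmD_le gB gC); apply: le_of_eq.
    congr (nrm K _); apply/funext => t; rewrite (indic_split t (AB i) BC); ring.
  have := nrm_ge0 K (fun t => a i * \1_(A i) t).
  move: h; set x := nrm K _; set y := nrm K _; set z := nrm K _ => h x0.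
  by have := sqr_ge0 (y - z); nra.
rewrite big_split /= -!mulr_sumr exprMn.
have := sqr_ge0 (nrm K (step A a)); lra.
Qed.

(** By absolute continuity, a small [J] removes at most half of the norm of each of the finitely
    many pieces; the square sum loses at most a factor 4, which [(2 * M) ^+ 2] absorbs. *)
Lemma lower_bad_stable M B : 0 < M -> measurable B -> lower_bad K (2 * M) B ->
  exists2 d : R, 0 < d & forall J, measurable J -> (mu J <= d%:E)%E -> lower_bad K M (B `\` J).
Proof.
move=> M0 mB [I [a [A [mA dA AB lt]]]].
pose nt i := nrm K (fun t => a i * \1_(A i) t).
have [e e0 He] : exists2 e : R, 0 < e & forall i, 0 < nt i -> `|a i| * e <= nt i / 2.
  (* The neutral value 1 covers the case without pieces of positive norm, and the added 1 keeps the
     denominators positive. *)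
  pose e := \big[Order.min/1]_(i | 0 < nt i) (nt i / 2 / (`|a i| + 1)).
  exists e.
    rewrite /e; apply: (big_ind (fun x => 0 < x)) => // [x y x0 y0|i ni].
      by rewrite lt_min x0 y0.
    by rewrite !divr_gt0// ltr_wpDl.
  move=> i ni; have h : e <= nt i / 2 / (`|a i| + 1) by exact: bigmin_le_cond.
  have a1 : 0 < `|a i| + 1 by rewrite ltr_wpDl.
  move: h; rewrite ler_pdivlMr// => h; apply: le_trans h.
  by rewrite mulrDr mulr1 mulrC lerDl /e; apply: (big_ind (fun x => 0 <= x)) =>
    // [x y x0 y0|j nj]; [rewrite le_min x0 y0|rewrite !divr_ge0 ?ltW// ltr_wpDl].
have [d d0 Hd] := abs_cont K p2 hM e0.
exists d => // J mJ muJ; exists I, a, (fun i => A i `&` ~` J); split.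
- by move=> i; apply: measurableI => //; exact: measurableC.
- exact: pw_disjoint_setI.
- by move=> i t [/AB Bt nJ].
have mJc : measurable (~` J) by exact: measurableC.
have h1 := nrm_step_setI_le a mA mJc.
have h2 i : nt i / 2 <= nrm K (fun t => a i * \1_(A i `&` ~` J) t).
  have [n0|/He ni] := lerP (nt i) 0.
    apply: le_trans (nrm_ge0 _ _); lra.
  rewrite nrm_term; last by exact: measurableI.
  have := ler_wpM2l (normr_ge0 (a i)) (nrm_setD_ge (mA i) mJ).
  rewrite setDE mulrBr; have -> : `|a i| * m (A i) = nt i by rewrite /nt nrm_term.
  by have := ler_wpM2l (normr_ge0 (a i)) (Hd _ mJ muJ); lra.
apply: (@lt_le_trans _ _ (\sum_i (nt i / 2) ^+ 2)); last first.
  by apply: ler_sum => i _; rewrite lerXn2r ?nnegrE ?nrm_ge0 ?divr_ge0 ?nrm_ge0.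
apply: (@le_lt_trans _ _ (M ^+ 2 * nrm K (step A a) ^+ 2)).
  by rewrite ler_wpM2l ?sqr_ge0// lerXn2r ?nnegrE ?nrm_ge0.
have -> : \sum_i (nt i / 2) ^+ 2 = (\sum_i nt i ^+ 2) / 4.
  by rewrite mulr_suml; apply: eq_bigr => i _; field.
have lt' : (2 * M) ^+ 2 * nrm K (step A a) ^+ 2 < \sum_i nt i ^+ 2 by [].
move: lt'; rewrite exprMn; lra.
Qed.

(** Otherwise one of the half lines is bad for all constants, and localization finds in it the
    disjoint bad sets that [no_lower_bad_seq] rules out. *)
Lemma lower_estimate : exists2 c : R, 0 < c & forall (I : finType) (a : I -> R) (A : I -> set T),
  (forall i, measurable (A i)) -> pw_disjoint A ->
  \sum_i nrm K (fun t => a i * \1_(A i) t) ^+ 2 <= c * nrm K (step A a) ^+ 2.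
Proof.
suff [M [M0 nM]] : exists M : R, 0 < M /\ ~ lower_bad K M setT.
  exists (M ^+ 2); first by rewrite exprn_gt0.
  move=> I a A mA dA; rewrite leNgt; apply/negP => lt; apply: nM.
  by exists I, a, A; split.
apply: contrapT => nex.
have PT M : 0 < M -> lower_bad K M setT.
  by move=> M0; apply: contrapT => nb; apply: nex; exists M.
have hT : (half_line true : set T) `|` half_line false = setT.
  apply/seteqP; split => // t _; rewrite /half_line /= !in_itv /= andbT.
  by case: (lerP (1 / 2) t) => h; [left|right].
have [b Pb] : exists b, forall M, 0 < M -> lower_bad K M (half_line b : set T).
  rewrite -hT in PT.
  have [h|h] := prime_all lower_bad_mono lower_bad_prime (measurable_half true)
    (measurable_half false) PT.
    by exists true.
  by exists false.
have [Mk [Mk0 noseq]] := no_lower_bad_seq K p2 hM b.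
have [B [mB dB Bh QB]] := localize lower_bad_mono lower_bad_prime lower_bad_stable
  (measurable_half b) Pb Mk0.
exact: noseq mB dB Bh QB.
Qed.

(** The flat form of the estimate, with pieces of norm at most 1 counted by their number, is the one
    [upper_failure] can treat; [upper_estimate] derives the general form. *)
Definition upper_bad (M : R) (B : set T) := exists (I : finType) (a : I -> R) (A : I -> set T),
  [/\ forall i, measurable (A i), pw_disjoint A, forall i, A i `<=` B,
    forall i, nrm K (fun t => a i * \1_(A i) t) <= 1 &
    M * Num.sqrt #|I|%:R < nrm K (step A a)].

Lemma upper_bad_mono M M' B : M <= M' -> 0 < M -> upper_bad M' B -> upper_bad M B.
Proof.
move=> MM M0 [I [a [A [mA dA AB a1 lt]]]]; exists I, a, A; split => //.
by apply: le_lt_trans lt; rewrite ler_wpM2r ?sqrtr_ge0.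
Qed.

Lemma nrm_step_split_le (I : finType) (a : I -> R) (A : I -> set T) B C :
  (forall i, measurable (A i)) -> measurable B -> measurable C ->
  (forall i, A i `<=` B `|` C) -> B `&` C = set0 ->
  nrm K (step A a) <= nrm K (step (fun i => A i `&` B) a) + nrm K (step (fun i => A i `&` C) a).
Proof.
move=> mA mB mC AB BC.
have gB : good K (step (fun i => A i `&` B) a) by apply: good_step => i; exact: measurableI.
have gC : good K (step (fun i => A i `&` C) a) by apply: good_step => i; exact: measurableI.
apply: le_trans (nrmD_le gB gC); apply: le_of_eq.
congr (nrm K _); apply/funext => t; rewrite /step -big_split /=.
by apply: eq_bigr => i _; rewrite (indic_split t (AB i) BC); ring.
Qed.

Lemma upper_bad_prime M B B' : 0 < M -> measurable B -> measurable B' ->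
  upper_bad (2 * M) (B `|` B') -> upper_bad M B \/ upper_bad M B'.
Proof.
move=> M0 mB mB' [I [a [A [mA dA AB a1 lt]]]].
have [C mC [CB' UE BC]] := setU_disj_split mB mB'; rewrite UE in AB.
apply: contrapT => /not_orP[n1 n2].
have key D : measurable D -> ~ upper_bad M D ->
    nrm K (step (fun i => A i `&` D) a) <= M * Num.sqrt #|I|%:R.
  move=> mD nD; rewrite leNgt; apply/negP => h; apply: nD.
  exists I, a, (fun i => A i `&` D); split => //.
  - by move=> i; exact: measurableI.
  - exact: pw_disjoint_setI.
  - by move=> i; apply: le_trans (a1 i); exact: nrm_term_setI_le.
have k1 := key _ mB n1.
have nC : ~ upper_bad M C.
  move=> [J [b [F [mF dF FC b1 h]]]]; apply: n2; exists J, b, F; split => //.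
  by move=> j; exact: subset_trans (FC j) CB'.
have k2 := key _ mC nC.
have := nrm_step_split_le a mA mB mC AB BC; lra.
Qed.

Lemma nrm_step_inside_le (I : finType) (a : I -> R) (A : I -> set T) J :
  (forall i, measurable (A i)) -> pw_disjoint A -> measurable J ->
  nrm K (step (fun i => A i `&` J) a) <= (\sum_i `|a i|) * m J.
Proof.
move=> mA dA mJ; have S0 : 0 <= \sum_i `|a i| by exact: sumr_ge0.
have -> : (\sum_i `|a i|) * m J = nrm K (fun t => (\sum_i `|a i|) * \1_J t).
  by rewrite nrm_term// ger0_norm.
apply: nrm_leW => [||t]; first by apply: good_step => i; exact: measurableI.
  exact/goodZ/good_indic.
rewrite step_setI// normrM mulrC normrM ler_wpM2r// [X in _ <= X]ger0_norm//.
have [[i Ai]|/forallNP h] := pselect (exists i, A i t); last by rewrite step_out// normr0.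
rewrite (step_in dA _ Ai) (bigD1 i)//= lerDl; exact: sumr_ge0.
Qed.

(** Within [J] the step function is at most the sum of the [|a i|] times the indicator of [J]; for
    small [J] this costs at most half of the norm. *)
Lemma upper_bad_stable M B : 0 < M -> measurable B -> upper_bad (2 * M) B ->
  exists2 d : R, 0 < d & forall J, measurable J -> (mu J <= d%:E)%E -> upper_bad M (B `\` J).
Proof.
move=> M0 mB [I [a [A [mA dA AB a1 lt]]]].
pose N := nrm K (step A a); have sq := sqrtr_ge0 (#|I|%:R : R).
have N0 : 0 < N by apply: le_lt_trans lt; rewrite !mulr_ge0// ltW.
pose S := \sum_i `|a i| + 1.
have S0 : 0 < S by rewrite ltr_wpDl// sumr_ge0.
have [d d0 Hd] := abs_cont K p2 hM (divr_gt0 N0 (mulr_gt0 (ltr0n _ 2) S0)).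
exists d => // J mJ muJ; exists I, a, (fun i => A i `&` ~` J).
have mJc : measurable (~` J) by exact: measurableC.
split.
- by move=> i; exact: measurableI.
- exact: pw_disjoint_setI.
- by move=> i t [/AB Bt nJ].
- by move=> i; apply: le_trans (a1 i); exact: nrm_term_setI_le.
have h1 : N <= nrm K (step (fun i => A i `&` J) a) + nrm K (step (fun i => A i `&` ~` J) a).
  by apply: nrm_step_split_le => //; rewrite ?setUv ?setICr.
have h2 := nrm_step_inside_le a mA dA mJ.
have h3 : (\sum_i `|a i|) * m J <= N / 2.
  apply: (@le_trans _ _ (S * (N / (2 * S)))); last by apply: le_of_eq; field; lra.
  apply: ler_pM; rewrite ?sumr_ge0 ?nrm_ge0// ?Hd//; by rewrite /S lerDl.
have : 2 * M * Num.sqrt #|I|%:R < N by [].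
lra.
Qed.

(** The failures given by [upper_failure] live in the bad sets themselves, so localization can run
    on the whole line instead of a half line. *)
Lemma upper_flat : exists2 C : R, 0 < C & forall (I : finType) (a : I -> R) (A : I -> set T),
  (forall i, measurable (A i)) -> pw_disjoint A ->
  (forall i, nrm K (fun t => a i * \1_(A i) t) <= 1) ->
  nrm K (step A a) <= C * Num.sqrt #|I|%:R.
Proof.
suff [M [M0 nM]] : exists M : R, 0 < M /\ ~ upper_bad M setT.
  exists M => // I a A mA dA a1; rewrite leNgt; apply/negP => lt; apply: nM.
  by exists I, a, A; split.
apply: contrapT => nex.
have PT M : 0 < M -> upper_bad M setT.
  by move=> M0; apply: contrapT => nb; apply: nex; exists M.
have [C0 C00 HC0] := upper_failure K p2.
have Mk0 k : 0 < C0 * 4 ^+ k by rewrite mulr_gt0// exprn_gt0.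
have [B [mB dB _ QB]] := localize upper_bad_mono upper_bad_prime upper_bad_stable
  measurableT PT Mk0.
apply: (gliding_hump _ hM mB dB); first by rewrite ltW// (lt_trans _ p2)// ltr1n.
move=> k; have [I [a [A [mA dA AB a1 lt]]]] := QB k.
by apply: HC0 lt => //; rewrite exprn_ege1// ler1n.
Qed.
End Estimates.

(** * The upper 2-estimate for arbitrary coefficients *)

Section UpperEstimate.
Context {R : realType} {X : completeNormedModType R} (K : kothe_space X).
Local Notation mu := (leb01 R).
Local Notation T := (measurableTypeR R).
Variable p : R.
Hypothesis p2 : 2 < p.
Hypothesis hM : has_M X p.
Local Notation m A := (nrm K \1_A).

Lemma pw_disjoint_option (J : finType) (F : J -> set T) G :
  pw_disjoint F -> (forall j, F j `&` G = set0) ->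
  pw_disjoint (fun o : option J => if o is Some j then F j else G).
Proof.
move=> dF FG [i|] [j|]//= ij; last by rewrite setIC.
by apply: dF; apply: contra ij => /eqP ->.
Qed.

Lemma step_cst_indic (J : finType) (F : J -> set T) A c : pw_disjoint F ->
  (forall t, A t <-> exists j, F j t) -> step F (fun=> c) = (fun t => c * \1_A t).
Proof.
move=> dF AF; apply/funext => t; have [[j Fj]|nF] := pselect (exists j, F j t).
  by rewrite (step_in dF _ Fj) indicE mem_set ?mulr1//; apply/AF; exists j.
rewrite step_out; last by move=> j Fj; apply: nF; exists j.
by rewrite indicE memNset ?mulr0// => /AF.
Qed.

(** The cells are swept and collected in a bag [G], closed once its norm reaches [e]. As one cell
    adds at most [e], a closed bag has norm between [e] and [2 * e], and the lower estimate bounds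
    the number of closed bags. The last bag may be small, whence the [- 1]. *)
Lemma split_indic c (A : set T) (e : R) : 0 < e -> measurable A ->
  (forall (I : finType) (a : I -> R) (F : I -> set T),
    (forall i, measurable (F i)) -> pw_disjoint F ->
    \sum_i nrm K (fun t => a i * \1_(F i) t) ^+ 2 <= c * nrm K (step F a) ^+ 2) ->
  exists (J : finType) (F : J -> set T), [/\ forall j, measurable (F j), pw_disjoint F,
    forall t, A t <-> exists j, F j t, forall j, m (F j) <= 2 * e &
    (#|J|%:R - 1) * e ^+ 2 <= c * m A ^+ 2].
Proof.
move=> e0 mA Hc; have [d d0 Hd] := abs_cont K p2 hM e0.
pose N := (Num.truncn d^-1).+1.
have Nd : N%:R^-1 <= d.
  by rewrite -[d]invrK lef_pV2 ?posrE ?invr_gt0 ?ltr0n//; exact/ltW/truncnS_gt.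
pose V k : set T := A `&` (cell_rest `|` [set t | exists2 j, (j < k)%N & cell N j t]).
have small (D C : set T) : measurable D -> measurable C -> D `<=` C -> (mu C <= d%:E)%E -> m D <= e.
  move=> mD mC DC muC; apply: Hd => //; apply: le_trans muC.
  by apply: le_measure; rewrite ?inE.
have H k : (k <= N)%N -> exists (J : finType) (F : J -> set T) (G : set T),
    [/\ forall j, measurable (F j), pw_disjoint F, measurable G, forall j, F j `&` G = set0 &
    [/\ forall t, V k t <-> (exists j, F j t) \/ G t, forall j, e <= m (F j),
      forall j, m (F j) <= 2 * e & m G <= e]].
  elim: k => [|k IH] kN.
    exists void, (fun=> set0), (A `&` cell_rest); split => //.
      by apply: measurableI => //; exact: measurable_cell_rest.
    split => // [t|]; first by split; [move=> [At [|[]//]]; right|move=> [[]//|[At ct]]; split => //; left].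
    apply: (small _ cell_rest) => //; [|exact: measurable_cell_rest|by rewrite mu_cell_rest lee_fin ltW].
    by apply: measurableI => //; exact: measurable_cell_rest.
  have [J [F [G [mF dF mG FG [VE Fe F2e Ge]]]]] := IH (ltnW kN).
  have mV : measurable (V k).
    apply: measurableI => //; apply: measurableU; first exact: measurable_cell_rest.
    rewrite [X in measurable X](_ : _ = \bigcup_(j in [set j | (j < k)%N]) cell N j).
      by apply: bigcup_measurable => j _; exact: measurable_cell.
    by apply/seteqP; split => t [j ? ?]; exists j.
  pose D := A `&` cell N k `\` V k.
  have mD : measurable D.
    by apply: measurableD => //; apply: measurableI => //; exact: measurable_cell.
  have De : m D <= e.
    apply: (small _ (cell N k)) => //; [exact: measurable_cell|by move=> t [[]]|].
    by rewrite mu_cell// lee_fin.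
  have mGD : measurable (G `|` D) by exact: measurableU.
  have FGD j : F j `&` (G `|` D) = set0.
    rewrite setIUr FG set0U; apply/seteqP; split => // t [Fj [_ nV]].
    by apply: nV; apply/VE; left; exists j.
  have GDe : m (G `|` D) <= 2 * e.
    by apply: le_trans (nrm_indicU_le K mG mD) _; lra.
  have VE' t : V k.+1 t <-> (exists j, F j t) \/ (G `|` D) t.
    have V1 : V k.+1 t <-> V k t \/ D t.
      split.
        move=> [At h]; have [Vt|nVt] := pselect (V k t); first by left.
        right; split => //; split => //; move: h => [ct|[j]]; first by case: nVt; split => //; left.
        rewrite ltnS leq_eqVlt => /orP[/eqP ->//|jk ct].
        by case: nVt; split => //; right; exists j.
      move=> [[At [ct|[j jk ct]]]|[[At ct] _]]; split => //; first by left.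
        by right; exists j => //; exact: ltnW.
      by right; exists k.
    rewrite V1 VE; split; first by move=> [[h|h]|h]; [left|right; left|right; right].
    by move=> [h|[h|h]]; [left; left|left; right|right].
  have [ge|lt] := lerP e (m (G `|` D)).
    exists (option J), (fun o => if o is Some j then F j else G `|` D), set0.
    split => //; [by case|exact: pw_disjoint_option|by move=> j; rewrite setI0|].
    split; [|by case|by case|].
      move=> t; rewrite VE'; split.
        by move=> [[j Fj]|h]; left; [exists (Some j)|exists None].
      by move=> [[[j|] h]|//]; [left; exists j|right].
    by apply: (small _ set0) => //; rewrite measure0 lee_fin ltW.
  exists J, F, (G `|` D); split => //; split => //; exact: ltW.
have [J [F [G [mF dF mG FG [VE Fe F2e Ge]]]]] := H N (leqnn N).
have VA t : V N t <-> A t.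
  split=> [[]//|At]; split => //; have [ct|nct] := pselect (cell_rest t); first by left.
  by right; exact: (@cell_cover R N).
exists (option J), (fun o => if o is Some j then F j else G).
have AE t : A t <-> exists o : option J, (if o is Some j then F j else G) t.
  rewrite -VA VE; split; first by move=> [[j h]|h]; [exists (Some j)|exists None].
  by move=> [[j|] h]; [left; exists j|right].
have dO := pw_disjoint_option dF FG.
have mO (o : option J) : measurable (if o is Some j then F j else G) by case: o.
split => //; first by case => // ; apply: le_trans Ge _; lra.
have := Hc _ (fun=> 1) _ mO dO.
rewrite (step_cst_indic _ dO AE).
have E1 (B : set T) : (fun t => 1 * \1_B t) = \1_B :> (T -> R) by apply/funext => t; rewrite mul1r.
rewrite E1; apply: le_trans; rewrite card_option -natr1 addrK.
under [leRHS]eq_bigr do rewrite E1.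
rewrite (bigD1 None)//= (reindex_omap Some id)/=; last by case.
rewrite (eq_bigl xpredT); last by move=> j; rewrite eqxx.
apply: (@le_trans _ _ (\sum_(j : J) e ^+ 2)); first by rewrite sumr_const mulr_natl.
rewrite ler_wpDl ?sqr_ge0//; apply: ler_sum => j _.
by rewrite lerXn2r// nnegrE ?nrm_ge0 ?ltW.
Qed.

(** Each term is cut into pieces of norm at most [2 * e]; up to one, their number is at most
    [c / e ^+ 2] times the squared norm of the term. The flat estimate for all pieces together gives
    [4 * C ^+ 2 * (c * S + n * e ^+ 2)], and [e] is arbitrary. *)
Lemma upper_estimate : exists2 C : R, 0 < C & forall (I : finType) (a : I -> R) (A : I -> set T),
  (forall i, measurable (A i)) -> pw_disjoint A ->
  nrm K (step A a) ^+ 2 <= C * \sum_i nrm K (fun t => a i * \1_(A i) t) ^+ 2.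
Proof.
have [c c0 Hc] := lower_estimate K p2 hM; have [C C0 HC] := upper_flat K p2 hM.
exists (4 * C ^+ 2 * c); first by rewrite !mulr_gt0// exprn_gt0.
move=> I a A mA dA; set S := \sum_i _; pose n := #|I|%:R : R.
suff key (e : R) : 0 < e -> nrm K (step A a) ^+ 2 <= 4 * C ^+ 2 * (c * S + n * e).
  apply/ler_addgt0Pr => e e0.
  have h0 : 0 < 4 * C ^+ 2 * (n + 1).
    by rewrite !mulr_gt0 ?exprn_gt0 ?ltr0n// ltr_wpDl// ler0n.
  have := key _ (divr_gt0 e0 h0); set q := e / _ => h; apply: le_trans h _.
  have qE : 4 * C ^+ 2 * ((n + 1) * q) = e by rewrite mulrA /q mulrC divfK// gt_eqF.
  have q0 : 0 < q by exact: divr_gt0.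
  have : 4 * C ^+ 2 * (n * q) <= e.
    have : 0 <= C ^+ 2 * q by rewrite mulr_ge0 ?sqr_ge0// ltW.
    by move: qE; lra.
  by lra.
suff key : forall d : R, 0 < d -> nrm K (step A a) ^+ 2 <= 4 * C ^+ 2 * (c * S + n * d ^+ 2).
  by move=> e0; have := key (Num.sqrt e); rewrite sqrtr_gt0 sqr_sqrtr ?(ltW e0)//; exact.
move=> {}e e0.
have [J] : exists J : I -> finType, exists F : forall i, J i -> set T, forall i,
    [/\ forall j, measurable (F i j), pw_disjoint (F i),
    forall t, A i t <-> exists j, F i j t,
    forall j, nrm K (fun t => a i * \1_(F i j) t) <= 2 * e &
    (#|J i|%:R - 1) * e ^+ 2 <= c * nrm K (fun t => a i * \1_(A i) t) ^+ 2].
  suff /choice[f Hf] i : exists JF : {J : finType & J -> set T},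
      [/\ forall j, measurable (projT2 JF j), pw_disjoint (projT2 JF),
      forall t, A i t <-> exists j, projT2 JF j t,
      forall j, nrm K (fun t => a i * \1_(projT2 JF j) t) <= 2 * e &
      (#|projT1 JF|%:R - 1) * e ^+ 2 <= c * nrm K (fun t => a i * \1_(A i) t) ^+ 2].
    by exists (fun i => projT1 (f i)), (fun i => projT2 (f i)).
  (* The level [e / |a i|] makes sense only for a nonzero coefficient; for a zero one a single piece
     suffices. *)
  have [a0|a0] := eqVneq (a i) 0.
    exists (existT _ (unit : finType) (fun=> A i)) => /=; split => //.
    - by move=> t; split => [At|[]//]; exists tt.
    - by move=> _; rewrite nrm_term// a0 normr0 mul0r mulr_ge0// ltW.
    - by rewrite card_unit subrr mul0r mulr_ge0 ?sqr_ge0// ltW.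
  have na : 0 < `|a i| by rewrite normr_gt0.
  have [J [F [mF dF AF F2 cF]]] := split_indic (divr_gt0 e0 na) (mA i) Hc.
  exists (existT _ J F) => /=; split => //.
    move=> j; rewrite nrm_term//; have := ler_wpM2l (ltW na) (F2 j).
    by have := divfK (lt0r_neq0 na) e; nra.
  rewrite nrm_term//; have := ler_wpM2r (sqr_ge0 `|a i|) cF.
  have -> : e ^+ 2 = (e / `|a i|) ^+ 2 * `|a i| ^+ 2 by rewrite -exprMn divfK ?gt_eqF.
  by rewrite [X in _ -> _ <= _ * X]exprMn; set q := _ ^+ 2; lra.
move=> [F HF].
pose A' (u : {i : I & J i}) := F (tag u) (tagged u).
pose a' (u : {i : I & J i}) := a (tag u).
have mA' u : measurable (A' u) by have [h _ _ _ _] := HF (tag u); exact: h.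
have dA' : pw_disjoint A'.
  move=> [i j] [i' j']; rewrite /A' /=; have [ii'|ii'] := eqVneq i i'.
    subst i'; have [_ dF _ _ _] := HF i; move=> ne; apply: dF.
    by apply: contra ne => /eqP ->.
  move=> _; apply/seteqP; split => // t [h1 h2].
  have [_ _ AF _ _] := HF i; have [_ _ AF' _ _] := HF i'.
  have : (A i `&` A i') t by split; [apply/AF; exists j|apply/AF'; exists j'].
  by rewrite dA.
have stE : step A a = step A' a'.
  apply/funext => t; have [[i Ai]|nA] := pselect (exists i, A i t).
    have [_ _ AF _ _] := HF i; have /AF[j Fj] := Ai.
    by rewrite (step_in dA _ Ai) (@step_in _ _ A' dA' a' (Tagged J j)).
  rewrite !step_out// => [[i j] h|i Ai]; apply: nA; last by exists i.
  by have [_ _ AF _ _] := HF i; exists i; apply/AF; exists j.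
have e2 : 0 < 2 * e by rewrite mulr_gt0.
pose b u := (2 * e)^-1 * a' u.
have stb : step A' a' = (fun t => (2 * e) * step A' b t).
  apply/funext => t; rewrite /step mulr_sumr; apply: eq_bigr => u _.
  by rewrite /b !mulrA divff ?gt_eqF// mul1r.
have b1 u : nrm K (fun t => b u * \1_(A' u) t) <= 1.
  have [_ _ _ /(_ (tagged u)) h _] := HF (tag u).
  rewrite nrm_term// normrM -mulrA gtr0_norm ?invr_gt0// ler_pdivrMl// mulr1.
  by rewrite -(nrm_term K _ (mA' u)).
have hb := HC _ _ _ mA' dA' b1.
have gb : good K (step A' b) by exact: good_step.
rewrite stE stb nrmZ// gtr0_norm// exprMn.
have hb2 : nrm K (step A' b) ^+ 2 <= C ^+ 2 * #|{: {i : I & J i}}|%:R.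
  rewrite -[X in _ * X]sqr_sqrtr// -exprMn lerXn2r// nnegrE ?nrm_ge0//.
  by rewrite mulr_ge0 ?sqrtr_ge0// ltW.
have card : #|{: {i : I & J i}}|%:R = \sum_i #|J i|%:R :> R.
  by rewrite card_tagged sumnE big_map big_enum /= natr_sum.
have hS : (#|{: {i : I & J i}}|%:R - n) * e ^+ 2 <= c * S.
  rewrite card /n -[#|I|]sum1_card natr_sum -sumrB mulr_suml /S mulr_sumr.
  by apply: ler_sum => i _; have [_ _ _ _ h] := HF i.
rewrite card in hb2 hS *.
have := ler_wpM2l (sqr_ge0 (2 * e)) hb2.
have := ler_wpM2l (sqr_ge0 C) hS.
set x := \sum_i _; set y := nrm _ _; nra.
Qed.
End UpperEstimate.

Lemma finite_measure_of (R : realType) (v0 : {measure set (measurableTypeR R) -> \bar R}) :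
  fin_num_fun v0 ->
  exists v : {finite_measure set (measurableTypeR R) -> \bar R}, v = v0 :> (set _ -> \bar R).
Proof.
move=> hf.
have sf : sigma_finite setT v0.
  by apply: fin_num_fun_sigma_finite; [rewrite measure0|].
pose v : {finite_measure set (measurableTypeR R) -> \bar R} := HB.pack (Measure.sort v0) v0
  (isSFinite.Build _ _ R v0 (sfinite_measure_sigma_finite sf))
  (isSigmaFinite.Build _ _ R v0 sf) (isFinite.Build _ _ R v0 hf).
by exists v.
Qed.

(** * The equivalent measure *)

(* A set function satisfying finite lower and upper 1-estimates is equivalent
   to an additive one: first take the supremum over disjoint subfamilies, which
   is superadditive, then the infimum over finite partitions. *)
Section Additivization.
Context {R : realType}.
Local Notation T := (measurableTypeR R).
Variables (q : set T -> R) (c C : R).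
Hypothesis q0 : forall A, 0 <= q A.
Hypothesis c0 : 0 < c.
Hypothesis C0 : 0 < C.

Definition partition_of (J : finType) (F : J -> set T) (A : set T) :=
  [/\ forall j, measurable (F j), pw_disjoint F & forall t, A t <-> exists j, F j t].

Hypothesis q_lower : forall (J : finType) (F : J -> set T) A, partition_of F A ->
  \sum_j q (F j) <= c * q A.
Hypothesis q_upper : forall (J : finType) (F : J -> set T) A, partition_of F A ->
  q A <= C * \sum_j q (F j).

Lemma partition_single A : measurable A -> partition_of (fun _ : unit => A) A.
Proof.
move=> mA; split => //.
by move=> t; split=> [At|[]//]; exists tt.
Qed.

Definition sumfam (J J' : finType) (F : J -> set T) (F' : J' -> set T) (u : J + J') :=
  match u with inl j => F j | inr j => F' j end.

Lemma partition_sum (J J' : finType) (F : J -> set T) (F' : J' -> set T) A A' :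
  A `&` A' = set0 -> partition_of F A -> partition_of F' A' ->
  partition_of (sumfam F F') (A `|` A').
Proof.
move=> AA [mF dF AF] [mF' dF' AF']; split; first by case.
  have dFF j j' : F j `&` F' j' = set0.
    apply/seteqP; split => // t [Fj Fj'].
    have : (A `&` A') t by split; [apply/AF; exists j|apply/AF'; exists j'].
    by rewrite AA.
  move=> [j|j] [j'|j']//= ne; [exact: dF|by rewrite setIC|exact: dF'].
move=> t; split.
  by move=> [/AF[j h]|/AF'[j h]]; [exists (inl j)|exists (inr j)].
by move=> [[j|j] h]; [left; apply/AF; exists j|right; apply/AF'; exists j].
Qed.

Lemma sum_sumfam (J J' : finType) (F : J -> set T) (F' : J' -> set T) (f : set T -> R) :
  \sum_u f (sumfam F F' u) = \sum_j f (F j) + \sum_j f (F' j).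
Proof. by rewrite big_sumType. Qed.

Lemma partition_setI (J : finType) (F : J -> set T) A B : measurable B ->
  partition_of F A -> B `<=` A -> partition_of (fun j => F j `&` B) B.
Proof.
move=> mB [mF dF AF] BA; split=> [j| |t].
- exact: measurableI.
- exact: pw_disjoint_setI.
- split; last by move=> [j []].
  by move=> Bt; have /BA/AF[j Fj] := Bt; exists j.
Qed.

Definition packing_sums A : set R := [set s | exists (J : finType) (F : J -> set T),
  partition_of F A /\ s = \sum_j q (F j)].

Definition packing A : R := sup (packing_sums A).

Lemma packing_ge (J : finType) (F : J -> set T) A : partition_of F A ->
  \sum_j q (F j) <= packing A.
Proof.
move=> FA; apply: ub_le_sup; last by exists J, F.
by exists (c * q A) => s [J' [F' [pF' ->]]]; exact: q_lower.
Qed.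

Lemma packing_le A s : measurable A -> ubound (packing_sums A) s -> packing A <= s.
Proof.
move=> mA us; apply: ge_sup => //.
by eexists; exists unit, (fun=> A); split; [exact: partition_single|reflexivity].
Qed.

Lemma q_le_packing A : measurable A -> q A <= packing A.
Proof.
by move=> mA; have := packing_ge (partition_single mA); rewrite big_const card_unit /= addr0.
Qed.

Lemma packing_ge0 A : measurable A -> 0 <= packing A.
Proof. by move=> /q_le_packing; exact: le_trans. Qed.

Lemma packing_le_q A : measurable A -> packing A <= c * q A.
Proof. by move=> mA; apply: packing_le => // s [J [F [pF ->]]]; exact: q_lower. Qed.

Lemma packing_super A B : measurable A -> measurable B -> A `&` B = set0 ->
  packing A + packing B <= packing (A `|` B).
Proof.
move=> mA mB AB; rewrite -lerBrDr; apply: packing_le => // s [J [F [pF ->]]].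
rewrite lerBrDr addrC -lerBrDr; apply: packing_le => // r [J' [F' [pF' ->]]].
rewrite lerBrDr addrC -sum_sumfam; apply: packing_ge; exact: partition_sum.
Qed.

Definition partition_sums A : set R := [set s | exists (J : finType) (F : J -> set T),
  partition_of F A /\ s = \sum_j packing (F j)].

Definition additivization A : R := inf (partition_sums A).

Local Notation nu := additivization.

Lemma additivization_le (J : finType) (F : J -> set T) A : partition_of F A ->
  nu A <= \sum_j packing (F j).
Proof.
move=> FA; apply: ge_inf; last by exists J, F.
exists 0 => s [J' [F' [[mF _ _] ->]]]; apply: sumr_ge0 => j _; exact: packing_ge0.
Qed.

Lemma additivization_ge A s : measurable A -> lbound (partition_sums A) s -> s <= nu A.
Proof.
move=> mA us; apply: lb_le_inf => //.
by eexists; exists unit, (fun=> A); split; [exact: partition_single|reflexivity].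
Qed.

Lemma additivization_ge0 A : 0 <= nu A.
Proof.
(* A set that is not measurable may have no partition; the infimum of the empty set is then 0. *)
have [ne|/nonemptyPn e] := pselect (partition_sums A !=set0); last by rewrite /nu e inf0.
apply: lb_le_inf => // s [J' [F' [[mF _ _] ->]]]; apply: sumr_ge0 => j _; exact: packing_ge0.
Qed.

Lemma additivization_le_q A : measurable A -> nu A <= c * q A.
Proof.
move=> mA; have := additivization_le (partition_single mA).
by rewrite big_const card_unit /= addr0 => /le_trans; apply; exact: packing_le_q.
Qed.

Lemma q_le_additivization A : measurable A -> q A <= C * nu A.
Proof.
move=> mA; rewrite mulrC -ler_pdivrMr//; apply: additivization_ge => // s [J [F [pF ->]]].
rewrite ler_pdivrMr// mulrC; apply: le_trans (q_upper pF) _; rewrite ler_pM2l//.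
by apply: ler_sum => j _; apply: q_le_packing; case: pF.
Qed.

(** In one direction partitions of the two sets combine. In the other, a partition of the union is
    cut along [A] and [B], and [packing] is superadditive on each piece. *)
Lemma additivizationD A B : measurable A -> measurable B -> A `&` B = set0 ->
  nu (A `|` B) = nu A + nu B.
Proof.
move=> mA mB AB; have mAB := measurableU _ _ mA mB; apply/le_anti/andP; split.
  rewrite -lerBlDr; apply: additivization_ge => // s [J [F [pF ->]]].
  rewrite lerBlDr addrC -lerBlDr; apply: additivization_ge => // r [J' [F' [pF' ->]]].
  rewrite lerBlDr addrC -sum_sumfam; apply: additivization_le; exact: partition_sum.
apply: additivization_ge => // s [J [F [pF ->]]].
have pA := partition_setI mA pF (@subsetUl _ _ _).
have pB := partition_setI mB pF (@subsetUr _ _ _).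
apply: le_trans (lerD (additivization_le pA) (additivization_le pB)) _.
rewrite -big_split; apply: ler_sum => j _ /=.
have [mF _ FE] := pF; have FjE : F j = (F j `&` A) `|` (F j `&` B).
  by rewrite -setIUr; apply/esym/setIidPl => t Fj; apply/FE; exists j.
rewrite [leRHS](_ : _ = packing ((F j `&` A) `|` (F j `&` B))); last by rewrite -FjE.
apply: packing_super; [exact: measurableI|exact: measurableI|].
by rewrite setIACA AB setI0.
Qed.

Lemma additivization0 : nu set0 = 0.
Proof.
have := additivizationD measurable0 measurable0 (setI0 set0); rewrite setU0 => h.
by apply: (@addrI _ (nu set0)); rewrite addr0 -h.
Qed.

Variable mu : {finite_measure set T -> \bar R}.
Hypothesis q_cont : forall e, 0 < e -> exists2 d : R, 0 < d &
  forall A, measurable A -> (mu A <= d%:E)%E -> q A <= e.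

(** By finite additivity the error is the value on the rest of the union, at most [c * q] of it;
    [mu] of this rest tends to 0, and [q_cont] concludes. *)
Lemma additivization_sigma : semi_sigma_additive (fun A => (nu A)%:E).
Proof.
move=> F mF tF mUF.
pose U n := \big[setU/set0]_(i < n) F i.
have mU n : measurable (U n) by apply: bigsetU_measurable.
have UE n : \sum_(0 <= i < n) nu (F i) = nu (U n).
  elim: n => [|n IH]; first by rewrite big_nil /U big_ord0 additivization0.
  rewrite big_nat_recr//= IH /U big_ord_recr additivizationD//; first exact: mU.
  apply/seteqP; split => // t []; rewrite /U -bigcup_mkord => -[i /= lin Fi] Fn.
  have := @trivIsetP _ _ setT F; move=> [/(_ tF)] h _.
  have : (F i `&` F n) t by [].
  by rewrite h// ltn_eqF.
rewrite (_ : (fun n => _) = (fun n => (nu (U n))%:E)); last first.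
  by apply/funext => n; rewrite sumEFin UE.
have UV : \bigcup_n U n = \bigcup_n F n.
  apply/seteqP; split => t [n _].
    by rewrite /U -bigcup_mkord => -[i _ Fi]; exists i.
  by move=> Fn; exists n.+1 => //; rewrite /U big_ord_recr; right.
have ndU : nondecreasing_seq U.
  move=> i j ij; apply/subsetPset => t; rewrite /U -!bigcup_mkord => -[k /= ki Fk].
  by exists k => //=; exact: leq_trans ij.
have cmu : mu (U n) @[n --> \oo] --> mu (\bigcup_n F n).
  by rewrite -UV; apply: nondecreasing_cvg_mu => //; rewrite UV.
have fin A : measurable A -> mu A \is a fin_num by move=> mA; exact: fin_num_measure.
have sub n : U n `<=` \bigcup_n F n by rewrite -UV => t Ut; exists n.
apply: cvg_EFin; first exact: nearW.
apply/cvgrPdist_le => e e0 /=.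
have [d d0 Hd] := q_cont (divr_gt0 e0 c0).
have /fine_cvgP[_ /cvgrPdist_le/(_ _ d0) h] : mu (U n) @[n --> \oo] --> (fine (mu (\bigcup_n F n)))%:E.
  by rewrite fineK//; exact: fin.
near=> n; have /= hn := near h n.
have mD : measurable (\bigcup_n F n `\` U n) by exact: measurableD.
have muD : mu (\bigcup_n F n `\` U n) = (mu (\bigcup_n F n) - mu (U n))%E.
  by rewrite measureD//= ?setIidr// -ge0_fin_numE ?fin.
have -> : nu (\bigcup_n F n) = nu (U n) + nu (\bigcup_n F n `\` U n).
  by rewrite -additivizationD ?setDIK// setDUK.
rewrite addrC addKr ger0_norm ?additivization_ge0//.
apply: le_trans (additivization_le_q mD) _.
rewrite mulrC -ler_pdivlMr//; apply: Hd => //.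
rewrite muD -(fineK (fin _ mUF)) -(fineK (fin _ (mU n))) -EFinB lee_fin.
apply: le_trans (ler_norm _) _; exact: hn.
Unshelve. all: by end_near. Qed.

Lemma equivalent_measure : exists v : {finite_measure set T -> \bar R},
  forall A, measurable A -> ((q A)%:E <= C%:E * v A)%E /\ (v A <= (c * q A)%:E)%E.
Proof.
have h0 : (nu set0)%:E = 0%E by rewrite additivization0.
have hp A : (0 <= (nu A)%:E)%E by rewrite lee_fin additivization_ge0.
pose v0 : {measure set T -> \bar R} := HB.pack (fun A => (nu A)%:E)
  (isMeasure.Build _ T R (fun A => (nu A)%:E) h0 hp additivization_sigma).
have [|v vE] := @finite_measure_of _ v0; first by move=> A mA.
exists v => A mA; rewrite vE -EFinM !lee_fin; split.
  exact: q_le_additivization.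
exact: additivization_le_q.
Qed.
End Additivization.

(** * The density of a measure equivalent to the squared indicator norm *)

Section Density.
Context {R : realType} {X : completeNormedModType R} (K : kothe_space X).
Local Notation mu := (leb01 R).
Local Notation T := (measurableTypeR R).
Variable p : R.
Hypothesis p2 : 2 < p.
Hypothesis hM : has_M X p.
Local Notation m A := (nrm K \1_A).

Lemma fin_num_leb01 : fin_num_fun mu.
Proof.
move=> A mA; rewrite ge0_fin_numE//; apply: (@le_lt_trans _ _ 1%E); last exact: ltry.
apply: (@le_trans _ _ (lebesgue_measure `[(0 : R), 1])).
  by rewrite /leb01 /= /mrestr; apply: le_measure; rewrite ?inE//; exact: measurableI.
by rewrite lebesgue_measure_itv /= lte_fin ltr01 oppr0 adde0.
Qed.

(** Both 2-estimates with all coefficients equal to 1 are the hypotheses of the additivization of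
    [m ^+ 2], and absolute continuity of the norm provides [q_cont]. The measure obtained vanishes
    on null sets, so Radon-Nikodym applies. *)
Lemma density : exists w : T -> R, exists c C : R,
  [/\ 0 < c, 0 < C, measurable_fun setT w, forall t, 0 <= w t &
  forall A, measurable A ->
    ((m A ^+ 2)%:E <= C%:E * \int[mu]_(t in A) (w t)%:E)%E /\
    (\int[mu]_(t in A) (w t)%:E <= (c * m A ^+ 2)%:E)%E].
Proof.
have [c c0 Hc] := lower_estimate K p2 hM; have [C C0 HC] := upper_estimate K p2 hM.
have stE (J : finType) (F : J -> set T) A : partition_of F A ->
    nrm K (step F (fun=> 1)) = m A /\
    \sum_j nrm K (fun t => 1 * \1_(F j) t) ^+ 2 = \sum_j m (F j) ^+ 2.
  move=> [mF dF AF]; rewrite (step_cst_indic 1 dF AF).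
  have E (B : set T) : (fun t => 1 * \1_B t) = \1_B :> (T -> R) by apply/funext => t; rewrite mul1r.
  by rewrite E; split => //; apply: eq_bigr => j _; rewrite E.
have [mu' muE] := finite_measure_of fin_num_leb01.
have [||||v Hv] := @equivalent_measure R (fun A => m A ^+ 2) c C _ c0 C0 _ _ mu'.
- by move=> A; exact: sqr_ge0.
- by move=> J F A pF; have [<- <-] := stE _ _ _ pF; case: pF => mF dF _; exact: Hc.
- by move=> J F A pF; have [<- <-] := stE _ _ _ pF; case: pF => mF dF _; exact: HC.
- move=> e e0; have se : 0 < Num.sqrt e by rewrite sqrtr_gt0.
  have [d d0 Hd] := abs_cont K p2 hM se; exists d => // A mA; rewrite muE => /(Hd _ mA) h.
  by rewrite -[e]sqr_sqrtr ?(ltW e0)// lerXn2r ?nnegrE ?nrm_ge0 ?sqrtr_ge0.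
have dom : v `<< mu'.
  apply/null_content_dominatesP => A mA A0.
  apply/eqP; rewrite eq_le measure_ge0 andbT; apply: le_trans (Hv A mA).2 _.
  rewrite lee_fin; suff -> : m A = 0 by rewrite expr0n mulr0.
  apply/le_anti; rewrite nrm_ge0 andbT; apply/ler_addgt0Pr => e e0; rewrite add0r.
  have [d d0 Hd] := abs_cont K p2 hM e0; apply: Hd => //.
  by rewrite -muE A0 lee_fin ltW.
have [f [f0 ffin intf fE]] := radon_nikodym_sigma_finite dom.
have fw t : (fine (f t))%:E = f t by rewrite fineK.
exists (fun t => fine (f t)), c, C; split => //.
- apply/measurable_EFinP; rewrite (_ : _ \o _ = f); last by apply/funext => t /=.
  by case/integrableP : intf.
- by move=> t; rewrite -lee_fin fw.
move=> A mA; have -> : (\int[mu]_(t in A) (fine (f t))%:E = v A)%E.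
  rewrite fE// [RHS](eq_measure_integral mu) => [|B mB _]; last by rewrite -muE.
  by apply: eq_integral => t _; rewrite fw.
exact: Hv.
Qed.
End Density.

(** * The weighted L_2-norm *)

Section SimpleFunctions.
Import HBNNSimple.
Context {R : realType}.
Local Notation mu := (leb01 R).
Local Notation T := (measurableTypeR R).

Lemma simple_approx (f : T -> R) : measurable_fun setT f -> (forall t, 0 <= f t) ->
  exists g : nat -> T -> R, [/\ forall n, measurable_fun setT (g n),
    forall n t, 0 <= g n t, forall n, finite_set (range (g n)),
    forall i j t, (i <= j)%N -> g i t <= g j t & forall t, g n t @[n --> \oo] --> f t].
Proof.
move=> mf f0; have mEf : measurable_fun setT (EFin \o f) by apply/measurable_EFinP.
have [g [nd cv]] := @approximation _ _ _ _ measurableT _ mEf (fun t _ => f0 t).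
exists (fun n => g n : T -> R); split => //.
- by move=> i j t ij; have /lefP := nd _ _ ij; exact.
- by move=> t; exact: (fine_cvg (cv t I)).
Qed.

Lemma simple_step (f : T -> R) : measurable_fun setT f -> finite_set (range f) ->
  exists (I : finType) (a : I -> R) (A : I -> set T),
    [/\ forall i, measurable (A i), pw_disjoint A & f = step A a].
Proof.
move=> mf /finite_seqP[s sE].
exists (seq_sub s), (fun i => ssval i), (fun i => f @^-1` [set ssval i]).
have dA : pw_disjoint (fun i : seq_sub s => f @^-1` [set ssval i]).
  move=> i j ij; apply/seteqP; split => // t /= [fi fj].
  by case/eqP : ij; apply: val_inj; rewrite /= -fi -fj.
split => //.
  by move=> i; rewrite -[X in measurable X]setTI; exact: mf.
apply/funext => t; have ft : f t \in s.
  by have : range f (f t) by [exists t]; rewrite sE.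
by rewrite (@step_in _ _ _ dA _ (SeqSub ft)).
Qed.

Variable w : T -> R.
Hypothesis mw : measurable_fun setT w.
Hypothesis w0 : forall t, 0 <= w t.

(** The squared weighted [L_2] norm, extended-valued because it is also used before [f] is known to
    belong to [X]. *)
Definition wint (f : T -> R) : \bar R := (\int[mu]_t (f t ^+ 2 * w t)%:E)%E.

Lemma measurable_wint (f : T -> R) : measurable_fun setT f ->
  measurable_fun setT (fun t => (f t ^+ 2 * w t)%:E).
Proof.
move=> mf; apply/measurable_EFinP; apply: measurable_funM => //.
exact: measurable_funX.
Qed.

Lemma wint_ge0 (f : T -> R) : (0 <= wint f)%E.
Proof. by apply: integral_ge0 => t _; rewrite lee_fin mulr_ge0 ?sqr_ge0. Qed.

Lemma wint_le (f g : T -> R) : measurable_fun setT f -> measurable_fun setT g ->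
  (\forall t \ae mu, `|f t| <= `|g t|) -> (wint f <= wint g)%E.
Proof.
move=> mf mg fg; apply: ae_ge0_le_integral => //; try exact: measurable_wint.
- by move=> t _; rewrite lee_fin mulr_ge0 ?sqr_ge0.
- by move=> t _; rewrite lee_fin mulr_ge0 ?sqr_ge0.
apply: filterS fg => t fg _.
by rewrite lee_fin ler_wpM2r// -real_normK ?num_real// -[leRHS]real_normK ?num_real// lerXn2r ?nnegrE.
Qed.

Lemma wint_step (I : finType) (a : I -> R) (A : I -> set T) :
  (forall i, measurable (A i)) -> pw_disjoint A ->
  wint (step A a) = (\sum_i (a i ^+ 2)%:E * \int[mu]_(t in A i) (w t)%:E)%E.
Proof.
move=> mA dA.
have mAw i : measurable_fun setT (fun t => (\1_(A i) t * w t)%:E).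
  by apply/measurable_EFinP; apply: measurable_funM.
have Aw0 i t : (0 <= (\1_(A i) t * w t)%:E)%E by rewrite lee_fin mulr_ge0.
transitivity (\int[mu]_t \sum_i ((a i ^+ 2)%:E * (\1_(A i) t * w t)%:E))%E.
  apply: eq_integral => t _; under [RHS]eq_bigr do rewrite -EFinM.
  rewrite sumEFin; congr EFin.
  have [[i Ai]|/forallNP nA] := pselect (exists i, A i t).
    rewrite (step_in dA _ Ai) (bigD1 i)//= indicE mem_set// mul1r big1 ?addr0// => j ji.
    rewrite indicE memNset ?mul0r ?mulr0// => Aj.
    by have : (A j `&` A i) t by []; rewrite dA.
  rewrite step_out// expr0n /= mul0r big1// => i _.
  by rewrite indicE memNset ?mul0r ?mulr0.
rewrite ge0_integral_sum//; first last.
- by move=> i t _; rewrite mule_ge0// lee_fin sqr_ge0.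
- by move=> i; apply: measurable_funeM.
apply: eq_bigr => i _; rewrite ge0_integralZl_EFin ?sqr_ge0//; congr (_ * _)%E.
rewrite [RHS]integral_mkcond; apply: eq_integral => t _.
by rewrite patchE indicE; case: ifPn; rewrite ?mul1r ?mul0r.
Qed.

Lemma wint_monotone (g : nat -> T -> R) (f : T -> R) :
  (forall n, measurable_fun setT (g n)) -> (forall n t, 0 <= g n t) ->
  (forall i j t, (i <= j)%N -> g i t <= g j t) ->
  (forall t, g n t @[n --> \oo] --> f t) ->
  wint (g n) @[n --> \oo] --> wint f.
Proof.
move=> mg g0 nd cv.
have := @cvg_monotone_convergence _ _ _ mu setT measurableT
  (fun n t => (g n t ^+ 2 * w t)%:E) (fun n => measurable_wint (mg n)).
have -> : wint f = (\int[mu]_t limn (fun n => (g n t ^+ 2 * w t)%:E))%E.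
  apply: eq_integral => t _; apply/esym/cvg_lim => //.
  apply: cvg_EFin; first exact: nearW.
  by apply: cvgMl; exact: (cvgM (cv t) (cv t)).
apply => [n t _|t _ i j ij].
  by rewrite lee_fin mulr_ge0 ?sqr_ge0.
by rewrite lee_fin ler_wpM2r// lerXn2r ?nnegrE// nd.
Qed.

Lemma wint_diff_cvg0 (g : nat -> T -> R) (f : T -> R) :
  measurable_fun setT f ->
  (forall n, measurable_fun setT (g n)) -> (forall n t, 0 <= g n t <= f t) ->
  (forall t, g n t @[n --> \oo] --> f t) -> (wint f < +oo)%E ->
  wint (fun t => f t - g n t) @[n --> \oo] --> (0 : \bar R).
Proof.
move=> mf mg g0 cv fin.
have mfg n : measurable_fun setT (fun t => f t - g n t) by exact: measurable_funB.
have [|||_ _] := @dominated_convergence _ _ _ mu setT measurableT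
  (fun n t => ((f t - g n t) ^+ 2 * w t)%:E) (fun=> 0%E) (fun t => (f t ^+ 2 * w t)%:E)
  (fun n => measurable_wint (mfg n)) (measurable_cst _).
- apply: aeW => t _; apply: cvg_EFin; first exact: nearW.
  rewrite -[X in _ --> X](mul0r (w t)); apply: cvgMl.
  have h : f t - g n t @[n --> \oo] --> (0 : R).
    by rewrite -(subrr (f t)); apply: cvgB => //; exact: cvg_cst.
  by rewrite -[X in _ --> X](mul0r 0); exact: (cvgM h h).
- apply/integrableP; split; first exact: measurable_wint.
  apply: le_lt_trans fin; apply: le_of_eq.
  by apply: eq_integral => t _; rewrite gee0_abs// lee_fin mulr_ge0 ?sqr_ge0.
- apply: aeW => t n _; have /andP[h1 h2] := g0 n t.
  rewrite gee0_abs ?lee_fin; last exact: mulr_ge0 (sqr_ge0 _) (w0 t).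
  have h3 : 0 <= f t - g n t by rewrite subr_ge0.
  have h4 : f t - g n t <= f t by rewrite lerBlDr lerDl.
  by rewrite ler_wpM2r// lerXn2r ?nnegrE// (le_trans h3).
- by rewrite integral0.
Qed.
End SimpleFunctions.

(** * Equivalence of the norm with the weighted L_2 norm *)

Section WeightedNorm.
Context {R : realType} {X : completeNormedModType R} (K : kothe_space X).
Local Notation mu := (leb01 R).
Local Notation T := (measurableTypeR R).
Variable p : R.
Hypothesis p2 : 2 < p.
Hypothesis hM : has_M X p.

Lemma simple_good (f : T -> R) : measurable_fun setT f -> finite_set (range f) -> good K f.
Proof.
move=> mf ff; have [I [a [A [mA dA ->]]]] := simple_step mf ff.
exact: good_step.
Qed.

(** Over a disjoint family the squared norm splits up to constants by the 2-estimates and the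
    integral splits exactly; the single terms are compared by [density]. *)
Lemma weight_simple : exists w : T -> R, exists c C : R,
  [/\ 0 < c, 0 < C, measurable_fun setT w, forall t, 0 <= w t &
  forall f, measurable_fun setT f -> finite_set (range f) ->
    (wint w f <= (c * nrm K f ^+ 2)%:E)%E /\ ((nrm K f ^+ 2)%:E <= C%:E * wint w f)%E].
Proof.
have [w [c [C [c0 C0 mw w0 Hw]]]] := density K p2 hM.
have [c' c'0 Hc] := lower_estimate K p2 hM; have [C' C'0 HC] := upper_estimate K p2 hM.
exists w, (c * c'), (C' * C); split; rewrite ?mulr_gt0// => f mf ff.
have [I [a [A [mA dA ->]]]] := simple_step mf ff.
rewrite wint_step//; split.
  apply: (@le_trans _ _ (\sum_i (c * nrm K (fun t => a i * \1_(A i) t) ^+ 2)%:E)%E).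
    apply: lee_sum => i _; rewrite nrm_term// exprMn real_normK ?num_real//.
    rewrite mulrCA [X in (_ <= X)%E]EFinM; apply: lee_wpmul2l; first by rewrite lee_fin sqr_ge0.
    by have [_] := Hw _ (mA i).
  by rewrite sumEFin lee_fin -mulr_sumr -mulrA ler_pM2l// Hc.
apply: (@le_trans _ _ (C' * \sum_i nrm K (fun t => a i * \1_(A i) t) ^+ 2)%:E).
  by rewrite lee_fin HC.
rewrite EFinM EFinM -muleA; apply: lee_wpmul2l; first by rewrite lee_fin ltW.
rewrite -sumEFin ge0_sume_distrr; last first.
  by move=> i _; rewrite mule_ge0 ?lee_fin ?sqr_ge0// integral_ge0// => t _; rewrite lee_fin.
apply: lee_sum => i _; rewrite nrm_term// exprMn real_normK ?num_real//.
rewrite muleCA [X in (X <= _)%E]EFinM; apply: lee_wpmul2l; first by rewrite lee_fin sqr_ge0.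
by have [] := Hw _ (mA i).
Qed.

(** The first bound passes from simple functions to [X] by monotone convergence. Conversely, when
    [wint w f] is finite, increasing simple functions converge to [f >= 0] in the weighted norm, so
    they are Cauchy in [X], and their limit there is represented by [f]. *)
Lemma weight : exists w : T -> R, exists c C : R,
  [/\ 0 < c, 0 < C, measurable_fun setT w, forall t, 0 <= w t &
  (forall x, (wint w (K x) <= (c * `|x| ^+ 2)%:E)%E) /\
  forall f, measurable_fun setT f -> (wint w f < +oo)%E -> exists x,
    rep K f x /\ ((`|x| ^+ 2)%:E <= C%:E * wint w f)%E].
Proof.
have [w [c [C [c0 C0 mw w0 Hw]]]] := weight_simple.
exists w, c, C; split => //; split.
  move=> x; have mx : measurable_fun setT (fun t => `|K x t|).
    by apply: measurableT_comp => //; exact: measurable_frepr.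
  have [g [mg g0 fg nd cv]] := simple_approx mx (fun t => normr_ge0 _).
  have gle n t : g n t <= `|K x t|.
    have /cvg_lim <- // := cv t.
    apply: nondecreasing_cvgn_le; last by apply/cvg_ex; eexists; exact: cv.
    by move=> i j; exact: nd.
  have -> : wint w (K x) = wint w (fun t => `|K x t|).
    by apply: eq_integral => t _; rewrite real_normK ?num_real.
  have /cvg_lim <- // := wint_monotone mw w0 mg g0 nd cv.
  apply: lime_le; first by apply/cvg_ex; eexists; exact: (wint_monotone mw w0 mg g0 nd cv).
  apply: nearW => n; have [h _] := Hw _ (mg n) (fg n); apply: le_trans h _.
  rewrite lee_fin ler_pM2l// lerXn2r ?nnegrE ?nrm_ge0//.
  rewrite -(nrmE (rep_refl K x)); apply: nrm_leW; [exact: simple_good|exact: good_frepr|].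
  by move=> t; rewrite ger0_norm.
suff pos (f : T -> R) : measurable_fun setT f -> (forall t, 0 <= f t) -> (wint w f < +oo)%E -> exists x,
    rep K f x /\ ((`|x| ^+ 2)%:E <= C%:E * wint w f)%E.
  move=> f mf fin; have maf : measurable_fun setT (fun t => `|f t|) by exact: measurableT_comp.
  have E : wint w (fun t => `|f t|) = wint w f.
    by apply: eq_integral => t _; rewrite real_normK ?num_real.
  have [|x [fx xle]] := pos _ maf (fun t => normr_ge0 _); first by rewrite E.
  have [|y fy yx] := rep_dominated mf fx.
    by apply: aeW => t; rewrite normr_id.
  exists y; split => //; rewrite -E; apply: le_trans xle.
  by rewrite lee_fin lerXn2r ?nnegrE.
move=> mf f0 fin; have [g [mg g0 fg nd cv]] := simple_approx mf f0.
have gle n t : g n t <= f t.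
  have /cvg_lim <- // := cv t.
  apply: nondecreasing_cvgn_le; last by apply/cvg_ex; eexists; exact: cv.
  by move=> i j; exact: nd.
have gg n : good K (g n) by exact: simple_good.
pose z n := el K (g n).
have zr n : rep K (g n) (z n) by exact: elP.
have mfg n : measurable_fun setT (fun t => f t - g n t) by exact: measurable_funB.
have cauchy : cauchy_seq z.
  move=> e e0; have g0f n t : 0 <= g n t <= f t by rewrite g0 gle.
  have d0 : 0 < e ^+ 2 / C by rewrite divr_gt0// exprn_gt0.
  have [N HN] : exists N, forall n, (N <= n)%N ->
      (wint w (fun t => (f t - g n t)%R) <= (e ^+ 2 / C)%:E)%E.
    have /fine_cvgP[h1 /cvgrPdist_le/(_ _ d0) h2] := wint_diff_cvg0 mw w0 mf mg g0f cv fin.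
    have [N _ HN] := filterI h1 h2; exists N => n Nn; have [/= f1 f2] := HN n Nn.
    rewrite -(fineK f1) lee_fin; apply: le_trans f2.
    by rewrite sub0r normrN; exact: ler_norm.
  have key i j : (N <= i)%N -> (i <= j)%N -> `|z j - z i| <= e.
    move=> Ni ij; have gij t : 0 <= g j t - g i t by rewrite subr_ge0 nd.
    have mgij : measurable_fun setT (fun t => g j t - g i t) by exact: measurable_funB.
    have fgij : finite_set (range (fun t => g j t - g i t)).
      apply: sub_finite_set (finite_image2 (fun x y => x - y) (fg j) (fg i)).
      by move=> _ [t _ <-]; exists (g j t); [exists t|exists (g i t); [exists t|]].
    have [_ h] := Hw _ mgij fgij.
    rewrite -(@ler_pXn2r _ 2)// ?nnegrE ?(ltW e0)//.
    rewrite -(nrmE (repB (zr j) (zr i))) -lee_fin; apply: le_trans h _.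
    apply: (@le_trans _ _ (C%:E * (e ^+ 2 / C)%:E)%E); last first.
      by rewrite -EFinM lee_fin mulrC divfK// gt_eqF.
    apply: lee_wpmul2l; first by rewrite lee_fin ltW.
    apply: le_trans (HN i Ni); apply: wint_le => //; apply: aeW => t.
    by rewrite (ger0_norm (gij t)) ger0_norm ?subr_ge0// lerD2r.
  exists N => i j Ni Nj; have [ij|/ltnW ji] := leqP i j.
    by rewrite distrC key.
  by rewrite key.
have [x zx] := cauchy_seq_limit cauchy.
have geg k : \forall t \ae mu, g k t <= K x t.
  have : \forall t \ae mu, 0 <= K (x - z k) t.
    apply: cone_closed => e e0; have [N HN] := zx e e0.
    exists (z (maxn N k) - z k); split; last first.
      by rewrite opprB addrA subrK; apply: HN; exact: leq_maxl.
    apply: filterS (repB (zr (maxn N k)) (zr k)) => t ->.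
    by rewrite subr_ge0 nd// leq_maxr.
  apply: filterS2 (repB (rep_refl K x) (zr k)) => t ->.
  by rewrite subr_ge0.
have gef : \forall t \ae mu, f t <= K x t.
  have := ae_foralln geg; apply: filterS => t h.
  have /cvg_lim <- // := cv t.
  by apply: limr_le; [apply/cvg_ex; eexists; exact: cv|exact: nearW].
(* Since [g n <= f <= K x] almost everywhere, the simple functions are at least as close to [f] as
   to their limit [x]. *)
have fx : rep K f x.
  have [|y fy _] := rep_dominated mf (rep_refl K x).
    by apply: filterS gef => t h; rewrite ger0_norm// ler_normr h.
  suff -> : x = y by [].
  apply: (limit_seq_uniq zx) => e e0; have [N HN] := zx e e0; exists N => n Nn.
  apply: le_trans (HN n Nn); apply: (rep_norm_le (repB (zr n) fy) (repB (zr n) (rep_refl K x))).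
  apply: filterS gef => t h; have h1 := gle n t.
  rewrite ler0_norm ?subr_le0// ler0_norm ?subr_le0 ?(le_trans h1)//.
  by rewrite !opprB lerB.
exists x; split => //.
have wfin : wint w f \is a fin_num by rewrite ge0_fin_numE// wint_ge0.
rewrite -(fineK wfin) -EFinM lee_fin; set F := fine _.
have F0 : 0 <= F by rewrite fine_ge0// wint_ge0.
rewrite -[leRHS]sqr_sqrtr ?mulr_ge0 ?(ltW C0)// lerXn2r ?nnegrE ?sqrtr_ge0//.
apply: (limit_seq_norm_le zx) => N; exists N => //.
rewrite -(nrmE (zr N)) -(@ler_pXn2r _ 2)// ?nnegrE ?nrm_ge0 ?sqrtr_ge0//.
rewrite sqr_sqrtr ?mulr_ge0 ?(ltW C0)// -lee_fin [X in (_ <= X)%E]EFinM /F fineK//.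
have [_ h] := Hw _ (mg N) (fg N); apply: le_trans h _.
apply: lee_wpmul2l; first by rewrite lee_fin ltW.
apply: wint_le => //; apply: aeW => t; rewrite ger0_norm// ger0_norm//.
Qed.
End WeightedNorm.

(** * The isomorphism onto L_2 *)

Section Isomorphism.
Context {R : realType}.
Local Notation mu := (leb01 R).
Local Notation T := (measurableTypeR R).

Lemma Lnorm2E (f : T -> R) :
  ('N[mu]_2%:E[EFin \o f] = (\int[mu]_t (f t ^+ 2)%:E) `^ 2^-1)%E.
Proof.
rewrite unlock; congr (_ `^ _)%E; apply: eq_integral => t _ /=.
by rewrite powR_mulrn// real_normK ?num_real.
Qed.

Lemma int_sqr_ge0 (f : T -> R) : (0 <= \int[mu]_t (f t ^+ 2)%:E)%E.
Proof. by apply: integral_ge0 => t _; rewrite lee_fin sqr_ge0. Qed.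

Lemma Lnorm2_sqr (f : T -> R) :
  ('N[mu]_2%:E[EFin \o f] `^ 2 = \int[mu]_t (f t ^+ 2)%:E)%E.
Proof. by rewrite Lnorm2E -poweRrM mulVf// poweRe1// int_sqr_ge0. Qed.

Lemma Lnorm2_le (f : T -> R) (c : R) : 0 <= c ->
  (('N[mu]_2%:E[EFin \o f] <= c%:E) = (\int[mu]_t (f t ^+ 2)%:E <= (c ^+ 2)%:E))%E.
Proof.
move=> c0; have cE : (c ^+ 2)%:E = (c%:E `^ 2)%E by rewrite poweR_EFin powR_mulrn.
have N0 : (0 <= 'N[mu]_2%:E[EFin \o f])%E by exact: Lnorm_ge0.
apply/idP/idP => h.
  rewrite -Lnorm2_sqr cE; apply: gt0_ler_poweR => //;
    by rewrite in_itv /= ?leey ?andbT ?lee_fin.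
have -> : c%:E = ((c ^+ 2)%:E `^ 2^-1)%E by rewrite cE -poweRrM mulfV// poweRe1.
rewrite Lnorm2E; apply: gt0_ler_poweR => //;
  by rewrite in_itv /= ?leey ?andbT ?lee_fin ?int_sqr_ge0 ?sqr_ge0 ?invr_ge0.
Qed.

Lemma Lnorm2_ge (f : T -> R) (c : R) : 0 <= c ->
  ((c ^+ 2)%:E <= \int[mu]_t (f t ^+ 2)%:E)%E -> (c%:E <= 'N[mu]_2%:E[EFin \o f])%E.
Proof.
move=> c0 h; have cE : (c ^+ 2)%:E = (c%:E `^ 2)%E by rewrite poweR_EFin powR_mulrn.
have -> : c%:E = ((c ^+ 2)%:E `^ 2^-1)%E by rewrite cE -poweRrM mulfV// poweRe1.
rewrite Lnorm2E; apply: gt0_ler_poweR => //;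
  by rewrite in_itv /= ?leey ?andbT ?lee_fin ?int_sqr_ge0 ?sqr_ge0 ?invr_ge0.
Qed.

Lemma Lfun2P (f : T -> R) : measurable_fun setT f ->
  (f \in Lfun mu 2%:E) = (\int[mu]_t (f t ^+ 2)%:E < +oo)%E.
Proof.
move=> mf; apply/idP/idP => h.
  have /sub_Lfun_finLfun := h; rewrite inE /= /finite_norm => fin.
  by rewrite -Lnorm2_sqr poweR_lty.
rewrite inE; apply/andP; split; first by rewrite inE.
by rewrite inE /= /finite_norm Lnorm2E poweR_lty.
Qed.
End Isomorphism.

Theorem corollary2p9 (R : realType) (X : completeNormedModType R)
    (K : kothe_space X) (p : R) (hp : 2 < p) (hM : has_M X p) :
  lattice_isomorphic_L2 K.
Proof.
have [w [c [C [c0 C0 mw w0 [Hup Hlow]]]]] := weight K hp hM.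
have mwr r : measurable_fun setT (fun t => w t `^ r).
  exact: (measurableT_comp (measurable_powR r) mw).
(* Multiplication by the square root of [w], written as a power so that it cancels against the
   exponent [- 2^-1] by [powRD]. *)
pose U x t := K x t * w t `^ 2^-1.
have mU x : measurable_fun setT (U x).
  by apply: measurable_funM => //; exact: measurable_frepr.
have UE x : (\int[leb01 R]_t (U x t ^+ 2)%:E = wint w (K x))%E.
  apply: eq_integral => t _; rewrite /U exprMn; congr (_ * _)%:E.
  by rewrite -powR_mulrn ?powR_ge0// -powRrM mulVf// powRr1.
(* The indicator of the zero set of [w] has weighted integral 0, so it represents an element of norm
   0, and the zero set is null. *)
have wn0 : \forall t \ae leb01 R, w t != 0.
  pose A := w @^-1` [set 0].
  have mA : measurable A by rewrite -[A]setTI; exact: mw.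
  have wA : wint w \1_A = 0%E.
    rewrite /wint integral0_eq// => t _; rewrite indicE.
    have [/set_mem /= ->|_] := boolP (t \in A); first by rewrite mulr0.
    by rewrite expr0n mul0r.
  have [||x [xA x0]] := Hlow \1_A; rewrite ?wA//.
  have {}x0 : x = 0.
    move: x0; rewrite wA mule0 lee_fin => x0; apply/eqP.
    by rewrite -normr_eq0 -sqrf_eq0 eq_le x0 sqr_ge0.
  rewrite x0 in xA; apply: filterS2 xA (rep0 K) => t ->.
  rewrite indicE => h; apply/negP => /eqP wt; move: h.
  by rewrite mem_set//= => /eqP; rewrite oner_eq0.
exists U; split.
- move=> x; rewrite Lfun2P// UE; exact: le_lt_trans (Hup x) (ltry _).
- move=> a x y; have := frepr_linear K a x y; apply: filterS => t h _.
  by rewrite /U h// mulrDl mulrA.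
- move=> g gL; have mg : measurable_fun setT g.
    by have := sub_Lfun_mfun gL; rewrite inE.
  (* The inverse image of [g]; it is recovered only where [w] is nonzero, which is almost
     everywhere. *)
  pose f t := g t * w t `^ (- 2^-1).
  have mf : measurable_fun setT f by exact: measurable_funM.
  have [|x [xf _]] := Hlow f mf.
    move: gL; rewrite Lfun2P//; apply: le_lt_trans.
    apply: ae_ge0_le_integral => //; [..|].
    + by move=> t _; rewrite lee_fin mulr_ge0 ?sqr_ge0.
    + exact: measurable_wint.
    + by move=> t _; rewrite lee_fin sqr_ge0.
    + by apply/measurable_EFinP; exact: measurable_funX.
    apply: filterS wn0 => t wt _; rewrite lee_fin /f exprMn -mulrA ler_piMr ?sqr_ge0//.
    by rewrite -powR_mulrn ?powR_ge0// -powRrM mulNr mulVf// powRN powRr1// mulVf.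
  exists x; apply: filterS2 xf wn0 => t h wt _; rewrite /U h /f -mulrA -powRD; last first.
    by rewrite wt implybT.
  by rewrite addNr powRr0 mulr1.
- exists (Num.sqrt C^-1), (Num.sqrt c); split; rewrite ?sqrtr_gt0 ?invr_gt0// => x.
  apply/andP; split.
    apply: Lnorm2_ge; first by rewrite mulr_ge0 ?sqrtr_ge0.
    rewrite UE exprMn sqr_sqrtr ?invr_ge0 ?(ltW C0)//.
    have [|y [xy yx]] := Hlow _ (measurable_frepr K x).
      exact: le_lt_trans (Hup x) (ltry _).
    rewrite -(rep_uniq (rep_refl K x) xy) in yx; rewrite EFinM.
    have -> : wint w (K x) = (C^-1%:E * (C%:E * wint w (K x)))%E.
      by rewrite muleA -EFinM mulVf ?mul1e// gt_eqF.
    by apply: lee_wpmul2l => //; rewrite lee_fin invr_ge0 ltW.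
  rewrite Lnorm2_le ?mulr_ge0 ?sqrtr_ge0// UE exprMn sqr_sqrtr ?(ltW c0)//.
- move=> x y z; split; apply: filterS => t h _; rewrite /U h//=.
    by rewrite maxr_pMl ?powR_ge0.
  by rewrite minr_pMl ?powR_ge0.
Qed.
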